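(* Let $k\ge1$ be an integer and let $\alpha,\beta>0$ satisfy $\alpha\beta=\pi^{2}$. Then \begin{align*} &\alpha^{\frac{k}{2}}\left\{ 2\eta_{k-1}\left(\tfrac{k}{2}\right)+2\gamma-4\log\Phi_k-2\log\left(4\beta\right)+2\sum_{m,n=1}^{\infty}r_{k}(m)\,r_{k}(n)\,K_{0}\left(2\sqrt{mn}\,\alpha\right)\right\}\\ &=\beta^{\frac{k}{2}}\left\{ 2 \eta_{k-1}\left(\tfrac{k}{2}\right)+2\gamma-4\log\Phi_k-2\log\left(4\alpha\right)+2\sum_{m,n=1}^{\infty}r_{k}(m)\,r_{k}(n)\,K_{0}\left(2\sqrt{mn}\,\beta\right)\right\}, \end{align*} where $\Phi_k:=\prod_{\mathbf{m}\in\mathbb{Z}^{k-1}\setminus\{\mathbf{0}\}}\left(1-e^{-2\pi|\mathbf{m}|}\right)$.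
   Context: For integers $j\geq1$ and $n\geq 0$, $r_j(n)$ is the number of $(n_1,\dots,n_j)\in\mathbb{Z}^j$ with $n_1^2+\dots+n_j^2=n$, $\zeta_j(s)=\sum_{n=1}^\infty r_j(n)n^{-s}$ for $\mathrm{Re}(s)>j/2$, and $\eta_j(s):=\pi^{-s}\Gamma(s)\zeta_j(s)$; thus $\eta_{k-1}(k/2)=\pi^{-k/2}\Gamma(k/2)\zeta_{k-1}(k/2)$. Conventions for $k=1$: $\zeta_0=\eta_0:=0$ and the empty product $\Phi_1:=1$. $|\mathbf{m}|$ is the Euclidean norm, $\gamma$ the Euler–Mascheroni constant, and $K_0$ the modified Bessel function of the second kind. *)

(* Defs.v *)
From Stdlib Require Import Reals ZArith List.
From Coquelicot Require Import Coquelicot.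
Import ListNotations.
Open Scope R_scope.

Fixpoint tuples (j : nat) (l : list Z) : list (list Z) :=
  match j with
  | O => [nil]
  | S j' => flat_map (fun a => map (cons a) (tuples j' l)) l
  end.

Definition zrange (N : nat) : list Z :=
  map (fun i => (Z.of_nat i - Z.of_nat N)%Z) (seq 0 (2 * N + 1)).

Definition sumsq (v : list Z) : Z := fold_right (fun a s => (a * a + s)%Z) 0%Z v.

(* r_j(n) = #{ v in Z^j : |v|^2 = n }; every such v has entries in [-n, n]. *)
Definition r (j n : nat) : nat :=
  length (filter (fun v => Z.eqb (sumsq v) (Z.of_nat n)) (tuples j (zrange n))).

Definition zeta (j : nat) (s : R) : R :=
  Series (fun n => INR (r j (S n)) * Rpower (INR (S n)) (- s)).

Definition Gamma (s : R) : R :=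
  real (Lim_seq (fun N => RInt (fun t => Rpower t (s - 1) * exp (- t))
                                (/ INR (S N)) (INR (S N)))).

Definition eta (j : nat) (s : R) : R := Rpower PI (- s) * Gamma s * zeta j s.

Definition euler_gamma : R :=
  real (Lim_seq (fun N => sum_n (fun i => / INR (S i)) N - ln (INR (S N)))).

Definition K0 (x : R) : R :=
  real (Lim_seq (fun N => RInt (fun t => exp (- x * cosh t)) 0 (INR N))).

Definition is_zero_vec (v : list Z) : bool := forallb (fun a => Z.eqb a 0) v.

Definition Phi (k : nat) : R :=
  real (Lim_seq (fun N =>
    fold_right Rmult 1
      (map (fun v => 1 - exp (- 2 * PI * sqrt (IZR (sumsq v))))
           (filter (fun v => negb (is_zero_vec v)) (tuples (k - 1) (zrange N)))))).

(* sum_{m,n >= 1} r_k(m) r_k(n) K_0(2 sqrt(mn) x)  (nonnegative terms) *)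
Definition bessel_sum (k : nat) (x : R) : R :=
  Series (fun m => Series (fun n =>
    INR (r k (S m)) * INR (r k (S n)) * K0 (2 * sqrt (INR (S m) * INR (S n)) * x))).

Definition bracket (k : nat) (a b : R) : R :=
  2 * eta (k - 1) (INR k / 2) + 2 * euler_gamma - 4 * ln (Phi k)
  - 2 * ln (4 * b) + 2 * bessel_sum k a.

(* Main.v *)
Require Import Defs.
From Stdlib Require Import Reals ZArith List Lra Lia Psatz FinFun.
From Stdlib Require Import Classical_Prop ClassicalEpsilon FunctionalExtensionality.
From Coquelicot Require Import Coquelicot.
Import ListNotations.
Open Scope R_scope.

(* Let [theta x] be the sum of [exp (- pi n^2 x)] over all integers [n], and
   write [alpha = pi e^c], [beta = pi e^(-c)]. The double Bessel series is half
   the integral over [s] of [(theta(e^(c+s))^k - 1) (theta(e^(c-s))^k - 1)].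
   Up to the factor [e^(kc/2)] the product of the two powers of [theta] is even
   in [c], by Poisson summation, so that only the linear terms contribute to the
   difference of the two sides; they produce the constant term of
   [pi^(-s) Gamma(s) zeta_k(s)] at its pole [s = k/2]. This constant is computed
   by writing [theta^k = theta^(k-1) theta] and expanding both factors, one of
   them after a Poisson summation: the resulting Bessel functions have order 1/2
   and are elementary, and their sum is the logarithm of [Phi_k]. *)

(* [RInt] lands in a canonical-structure carrier that [ring] and [field] do not unfold. *)
Ltac toR := match goal with |- @eq _ ?a ?b => change (@eq R a b) end.

(** No analytic continuation enters: the constant term at the pole is itself a convergent real
    integral. In the variable u = log x a dilation is a shift and x -> 1/x a reflection, and
    e^(ku/2) (theta(e^u)^k - 1) tends to 1 at minus infinity and to 0 at plus infinity. Subtracting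
    the indicator [step] of u < 0, which accounts for the polar part 1/(s - k/2), makes it
    integrable. Its integral splits into three, with values - 2 log Phi_k, eta_{k-1}(k/2) and gamma
    - log(4 pi), the last being the case k = 1. [Series], [Lim_seq] and [RInt] are total functions,
    so every identity has to come with a proof of convergence. Interchanges therefore use series of
    nonnegative continuous functions with integrable sum: there the convergence of the zeta, Bessel
    and log Phi_k series is a conclusion. The even product of theta powers grows exponentially and
    has no integral over the line. The two sides are compared on windows [-n, n], where the large
    boundary terms cancel before n tends to infinity. *)

(** * Series: tails and dominated limits *)

Lemma is_series_R (a : nat -> R) (l : R) :
  is_series a l <-> is_lim_seq (sum_n a) l.
Proof. split; intros H; exact H. Qed.

Lemma series_tail_small (M : nat -> R) (eps : R) :
  ex_series M -> (forall n, 0 <= M n) -> 0 < eps ->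
  exists N, Series (fun k => M (S N + k)%nat) < eps.
Proof.
  intros HM Hp He.
  assert (H : is_lim_seq (sum_n M) (Series M)) by (apply Series_correct; exact HM).
  apply is_lim_seq_spec in H. destruct (H (mkposreal eps He)) as [N HN].
  exists N. specialize (HN N (le_n _)). simpl in HN.
  rewrite (Series_incr_n M (S N)) in HN by (auto with arith || exact HM).
  simpl Init.Nat.pred in HN. rewrite sum_n_Reals in HN.
  apply Rabs_def2 in HN. destruct HN as [_ HN]. simpl in *. lra.
Qed.

Lemma Series_tail_bound (a M : nat -> R) (N : nat) :
  (forall n, Rabs (a n) <= M n) -> ex_series M ->
  Rabs (Series a - sum_n a N) <= Series (fun k => M (S N + k)%nat).
Proof.
  intros Ha HM.
  assert (Ea : ex_series a) by (apply (ex_series_le a M); [exact Ha|exact HM]).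
  rewrite (Series_incr_n a (S N)) by (auto with arith || exact Ea).
  simpl Init.Nat.pred. rewrite sum_n_Reals.
  replace (sum_f_R0 a N + Series (fun k => a (S N + k)%nat) - sum_f_R0 a N)
    with (Series (fun k => a (S N + k)%nat)) by ring.
  assert (EM : ex_series (fun k => M (S N + k)%nat)) by (apply ex_series_incr_n; exact HM).
  assert (EA : ex_series (fun k => Rabs (a (S N + k)%nat))).
  { apply (ex_series_le (fun k => Rabs (a (S N + k)%nat)) (fun k => M (S N + k)%nat)); [|exact EM].
    intros n. unfold norm; simpl. unfold abs; simpl. rewrite Rabs_Rabsolu. apply Ha. }
  eapply Rle_trans; [apply Series_Rabs; exact EA|].
  apply Series_le; [|exact EM]. intros n; split; [apply Rabs_pos|apply Ha].
Qed.

Lemma filterlim_R_eps {T : Type} (F : (T -> Prop) -> Prop) {FF : Filter F}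
  (f : T -> R) (l eps : R) :
  filterlim f F (locally l) -> 0 < eps -> F (fun t => Rabs (f t - l) < eps).
Proof. intros H He. exact (proj1 (filterlim_locally f l) H (mkposreal eps He)). Qed.

Lemma filterlim_sum_n {T : Type} (F : (T -> Prop) -> Prop) {FF : Filter F}
  (f : nat -> T -> R) (l : nat -> R) (N : nat) :
  (forall n, filterlim (f n) F (locally (l n))) ->
  filterlim (fun t => sum_n (fun n => f n t) N) F (locally (sum_n l N)).
Proof.
  intros H. induction N as [|N IH].
  - apply (filterlim_ext (f 0%nat)); [intros t; now rewrite sum_O|]. rewrite sum_O. apply H.
  - apply (filterlim_ext (fun t => plus (sum_n (fun n => f n t) N) (f (S N) t)));
      [intros t; now rewrite sum_Sn|]. rewrite sum_Sn.
    eapply filterlim_comp_2; [exact IH|exact (H (S N))|].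
    apply (filterlim_plus (sum_n l N) (l (S N))).
Qed.

(** Dominated convergence for series: the first [N] terms converge, and the tails of [f] and of [l]
    are both at most the tail of [M]. An arbitrary filter lets it serve at a point (continuity of
    theta) and along [eventually] (Poisson summation, Euler's constant). *)
Lemma tannery {T : Type} (F : (T -> Prop) -> Prop) {FF : ProperFilter F}
  (f : nat -> T -> R) (l M : nat -> R) :
  (forall n, filterlim (f n) F (locally (l n))) ->
  F (fun t => forall n, Rabs (f n t) <= M n) -> ex_series M ->
  filterlim (fun t => Series (fun n => f n t)) F (locally (Series l)).
Proof.
  intros Hl HM EM.
  assert (Hp : forall n, 0 <= M n).
  { intros n. destruct (filter_ex _ HM) as [t Ht]. eapply Rle_trans; [apply Rabs_pos|apply (Ht n)]. }
  (* The limits inherit the majorant: a violation would persist at some [t] of the filter. *)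
  assert (HlM : forall n, Rabs (l n) <= M n).
  { intros n. apply Rnot_lt_le. intros Hlt.
    assert (He : 0 < Rabs (l n) - M n) by lra.
    assert (H1 := Hl n).
    apply (fun H => filterlim_R_eps F _ _ _ H He) in H1.
    destruct (filter_ex _ (filter_and _ _ H1 HM)) as [t [Ht1 Ht2]].
    specialize (Ht2 n).
    assert (T1 := Rabs_triang_inv (l n) (f n t)).
    rewrite (Rabs_minus_sym (l n) (f n t)) in T1. lra. }
  apply filterlim_locally. intros eps.
  (* One quarter for the head and one for each of the two tails. *)
  assert (He3 : 0 < eps / 4) by (destruct eps; simpl; lra).
  destruct (series_tail_small M (eps / 4) EM Hp He3) as [N HN].
  assert (HS := filterlim_sum_n F f l N Hl).
  apply (fun H => filterlim_R_eps F _ _ _ H He3) in HS.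
  generalize (filter_and _ _ HS HM). apply filter_imp. intros t [H1 H2].
  change (Rabs (Series (fun n => f n t) - Series l) < eps).
  assert (B1 := Series_tail_bound (fun n => f n t) M N H2 EM).
  assert (B2 := Series_tail_bound l M N HlM EM).
  unfold Rabs in *; repeat destruct Rcase_abs; lra.
Qed.

Lemma continuous_Series (f : nat -> R -> R) (M : nat -> R) (x : R) :
  (forall n, continuous (f n) x) ->
  locally x (fun t => forall n, Rabs (f n t) <= M n) -> ex_series M ->
  continuous (fun t => Series (fun n => f n t)) x.
Proof. intros Hf HM EM. apply (tannery (locally x) f (fun n => f n x) M); assumption. Qed.

Lemma is_series_le_bound (a : nat -> R) (l : R) (N : nat) :
  (forall n, 0 <= a n) -> is_series a l -> sum_n a N <= l.
Proof.
  intros Ha Hl.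
  assert (E : ex_series a) by (exists l; exact Hl).
  rewrite <- (is_series_unique a l Hl).
  rewrite (Series_incr_n a (S N)) by (auto with arith || exact E).
  simpl Init.Nat.pred. rewrite sum_n_Reals.
  assert (0 <= Series (fun k => a (S N + k)%nat)).
  { rewrite <- (Rmult_0_l (Series (fun _ => 0))), <- Series_scal_l.
    apply Series_le; [intros n; rewrite Rmult_0_l; split; [lra|apply Ha]|].
    apply ex_series_incr_n; exact E. }
  lra.
Qed.

(** * Riemann integrals *)

Lemma RInt_plus_R (f g : R -> R) (a b : R) :
  ex_RInt f a b -> ex_RInt g a b ->
  RInt (fun x => f x + g x) a b = RInt f a b + RInt g a b.
Proof. intros Hf Hg. apply (RInt_plus f g a b Hf Hg). Qed.

Lemma RInt_minus_R (f g : R -> R) (a b : R) :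
  ex_RInt f a b -> ex_RInt g a b ->
  RInt (fun x => f x - g x) a b = RInt f a b - RInt g a b.
Proof. intros Hf Hg. apply (RInt_minus f g a b Hf Hg). Qed.

Lemma RInt_scal_R (f : R -> R) (c a b : R) :
  ex_RInt f a b -> RInt (fun x => c * f x) a b = c * RInt f a b.
Proof. intros Hf. apply (RInt_scal f a b c Hf). Qed.

Lemma RInt_Chasles_R (f : R -> R) (a b c : R) :
  ex_RInt f a b -> ex_RInt f b c -> RInt f a b + RInt f b c = RInt f a c.
Proof. intros H1 H2. apply (RInt_Chasles f a b c H1 H2). Qed.

Lemma RInt_const_R (c a b : R) : RInt (fun _ => c) a b = (b - a) * c.
Proof. apply (RInt_const a b c). Qed.

Lemma ex_RInt_cont (f : R -> R) (a b : R) :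
  (forall x, continuous f x) -> ex_RInt f a b.
Proof. intros H. apply (ex_RInt_continuous (V := R_CompleteNormedModule)). intros z _. apply H. Qed.

Lemma RInt_derive_R (F f : R -> R) (a b : R) :
  (forall x, is_derive F x (f x)) -> (forall x, continuous f x) ->
  RInt f a b = F b - F a.
Proof.
  intros HF Hf. apply is_RInt_unique.
  apply (is_RInt_derive F f); intros x _; [apply HF|apply Hf].
Qed.

Lemma ex_RInt_shift (f : R -> R) (c a b : R) :
  ex_RInt f (a + c) (b + c) -> ex_RInt (fun x => f (x + c)) a b.
Proof.
  intros H. apply ex_RInt_ext with (fun x => scal 1 (f (1 * x + c))).
  - intros x _. change (1 * f (1 * x + c) = f (x + c)). now rewrite !Rmult_1_l.
  - apply (ex_RInt_comp_lin f 1 c). rewrite !Rmult_1_l. exact H.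
Qed.

Lemma RInt_shift (f : R -> R) (c a b : R) :
  ex_RInt f (a + c) (b + c) -> RInt (fun x => f (x + c)) a b = RInt f (a + c) (b + c).
Proof.
  intros H. assert (E := RInt_comp_lin f 1 c a b). rewrite !Rmult_1_l in E.
  rewrite <- (E H). apply RInt_ext.
  intros x _. change (f (x + c) = 1 * f (1 * x + c)). now rewrite !Rmult_1_l.
Qed.

Lemma ex_RInt_reflect (f : R -> R) (a b : R) :
  ex_RInt f (- b) (- a) -> ex_RInt (fun x => f (- x)) a b.
Proof.
  intros H. apply ex_RInt_ext with (fun x => opp (opp (f (- x)))).
  - intros x _. apply Ropp_involutive.
  - apply (ex_RInt_opp (fun y => opp (f (- y)))). apply (ex_RInt_comp_opp (V := R_NormedModule) f a b).
    apply ex_RInt_swap. exact H.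
Qed.

Lemma RInt_reflect (f : R -> R) (a b : R) :
  ex_RInt f (- b) (- a) -> RInt (fun x => f (- x)) a b = RInt f (- b) (- a).
Proof.
  intros H. apply is_RInt_unique.
  apply is_RInt_ext with (fun x => opp (opp (f (- x)))).
  - intros x _. apply Ropp_involutive.
  - rewrite <- (Ropp_involutive (RInt f (- b) (- a))).
    apply (is_RInt_opp (fun y => opp (f (- y)))).
    apply (is_RInt_comp_opp (V := R_NormedModule) f a b). apply (is_RInt_swap (V := R_NormedModule)).
    apply (RInt_correct f). exact H.
Qed.

Lemma RInt_abs_bound (f g : R -> R) (a b : R) :
  a <= b -> ex_RInt f a b -> ex_RInt g a b -> (forall x, a <= x <= b -> Rabs (f x) <= g x) ->
  Rabs (RInt f a b) <= RInt g a b.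
Proof.
  intros Hab Hf Hg H.
  apply (norm_RInt_le f g a b (RInt f a b) (RInt g a b) Hab H);
    [apply (RInt_correct f)|apply (RInt_correct g)]; assumption.
Qed.

Lemma RInt_sum_n (f : nat -> R -> R) (N : nat) (a b : R) :
  (forall n, ex_RInt (f n) a b) ->
  ex_RInt (fun x => sum_n (fun n => f n x) N) a b /\
  RInt (fun x => sum_n (fun n => f n x) N) a b = sum_n (fun n => RInt (f n) a b) N.
Proof.
  intros H. induction N as [|N [IH1 IH2]].
  - split.
    + apply ex_RInt_ext with (f 0%nat); [|apply H]. intros x _. now rewrite sum_O.
    + rewrite sum_O. apply RInt_ext. intros x _. now rewrite sum_O.
  - split.
    + apply ex_RInt_ext with (fun x => plus (sum_n (fun n => f n x) N) (f (S N) x)).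
      * intros x _. now rewrite sum_Sn.
      * apply (ex_RInt_plus (fun x => sum_n (fun n => f n x) N) (f (S N))); [exact IH1|apply H].
    + rewrite sum_Sn, <- IH2. rewrite <- (RInt_plus (fun x => sum_n (fun n => f n x) N) (f (S N))).
      * apply RInt_ext. intros x _. now rewrite sum_Sn.
      * exact IH1.
      * apply H.
Qed.

(** * Improper integrals over the real line *)

(** The endpoints go to infinity independently: symmetric windows alone would give a principal
    value, which a shift can change. As a relation it carries existence and value together, and
    integrability on bounded intervals discharges the side conditions of [RInt_Chasles_R]. *)
Definition integ (f : R -> R) (l : R) : Prop :=
  (forall a b, ex_RInt f a b) /\
  forall eps, 0 < eps -> exists A, forall a b, a <= - A -> A <= b -> Rabs (RInt f a b - l) < eps.

Lemma integ_unique (f : R -> R) (l l' : R) : integ f l -> integ f l' -> l = l'.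
Proof.
  intros [_ H] [_ H'].
  destruct (Req_dec l l') as [E|E]; [exact E|exfalso].
  assert (He : 0 < Rabs (l - l') / 2) by (assert (0 < Rabs (l - l')) by (apply Rabs_pos_lt; lra); lra).
  destruct (H _ He) as [A HA]. destruct (H' _ He) as [B HB].
  pose (m := Rmax A B).
  assert (A <= m) by apply Rmax_l. assert (B <= m) by apply Rmax_r.
  specialize (HA (- m) m ltac:(lra) ltac:(lra)). specialize (HB (- m) m ltac:(lra) ltac:(lra)).
  assert (T := Rabs_triang (l - RInt f (- m) m) (RInt f (- m) m - l')).
  replace (l - RInt f (- m) m + (RInt f (- m) m - l')) with (l - l') in T by ring.
  rewrite (Rabs_minus_sym l (RInt f (- m) m)) in T. lra.
Qed.

Lemma integ_ext (f g : R -> R) (l : R) : (forall x, f x = g x) -> integ f l -> integ g l.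
Proof. intros E H. replace g with f; [exact H|]. apply functional_extensionality. exact E. Qed.

Lemma integ_plus (f g : R -> R) (l m : R) :
  integ f l -> integ g m -> integ (fun x => f x + g x) (l + m).
Proof.
  intros [Ef Hf] [Eg Hg]. split; [intros a b; apply (ex_RInt_plus f g); auto|].
  intros eps He. destruct (Hf (eps / 2)) as [A HA]; [lra|]. destruct (Hg (eps / 2)) as [B HB]; [lra|].
  exists (Rmax A B). intros a b Ha Hb.
  assert (A <= Rmax A B) by apply Rmax_l. assert (B <= Rmax A B) by apply Rmax_r.
  rewrite RInt_plus_R by auto.
  specialize (HA a b ltac:(lra) ltac:(lra)). specialize (HB a b ltac:(lra) ltac:(lra)).
  apply Rabs_def2 in HA. apply Rabs_def2 in HB. apply Rabs_def1; lra.
Qed.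

Lemma integ_scal (f : R -> R) (l c : R) : integ f l -> integ (fun x => c * f x) (c * l).
Proof.
  intros [Ef Hf]. split; [intros a b; apply (ex_RInt_scal f); auto|].
  intros eps He.
  assert (Hc := Rabs_pos c).
  destruct (Hf (eps / (Rabs c + 1))) as [A HA]; [apply Rdiv_lt_0_compat; lra|].
  exists A. intros a b Ha Hb. rewrite RInt_scal_R by auto.
  rewrite <- Rmult_minus_distr_l, Rabs_mult.
  specialize (HA a b Ha Hb). assert (P := Rabs_pos (RInt f a b - l)).
  apply Rle_lt_trans with ((Rabs c) * (eps / (Rabs c + 1))).
  - apply Rmult_le_compat_l; lra.
  - apply Rlt_le_trans with ((Rabs c + 1) * (eps / (Rabs c + 1))).
    + apply Rmult_lt_compat_r; [apply Rdiv_lt_0_compat|]; lra.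
    + right; field; lra.
Qed.

Lemma integ_minus (f g : R -> R) (l m : R) :
  integ f l -> integ g m -> integ (fun x => f x - g x) (l - m).
Proof.
  intros Hf Hg. replace (l - m) with (l + (-1) * m) by ring.
  apply integ_ext with (fun x => f x + (-1) * g x); [intros x; ring|].
  apply integ_plus; [exact Hf|]. apply integ_scal; exact Hg.
Qed.

Lemma integ_shift (f : R -> R) (l c : R) : integ f l -> integ (fun x => f (x + c)) l.
Proof.
  intros [Ef Hf]. split; [intros a b; apply ex_RInt_shift; auto|].
  intros eps He. destruct (Hf eps He) as [A HA]. exists (A + Rabs c). intros a b Ha Hb.
  rewrite RInt_shift by auto.
  assert (c <= Rabs c) by apply Rle_abs. assert (- c <= Rabs c) by (rewrite <- Rabs_Ropp; apply Rle_abs).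
  apply HA; lra.
Qed.

Lemma integ_reflect (f : R -> R) (l : R) : integ f l -> integ (fun x => f (- x)) l.
Proof.
  intros [Ef Hf]. split; [intros a b; apply ex_RInt_reflect; auto|].
  intros eps He. destruct (Hf eps He) as [A HA]. exists A. intros a b Ha Hb.
  rewrite RInt_reflect by auto. apply HA; lra.
Qed.

Lemma integ_le (f g : R -> R) (l m : R) :
  (forall x, f x <= g x) -> integ f l -> integ g m -> l <= m.
Proof.
  intros Hfg [Ef Hf] [Eg Hg]. apply Rnot_lt_le. intros Hlt.
  destruct (Hf ((l - m) / 2)) as [A HA]; [lra|]. destruct (Hg ((l - m) / 2)) as [B HB]; [lra|].
  pose (M := Rmax 0 (Rmax A B)).
  assert (Rmax A B <= M) by apply Rmax_r. assert (0 <= M) by apply Rmax_l.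
  assert (A <= Rmax A B) by apply Rmax_l. assert (B <= Rmax A B) by apply Rmax_r.
  specialize (HA (- M) M ltac:(lra) ltac:(lra)). specialize (HB (- M) M ltac:(lra) ltac:(lra)).
  apply Rabs_def2 in HA. apply Rabs_def2 in HB.
  assert (RInt f (- M) M <= RInt g (- M) M) by (apply RInt_le; auto; lra). lra.
Qed.

Lemma RInt_le_integ (f : R -> R) (l a b : R) :
  (forall x, 0 <= f x) -> a <= b -> integ f l -> RInt f a b <= l.
Proof.
  intros Hp Hab [Ef Hf]. apply Rnot_lt_le. intros Hlt.
  destruct (Hf (RInt f a b - l)) as [A HA]; [lra|].
  assert (Hm1 := Rmin_l a (- A)). assert (Hm2 := Rmin_r a (- A)).
  assert (Hm3 := Rmax_l b A). assert (Hm4 := Rmax_r b A).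
  specialize (HA (Rmin a (- A)) (Rmax b A) Hm2 Hm4).
  rewrite <- (RInt_Chasles_R f _ a) in HA by auto.
  rewrite <- (RInt_Chasles_R f a b) in HA by auto.
  assert (0 <= RInt f (Rmin a (- A)) a) by (apply RInt_ge_0; auto).
  assert (0 <= RInt f b (Rmax b A)) by (apply RInt_ge_0; auto).
  apply Rabs_def2 in HA. lra.
Qed.

Lemma is_lim_seq_RInt_integ (f : R -> R) (l : R) (a b : nat -> R) :
  integ f l -> is_lim_seq a m_infty -> is_lim_seq b p_infty ->
  is_lim_seq (fun n => RInt f (a n) (b n)) l.
Proof.
  intros [Ef Hf] Ha Hb. apply is_lim_seq_spec. intros eps.
  destruct (Hf eps (cond_pos eps)) as [A HA].
  apply is_lim_seq_spec in Ha. apply is_lim_seq_spec in Hb.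
  destruct (Ha (- A)) as [N HN]. destruct (Hb A) as [N' HN'].
  exists (N + N')%nat. intros n Hn. apply HA; left; [apply HN|apply HN']; lia.
Qed.

Lemma RInt_exp_bound (f : R -> R) (C d a b : R) :
  0 < d -> 0 <= C -> a <= b -> ex_RInt f a b ->
  (forall u, Rabs (f u) <= C * exp (- d * u)) ->
  Rabs (RInt f a b) <= C / d * exp (- d * a).
Proof.
  intros Hd HC Hab Ef Hf.
  assert (Hc : forall x, continuous (fun u => C * exp (- d * u)) x).
  { intros x. apply (ex_derive_continuous (fun u => C * exp (- d * u))). auto_derive. auto. }
  eapply Rle_trans; [apply (RInt_abs_bound f (fun u => C * exp (- d * u)));
    [exact Hab|exact Ef|apply ex_RInt_cont; exact Hc|intros; apply Hf]|].
  rewrite (RInt_derive_R (fun u => - (C / d) * exp (- d * u))).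
  - assert (0 <= C / d * exp (- d * b)).
    { apply Rmult_le_pos; [apply Rdiv_le_0_compat; lra|left; apply exp_pos]. }
    lra.
  - intros x. auto_derive; [auto|]. field. lra.
  - exact Hc.
Qed.

Lemma RInt_exp_bound_left (f : R -> R) (C d a b : R) :
  0 < d -> 0 <= C -> a <= b -> ex_RInt f a b ->
  (forall u, Rabs (f u) <= C * exp (d * u)) ->
  Rabs (RInt f a b) <= C / d * exp (d * b).
Proof.
  intros Hd HC Hab Ef Hf.
  assert (E := RInt_reflect (fun x => f (- x)) a b).
  rewrite (RInt_ext _ f) in E by (intros; now rewrite Ropp_involutive).
  assert (E1 : ex_RInt (fun x => f (- x)) (- b) (- a)).
  { apply ex_RInt_reflect. now rewrite !Ropp_involutive. }
  rewrite (E E1). replace (d * b) with (- d * (- b)) by ring.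
  apply RInt_exp_bound; auto; [lra|].
  intros u. eapply Rle_trans; [apply Hf|]. right. do 2 f_equal. ring.
Qed.

Lemma exp_neg_small (C d eps : R) : 0 < d -> 0 <= C -> 0 < eps ->
  exists A, 0 <= A /\ forall x, A <= x -> C * exp (- d * x) < eps.
Proof.
  intros Hd HC He. exists (C / (d * eps)). split.
  { apply Rdiv_le_0_compat; [lra|]. now apply Rmult_lt_0_compat. }
  intros x Hx.
  assert (H1 : C / eps <= d * x).
  { apply Rle_trans with (d * (C / (d * eps))); [right; field; lra|].
    apply Rmult_le_compat_l; lra. }
  assert (H2 : C / eps < exp (d * x)) by (assert (H3 := exp_ineq1_le (d * x)); lra).
  replace (- d * x) with (- (d * x)) by ring. rewrite exp_Ropp.
  apply Rmult_lt_reg_r with (exp (d * x)); [apply exp_pos|].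
  rewrite Rmult_assoc, Rinv_l, Rmult_1_r by (apply Rgt_not_eq, exp_pos).
  apply Rmult_lt_reg_l with (/ eps); [apply Rinv_0_lt_compat; lra|].
  rewrite <- Rmult_assoc, Rinv_l, Rmult_1_l by lra. unfold Rdiv in H2. lra.
Qed.

(** The two bounds together mean decay like e^(-d |u|), so the windows form a Cauchy family. The
    explicit bound on the value, C / d from each half-line, later measures the error made by
    removing a damping factor. *)
Lemma integ_exp_bound (f : R -> R) (C d : R) :
  0 < d -> (forall a b, ex_RInt f a b) ->
  (forall u, Rabs (f u) <= C * exp (- d * u)) -> (forall u, Rabs (f u) <= C * exp (d * u)) ->
  exists l, integ f l /\ Rabs l <= 2 * C / d.
Proof.
  intros Hd Ef Hr Hl.
  assert (HC : 0 <= C).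
  { assert (H := Hr 0). rewrite Rmult_0_r, exp_0 in H. assert (P := Rabs_pos (f 0)). lra. }
  assert (Hcau : forall eps, 0 < eps -> exists A, 0 <= A /\ forall a b a' b',
     a <= - A -> a' <= - A -> A <= b -> A <= b' -> Rabs (RInt f a b - RInt f a' b') < eps).
  { intros eps He.
    destruct (exp_neg_small (C / d) d (eps / 4) Hd) as [A [HA0 HA]]; [apply Rdiv_le_0_compat; lra|lra|].
    assert (Hright : forall b, A <= b -> Rabs (RInt f A b) < eps / 4).
    { intros b Hb. eapply Rle_lt_trans; [apply (RInt_exp_bound f C d); auto|]. apply HA; lra. }
    assert (Hleft : forall a, a <= - A -> Rabs (RInt f a (- A)) < eps / 4).
    { intros a Ha. eapply Rle_lt_trans; [apply (RInt_exp_bound_left f C d); auto|].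
      replace (d * - A) with (- d * A) by ring. apply HA; lra. }
    exists A. split; [exact HA0|]. intros a b a' b' Ha Ha' Hb Hb'.
    rewrite <- (RInt_Chasles_R f a (- A) b), <- (RInt_Chasles_R f (- A) A b),
      <- (RInt_Chasles_R f a' (- A) b'), <- (RInt_Chasles_R f (- A) A b') by auto.
    assert (H1 := Hright b Hb). assert (H2 := Hright b' Hb').
    assert (H3 := Hleft a Ha). assert (H4 := Hleft a' Ha').
    apply Rabs_def2 in H1. apply Rabs_def2 in H2. apply Rabs_def2 in H3. apply Rabs_def2 in H4.
    apply Rabs_def1; lra. }
  pose (u := fun n => RInt f (- INR n) (INR n)).
  assert (Hu : ex_finite_lim_seq u).
  { apply ex_lim_seq_cauchy_corr. intros eps. destruct (Hcau eps (cond_pos eps)) as [A [HA0 HA]].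
    destruct (nfloor_ex A HA0) as [N [_ HN]]. exists (S N). intros n m Hn Hm.
    apply le_INR in Hn. apply le_INR in Hm. rewrite S_INR in Hn, Hm. apply HA; lra. }
  destruct Hu as [l Hlim]. exists l. split.
  - split; [exact Ef|]. intros eps He.
    destruct (Hcau (eps / 2)) as [A [HA0 HA]]; [lra|]. exists A. intros a b Ha Hb.
    assert (Hlim2 := Hlim). apply is_lim_seq_spec in Hlim2.
    assert (He2 : 0 < eps / 2) by lra.
    destruct (Hlim2 (mkposreal _ He2)) as [N HN].
    destruct (nfloor_ex A HA0) as [N' [_ HN']].
    pose (n := (N + S N')%nat). specialize (HN n ltac:(unfold n; lia)). simpl in HN.
    assert (Hn : A <= INR n).
    { unfold n. rewrite plus_INR, S_INR. assert (0 <= INR N) by apply pos_INR. lra. }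
    specialize (HA a b (- INR n) (INR n) Ha ltac:(lra) Hb Hn). unfold u in HN.
    apply Rabs_def2 in HA. apply Rabs_def2 in HN. apply Rabs_def1; lra.
  - assert (Hb : forall n, Rabs (u n) <= 2 * C / d).
    { intros n. unfold u. rewrite <- (RInt_Chasles_R f _ 0) by auto.
      eapply Rle_trans; [apply Rabs_triang|].
      assert (P := pos_INR n).
      assert (H1 := RInt_exp_bound f C d 0 (INR n) Hd HC P (Ef _ _) Hr).
      assert (H2 := RInt_exp_bound_left f C d (- INR n) 0 Hd HC ltac:(lra) (Ef _ _) Hl).
      rewrite Rmult_0_r, exp_0, Rmult_1_r in H1, H2. lra. }
    apply is_lim_seq_abs in Hlim.
    apply (is_lim_seq_le (fun n => Rabs (u n)) (fun _ => 2 * C / d) (Rabs l) (2 * C / d) Hb Hlim).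
    apply is_lim_seq_const.
Qed.

Lemma integ_even_half (f : R -> R) (l : R) (b : nat -> R) :
  (forall x, f (- x) = f x) -> integ f l -> is_lim_seq b p_infty ->
  is_lim_seq (fun n => RInt f 0 (b n)) (l / 2).
Proof.
  intros Hev Hf Hb.
  assert (H : is_lim_seq (fun n => / 2 * RInt f (- b n) (b n)) (/ 2 * l)).
  { apply (is_lim_seq_scal_l _ (/ 2) l). apply is_lim_seq_RInt_integ; auto.
    apply (is_lim_seq_opp b p_infty). exact Hb. }
  replace (l / 2) with (/ 2 * l) by field.
  eapply is_lim_seq_ext; [|exact H]. intros n. cbv beta. destruct Hf as [Ef _].
  rewrite <- (RInt_Chasles_R f (- b n) 0 (b n)) by auto.
  rewrite <- (RInt_ext (fun x => f (- x)) f (- b n) 0) by (intros; apply Hev).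
  rewrite RInt_reflect by auto. rewrite Ropp_0, Ropp_involutive. field.
Qed.

(** * Dini's theorem and termwise integration *)

(** Near each [t] some index [N t] works, by continuity of [s (N t)] and [f]; finitely many such
    neighbourhoods cover the interval, and monotonicity allows the largest of their indices
    everywhere. *)
Lemma dini (s : nat -> R -> R) (f : R -> R) (a b eps : R) :
  (forall n x, continuous (s n) x) -> (forall x, continuous f x) ->
  (forall n x, s n x <= s (S n) x) -> (forall x, is_lim_seq (fun n => s n x) (f x)) -> 0 < eps ->
  exists N, forall x, a <= x <= b -> f x - s N x < eps.
Proof.
  intros Cs Cf Hmono Hlim He.
  assert (Hm : forall n m x, (n <= m)%nat -> s n x <= s m x).
  { intros n m x H. induction H; [lra|]. eapply Rle_trans; [exact IHle|apply Hmono]. }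
  assert (H : forall t, exists Nd : nat * posreal,
     forall x, Rabs (x - t) < snd Nd -> f x - s (fst Nd) x < eps).
  { intros t. assert (Ht := Hlim t). apply is_lim_seq_spec in Ht.
    assert (He2 : 0 < eps / 2) by lra.
    destruct (Ht (mkposreal _ He2)) as [N HN]. specialize (HN N (le_n _)). simpl in HN.
    assert (Cd : continuous (fun x => minus (f x) (s N x)) t).
    { apply (continuous_minus f (s N)); auto. }
    apply (fun H => filterlim_R_eps (locally t) _ _ _ H He2) in Cd.
    destruct Cd as [d Hd]. exists (N, d). intros x Hx. simpl in *. specialize (Hd x Hx).
    unfold minus, plus, opp in Hd; simpl in Hd.
    apply Rabs_def2 in Hd. apply Rabs_def2 in HN. lra. }
  pose (N := fun t => fst (proj1_sig (constructive_indefinite_description _ (H t)))).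
  pose (d := fun t => snd (proj1_sig (constructive_indefinite_description _ (H t)))).
  assert (HNd : forall t x, Rabs (x - t) < d t -> f x - s (N t) x < eps).
  { intros t x. unfold N, d. destruct (constructive_indefinite_description _ (H t)) as [Nd P]. apply P. }
  apply NNPP. intros Hno.
  (* Compactness is stated for tuples, hence the pairs with [tt], and its conclusion is doubly
     negated, hence the argument by contradiction. *)
  apply (compactness_list 1 (a, tt) (b, tt) (fun t => d (fst t))). intros [l Hl].
  apply Hno. exists (fold_right Nat.max 0%nat (map (fun t => N (fst t)) l)).
  intros x Hx. destruct (Hl (x, tt)) as [[t []] [Hin [_ [Hcl _]]]]; [simpl; tauto|].
  simpl in Hcl. specialize (HNd t x Hcl).
  assert (s (N t) x <= s (fold_right Nat.max 0%nat (map (fun t0 => N (fst t0)) l)) x); [|lra].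
  apply Hm. clear - Hin. induction l as [|y l IH]; [destruct Hin|].
  simpl. destruct Hin as [->|Hin]; [simpl; lia|]. specialize (IH Hin). simpl in *. lia.
Qed.

(** Partial sums stay below [L] by comparison with [F]. Conversely a window [-A, A] carries almost
    all of [L], and Dini's theorem makes some partial sum uniformly close to [F] on it. *)
Lemma tonelli_series (f : nat -> R -> R) (F : R -> R) (l : nat -> R) (L : R) :
  (forall n x, 0 <= f n x) -> (forall n x, continuous (f n) x) -> (forall x, continuous F x) ->
  (forall x, is_series (fun n => f n x) (F x)) ->
  (forall n, integ (f n) (l n)) -> integ F L -> is_series l L.
Proof.
  intros Hp Cf CF HF Hl HL. apply is_series_R. apply is_lim_seq_spec. intros eps.
  assert (Hsum : forall N a b, RInt (fun x => sum_n (fun n => f n x) N) a b = sum_n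
    (fun n => RInt (f n) a b) N).
  { intros N a b. apply RInt_sum_n. intros n. apply ex_RInt_cont, Cf. }
  assert (Esum : forall N a b, ex_RInt (fun x => sum_n (fun n => f n x) N) a b).
  { intros N a b. apply RInt_sum_n. intros n. apply ex_RInt_cont, Cf. }
  assert (Hlp : forall n, 0 <= l n).
  { intros n. eapply Rle_trans; [|apply (RInt_le_integ (f n) (l n) 0 0); auto; lra].
    rewrite RInt_point. right; reflexivity. }
  assert (Hup : forall N, sum_n l N <= L).
  { intros N.
    assert (Hs : integ (fun x => sum_n (fun n => f n x) N) (sum_n l N)).
    { induction N as [|N IH].
      - rewrite sum_O. eapply integ_ext; [|apply (Hl 0%nat)]. intros x; now rewrite sum_O.
      - rewrite sum_Sn. apply integ_ext with (fun x => sum_n (fun n => f n x) N + f (S N) x);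
          [intros x; now rewrite sum_Sn|].
        apply integ_plus; auto. }
    apply (integ_le (fun x => sum_n (fun n => f n x) N) F); auto.
    intros x. apply is_series_le_bound; auto. }
  assert (Hmono : forall N M, (N <= M)%nat -> sum_n l N <= sum_n l M).
  { intros N M H. induction H; [lra|]. rewrite sum_Sn. unfold plus; simpl. assert (P := Hlp (S m)). lra.
    }
  destruct HL as [EF HL].
  assert (He : 0 < eps / 2) by (destruct eps; simpl; lra).
  destruct (HL _ He) as [A0 HA]. pose (A := Rmax A0 1).
  assert (HA1 : A0 <= A) by apply Rmax_l. assert (HA2 : 1 <= A) by apply Rmax_r.
  specialize (HA (- A) A ltac:(lra) HA1).
  (* Integrated over a window of length 2 A, this tolerance costs eps / 2. *)
  assert (He2 : 0 < eps / (4 * A)) by (apply Rdiv_lt_0_compat; [apply cond_pos|lra]).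
  destruct (dini (fun N x => sum_n (fun n => f n x) N) F (- A) A (eps / (4 * A))) as [N HN]; auto.
  - intros n x. induction n as [|n IH].
    + apply continuous_ext with (f 0%nat); [intros; now rewrite sum_O|auto].
    + apply continuous_ext with (fun x => plus (sum_n (fun n => f n x) n) (f (S n) x));
        [intros; now rewrite sum_Sn|]. apply (continuous_plus (fun x => sum_n (fun n => f n x) n)); auto.
  - intros n x. rewrite sum_Sn. unfold plus; simpl. assert (P := Hp (S n) x). lra.
  - exists N. intros M HM. specialize (Hmono N M HM). assert (U := Hup M).
    assert (HlN : sum_n (fun n => RInt (f n) (- A) A) N <= sum_n l N).
    { clear - Hp Hl HA2. rewrite !sum_n_Reals. apply sum_Rle. intros n _.
      apply RInt_le_integ; auto; lra. }
    assert (Hd : RInt (fun x => F x - sum_n (fun n => f n x) N) (- A) A <= RInt (fun _ => eps / (4 * A))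
      (- A) A).
    { apply RInt_le; [lra| | |].
      - apply (ex_RInt_minus F (fun x => sum_n (fun n => f n x) N)); auto.
      - apply ex_RInt_const.
      - intros x Hx. left. apply HN; lra. }
    rewrite RInt_const_R, RInt_minus_R, Hsum in Hd by auto.
    replace ((A - - A) * (eps / (4 * A))) with (eps / 2) in Hd by (field; lra).
    apply Rabs_def2 in HA. apply Rabs_def1; lra.
Qed.

(** * Substitution *)

Lemma integ_comp (g phi dphi : R -> R) (l : R) :
  (forall x, continuous g x) -> (forall x, is_derive phi x (dphi x)) ->
  (forall x, continuous dphi x) ->
  (forall K, exists A, forall x, A <= x -> K <= phi x) ->
  (forall K, exists A, forall x, x <= A -> phi x <= K) ->
  integ g l -> integ (fun s => dphi s * g (phi s)) l.
Proof.
  intros Cg Hphi Cd Hp Hm [Eg Hg].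
  assert (E : forall a b, RInt (fun s => dphi s * g (phi s)) a b = RInt g (phi a) (phi b)).
  { intros a b. apply (RInt_comp g phi dphi a b); auto. }
  split.
  - intros a b. apply ex_RInt_cont. intros x.
    apply (continuous_mult dphi (fun s => g (phi s))); [apply Cd|].
    apply (continuous_comp phi g); [|apply Cg].
    apply (ex_derive_continuous phi). eexists; apply Hphi.
  - intros eps He. destruct (Hg eps He) as [A HA].
    destruct (Hp A) as [B HB]. destruct (Hm (- A)) as [B' HB'].
    exists (Rmax B (- B')). intros a b Ha Hb. rewrite E.
    assert (B <= Rmax B (- B')) by apply Rmax_l. assert (- B' <= Rmax B (- B')) by apply Rmax_r.
    apply HA; [apply HB'|apply HB]; lra.
Qed.

(** * Fejer kernel *)

(** This is sin((2n+1)x) / sin x, of period pi: the even frequencies match the Fourier integral of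
    the Gaussian, written with cos(2yx), and lead to sampling at the multiples of pi. *)
Fixpoint dirichlet (n : nat) (x : R) : R :=
  match n with O => 1 | S m => dirichlet m x + 2 * cos (2 * INR (S m) * x) end.

(** This is sin^2((n+1)x) / sin^2 x, without the customary factor 1/(n+1), which is supplied where
    the limit is taken. *)
Fixpoint fejer (n : nat) (x : R) : R :=
  match n with O => 1 | S m => fejer m x + dirichlet (S m) x end.

Lemma dirichlet_continuous (n : nat) (x : R) : continuous (dirichlet n) x.
Proof.
  induction n as [|n IH]; [apply continuous_const|].
  apply (continuous_plus (dirichlet n) (fun x => 2 * cos (2 * INR (S n) * x))); [exact IH|].
  apply (ex_derive_continuous (fun x => 2 * cos (2 * INR (S n) * x))). auto_derive. auto.
Qed.

Lemma fejer_continuous (n : nat) (x : R) : continuous (fejer n) x.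
Proof.
  induction n as [|n IH]; [apply continuous_const|].
  apply (continuous_plus (fejer n) (dirichlet (S n))); [exact IH|apply dirichlet_continuous].
Qed.

Lemma dirichlet_even (n : nat) (x : R) : dirichlet n (- x) = dirichlet n x.
Proof.
  induction n as [|n IH]; [reflexivity|]. cbn [dirichlet]. rewrite IH.
  replace (2 * INR (S n) * - x) with (- (2 * INR (S n) * x)) by ring. now rewrite cos_neg.
Qed.

Lemma fejer_even (n : nat) (x : R) : fejer n (- x) = fejer n x.
Proof.
  induction n as [|n IH]; [reflexivity|]. cbn [fejer]. now rewrite IH, dirichlet_even.
Qed.

Lemma dirichlet_period (n m : nat) (x : R) : dirichlet n (x + INR m * PI) = dirichlet n x.
Proof.
  induction n as [|n IH]; [reflexivity|]. cbn [dirichlet]. rewrite IH.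
  replace (2 * INR (S n) * (x + INR m * PI)) with (2 * INR (S n) * x + 2 * INR (S n * m) * PI)
    by (rewrite mult_INR; ring).
  now rewrite cos_period.
Qed.

Lemma fejer_period (n m : nat) (x : R) : fejer n (x + INR m * PI) = fejer n x.
Proof.
  induction n as [|n IH]; [reflexivity|]. cbn [fejer]. now rewrite IH, dirichlet_period.
Qed.

(** The product form avoids a quotient at the multiples of pi. The induction step is sin(a + x) -
    sin(a - x) = 2 cos(a) sin(x) with a = 2(n+1)x. *)
Lemma dirichlet_sin (n : nat) (x : R) : dirichlet n x * sin x = sin (INR (2 * n + 1) * x).
Proof.
  induction n as [|n IH].
  - simpl. now rewrite !Rmult_1_l.
  - cbn [dirichlet]. rewrite Rmult_plus_distr_r, IH.
    replace (INR (2 * S n + 1) * x) with (2 * INR (S n) * x + x)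
      by (rewrite plus_INR, mult_INR, !S_INR; simpl; ring).
    replace (INR (2 * n + 1) * x) with (2 * INR (S n) * x - x)
      by (rewrite plus_INR, mult_INR, !S_INR; simpl; ring).
    rewrite sin_plus, sin_minus. ring.
Qed.

Lemma fejer_sin (n : nat) (x : R) : fejer n x * (sin x)² = (sin (INR (S n) * x))².
Proof.
  induction n as [|n IH].
  - simpl. now rewrite !Rmult_1_l.
  - cbn [fejer]. rewrite Rmult_plus_distr_r, IH. unfold Rsqr at 2.
    rewrite <- Rmult_assoc, dirichlet_sin.
    set (y := INR (S n) * x).
    replace (INR (2 * S n + 1) * x) with (y + y + x)
      by (unfold y; rewrite plus_INR, mult_INR, !S_INR; simpl; ring).
    replace (INR (S (S n)) * x) with (y + x) by (unfold y; rewrite !S_INR; ring).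
    rewrite !sin_plus, cos_plus. unfold Rsqr.
    assert (H' := sin2_cos2 x). unfold Rsqr in *.
    apply Rminus_diag_uniq.
    transitivity (sin y * sin y * (1 - (sin x * sin x + cos x * cos x))); [ring|].
    rewrite H'. ring.
Qed.

Lemma fejer_nonneg (n : nat) (x : R) : - (PI / 2) <= x <= PI / 2 -> 0 <= fejer n x.
Proof.
  intros Hx. destruct (Req_dec x 0) as [->|Hx0].
  - assert (H : forall n, 0 <= dirichlet n 0).
    { clear. induction n as [|n IH]; [simpl; lra|]. cbn [dirichlet]. rewrite Rmult_0_r, cos_0. lra. }
    induction n as [|n IH]; [simpl; lra|]. cbn [fejer]. assert (P := H (S n)). lra.
  - assert (P := PI_RGT_0).
    assert (Hs : 0 < (sin x)²).
    { apply Rsqr_pos_lt. destruct (Rlt_or_le 0 x) as [H|H].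
      - apply Rgt_not_eq. apply sin_gt_0; lra.
      - rewrite <- (Ropp_involutive x), sin_neg. apply Ropp_neq_0_compat.
        apply Rgt_not_eq. apply sin_gt_0; lra. }
    apply Rmult_le_reg_r with ((sin x)²); [exact Hs|].
    rewrite Rmult_0_l, fejer_sin. apply Rle_0_sqr.
Qed.

(** The bound is uniform in [n], so division by n+1 makes the kernel vanish away from 0. *)
Lemma fejer_le (n : nat) (d x : R) :
  0 < d <= PI / 2 -> d <= Rabs x -> - (PI / 2) <= x <= PI / 2 -> fejer n x <= / (sin d)².
Proof.
  intros Hd Hdx Hx. assert (P := PI_RGT_0).
  assert (Hsd : 0 < sin d) by (apply sin_gt_0; lra).
  assert (Hs : sin d <= sin (Rabs x)).
  { assert (Rabs x <= PI / 2) by (apply Rabs_le; lra). apply sin_incr_1; lra. }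
  assert (E : (sin x)² = (sin (Rabs x))²).
  { unfold Rabs. destruct (Rcase_abs x); [|reflexivity]. rewrite sin_neg. apply Rsqr_neg. }
  assert (Hq : (sin d)² <= (sin x)²) by (rewrite E; apply Rsqr_incr_1; lra).
  assert (0 < (sin d)²) by (apply Rsqr_pos_lt; lra).
  apply Rmult_le_reg_r with ((sin d)²); [lra|]. rewrite Rinv_l by lra.
  apply Rle_trans with (fejer n x * (sin x)²).
  - apply Rmult_le_compat_l; [apply fejer_nonneg; lra|exact Hq].
  - rewrite fejer_sin. assert (B := SIN_bound (INR (S n) * x)). 
    unfold Rsqr. nra.
Qed.

Lemma sin_INR_PI (n : nat) : sin (INR n * PI) = 0.
Proof. apply sin_eq_0_1. exists (Z.of_nat n). now rewrite <- INR_IZR_INZ. Qed.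

Lemma RInt_dirichlet (n : nat) : RInt (dirichlet n) (- (PI / 2)) (PI / 2) = PI.
Proof.
  induction n as [|n IH].
  - change (RInt (fun _ => 1) (- (PI / 2)) (PI / 2) = PI). rewrite RInt_const_R. toR. field.
  - change (RInt (fun x => dirichlet n x + 2 * cos (2 * INR (S n) * x)) (- (PI / 2)) (PI / 2) = PI).
    assert (Hn : INR (S n) <> 0) by (apply not_0_INR; lia).
    revert Hn. assert (Hs := sin_INR_PI (S n)). revert Hs. generalize (INR (S n)). intros y Hs Hn.
    assert (C : forall x, continuous (fun x => 2 * cos (2 * y * x)) x).
    { intros x. apply (ex_derive_continuous (fun x => 2 * cos (2 * y * x))). auto_derive. auto. }
    rewrite RInt_plus_R, IH.
    + rewrite (RInt_derive_R (fun x => sin (2 * y * x) / y)).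
      * replace (2 * y * (PI / 2)) with (y * PI) by field.
        replace (2 * y * - (PI / 2)) with (- (y * PI)) by field.
        rewrite sin_neg, Hs. toR. field. exact Hn.
      * intros x. auto_derive; [auto|]. toR. field. exact Hn.
      * exact C.
    + apply ex_RInt_cont. apply dirichlet_continuous.
    + apply ex_RInt_cont. exact C.
Qed.

Lemma RInt_fejer (n : nat) : RInt (fejer n) (- (PI / 2)) (PI / 2) = INR (S n) * PI.
Proof.
  induction n as [|n IH].
  - change (RInt (dirichlet 0) (- (PI / 2)) (PI / 2) = INR 1 * PI). rewrite RInt_dirichlet. simpl. toR.
    ring.
  - change (RInt (fun x => fejer n x + dirichlet (S n) x) (- (PI / 2)) (PI / 2) = INR (S (S n)) * PI).
    rewrite RInt_plus_R, IH, RInt_dirichlet, (S_INR (S n)); [toR; ring| |];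
      apply ex_RInt_cont; [apply fejer_continuous|apply dirichlet_continuous].
Qed.

Lemma is_lim_seq_div_S (c : R) : is_lim_seq (fun n => c / INR (S n)) 0.
Proof.
  replace (Finite 0) with (Rbar_mult c 0) by (simpl; f_equal; ring).
  apply (is_lim_seq_scal_l (fun n => / INR (S n)) c 0).
  replace (Finite 0) with (Rbar_inv p_infty) by reflexivity.
  apply is_lim_seq_inv; [|discriminate].
  apply (is_lim_seq_incr_1 INR). apply is_lim_seq_INR.
Qed.

(** Approximate identity on one period: near 0 the oscillation of [g] is small against the total
    mass (n+1) pi, and farther away the kernel is bounded, which the division by n+1 makes
    negligible. *)
Lemma fejer_approx (g : R -> R) (B : R) :
  (forall x, continuous g x) -> (forall x, Rabs (g x) <= B) ->
  is_lim_seq (fun n => RInt (fun x => g x * fejer n x) (- (PI / 2)) (PI / 2) / INR (S n)) (PI * g 0).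
Proof.
  intros Cg HB. assert (P := PI_RGT_0).
  apply is_lim_seq_spec. intros eps.
  (* Times the mass pi of the normalized kernel, this gives eps / 2. *)
  assert (He : 0 < eps / (2 * PI)) by (apply Rdiv_lt_0_compat; [apply cond_pos|lra]).
  destruct (filterlim_R_eps (locally 0) g (g 0) _ (Cg 0) He) as [d0 Hd0].
  pose (d := Rmin d0 (PI / 2)).
  assert (Hd : 0 < d <= PI / 2).
  { split; [apply Rmin_glb_lt; [apply cond_pos|lra]|apply Rmin_r]. }
  pose (K := 2 * B * / (sin d)²).
  (* The sum of the near and the far bound holds on the whole period, so the integral need not be
     split at -d and d. *)
  assert (Hpt : forall n x, - (PI / 2) <= x <= PI / 2 ->
    Rabs ((g x - g 0) * fejer n x) <= eps / (2 * PI) * fejer n x + K).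
  { intros n x Hx. assert (Hf := fejer_nonneg n x Hx).
    rewrite Rabs_mult, (Rabs_pos_eq (fejer n x)) by exact Hf.
    assert (HK : 0 <= K).
    { unfold K. assert (0 <= B) by (eapply Rle_trans; [apply Rabs_pos|apply (HB 0)]).
      apply Rmult_le_pos; [lra|]. left. apply Rinv_0_lt_compat. apply Rsqr_pos_lt.
      apply Rgt_not_eq, sin_gt_0; lra. }
    destruct (Rlt_or_le (Rabs x) d) as [Hlt|Hge].
    - assert (Hb : Rabs (g x - g 0) < eps / (2 * PI)).
      { apply Hd0. change (Rabs (x - 0) < d0). rewrite Rminus_0_r.
        eapply Rlt_le_trans; [exact Hlt|apply Rmin_l]. }
      assert (Rabs (g x - g 0) * fejer n x <= eps / (2 * PI) * fejer n x)
        by (apply Rmult_le_compat_r; lra). lra.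
    - assert (Hle := fejer_le n d x Hd Hge Hx).
      assert (Hb : Rabs (g x - g 0) <= 2 * B).
      { assert (T := Rabs_triang (g x) (- g 0)). rewrite Rabs_Ropp in T.
        assert (H1 := HB x). assert (H2 := HB 0). unfold Rminus. lra. }
      assert (Rabs (g x - g 0) * fejer n x <= K).
      { unfold K. apply Rmult_le_compat; auto. apply Rabs_pos. }
      assert (0 <= eps / (2 * PI) * fejer n x) by (apply Rmult_le_pos; lra). lra. }
  assert (HL := is_lim_seq_div_S (K * PI)). apply is_lim_seq_spec in HL.
  assert (He2 : 0 < eps / 2) by (destruct eps; simpl; lra).
  destruct (HL (mkposreal _ He2)) as [N HN]. exists N. intros n Hn.
  specialize (HN n Hn). cbn [pos] in HN. rewrite Rminus_0_r in HN.
  assert (Hp : 0 < INR (S n)) by (apply lt_0_INR; lia).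
  assert (Cgf : forall x, continuous (fun x => g x * fejer n x) x).
  { intros x. apply (continuous_mult g (fejer n)); [apply Cg|apply fejer_continuous]. }
  assert (Cgf0 : forall x, continuous (fun x => g 0 * fejer n x) x).
  { intros x. apply (continuous_mult (fun _ => g 0) (fejer n));
      [apply continuous_const|apply fejer_continuous]. }
  assert (E : RInt (fun x => (g x - g 0) * fejer n x) (- (PI / 2)) (PI / 2)
     = RInt (fun x => g x * fejer n x) (- (PI / 2)) (PI / 2) - g 0 * (INR (S n) * PI)).
  { rewrite <- RInt_fejer, <- RInt_scal_R, <- RInt_minus_R.
    - apply RInt_ext. intros t _. toR. ring.
    - apply ex_RInt_cont; exact Cgf.
    - apply ex_RInt_cont; exact Cgf0.
    - apply ex_RInt_cont, fejer_continuous. }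
  assert (Cb : forall x, continuous (fun x => eps / (2 * PI) * fejer n x + K) x).
  { intros x. apply (continuous_plus (fun x => eps / (2 * PI) * fejer n x) (fun _ => K));
      [|apply continuous_const].
    apply (continuous_mult (fun _ => eps / (2 * PI)) (fejer n));
      [apply continuous_const|apply fejer_continuous]. }
  assert (Hint : Rabs (RInt (fun x => (g x - g 0) * fejer n x) (- (PI / 2)) (PI / 2))
     <= eps / (2 * PI) * (INR (S n) * PI) + PI * K).
  { eapply Rle_trans; [apply (RInt_abs_bound _ (fun x => eps / (2 * PI) * fejer n x + K))|].
    - lra.
    - apply ex_RInt_cont. intros x.
      apply continuous_ext with (fun x => minus (g x * fejer n x) (g 0 * fejer n x)).
      + intros t. unfold minus, plus, opp; simpl. toR. ring.
      + apply (continuous_minus (fun x => g x * fejer n x) (fun x => g 0 * fejer n x)); auto.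
    - apply ex_RInt_cont; exact Cb.
    - intros x Hx. apply Hpt; exact Hx.
    - right. rewrite RInt_plus_R, RInt_scal_R, RInt_fejer, RInt_const_R; [toR; field; lra| | |].
      + apply ex_RInt_cont, fejer_continuous.
      + apply (ex_RInt_scal (fejer n)). apply ex_RInt_cont, fejer_continuous.
      + apply ex_RInt_const. }
  replace (RInt (fun x => g x * fejer n x) (- (PI / 2)) (PI / 2) / INR (S n) - PI * g 0)
    with (RInt (fun x => (g x - g 0) * fejer n x) (- (PI / 2)) (PI / 2) / INR (S n))
      by (rewrite E; field; lra).
  unfold Rdiv at 1. rewrite Rabs_mult, (Rabs_pos_eq (/ INR (S n)))
    by (left; apply Rinv_0_lt_compat; exact Hp).
  apply Rle_lt_trans with ((eps / (2 * PI) * (INR (S n) * PI) + PI * K) * / INR (S n)).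
  - apply Rmult_le_compat_r; [left; apply Rinv_0_lt_compat; exact Hp|exact Hint].
  - replace ((eps / (2 * PI) * (INR (S n) * PI) + PI * K) * / INR (S n)) with
      (eps / 2 + K * PI / INR (S n)) by (field; lra).
    apply Rabs_def2 in HN. lra.
Qed.

(** * Gaussian integrals *)

(** Completing the square: (2 lam x - d)^2 >= 0. Taken with both signs of [d], this brings Gaussians
    under [integ_exp_bound]. *)
Lemma gauss_bound (lam d x : R) : 0 < lam -> exp (- lam * x ^ 2) <= exp (d ^ 2 / (4 * lam)) * exp
  (- d * x).
Proof.
  intros Hl. rewrite <- exp_plus.
  assert (H : - lam * x ^ 2 <= d ^ 2 / (4 * lam) + - d * x).
  { apply Rmult_le_reg_l with (4 * lam); [lra|].
    replace (4 * lam * (d ^ 2 / (4 * lam) + - d * x)) with (d ^ 2 - 4 * lam * d * x) by (field; lra).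
    assert (0 <= (2 * lam * x - d) ^ 2) by apply pow2_ge_0. lra. }
  destruct H as [H|H]; [left; now apply exp_increasing|right; now rewrite H].
Qed.

Lemma integ_gauss_bound (f : R -> R) (C lam : R) :
  0 < lam -> (forall x, continuous f x) -> (forall x, Rabs (f x) <= C * exp (- lam * x ^ 2)) ->
  exists l, integ f l.
Proof.
  intros Hl Cf Hf.
  assert (HC : 0 <= C).
  { assert (H := Hf 0). rewrite pow_i, Rmult_0_r, exp_0 in H by lia. assert (P := Rabs_pos (f 0)). lra. }
  destruct (integ_exp_bound f (C * exp (1 ^ 2 / (4 * lam))) 1) as [l [H _]].
  - lra.
  - intros a b. apply ex_RInt_cont; exact Cf.
  - intros u. eapply Rle_trans; [apply Hf|]. rewrite Rmult_assoc.
    apply Rmult_le_compat_l; [exact HC|apply gauss_bound; exact Hl].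
  - intros u. eapply Rle_trans; [apply Hf|]. rewrite Rmult_assoc.
    apply Rmult_le_compat_l; [exact HC|].
    assert (G := gauss_bound lam (-1) u Hl).
    replace ((-1) ^ 2) with (1 ^ 2) in G by ring. replace (- -1) with 1 in G by ring. exact G.
  - exists l. exact H.
Qed.

(** Integration by parts over the line: the boundary values of [F] decay at both ends. *)
Lemma integ_derive_zero (F f : R -> R) (C d : R) :
  0 < d -> (forall x, is_derive F x (f x)) -> (forall x, continuous f x) ->
  (forall x, Rabs (F x) <= C * exp (- d * x)) -> (forall x, Rabs (F x) <= C * exp (d * x)) ->
  integ f 0.
Proof.
  intros Hd HF Cf Hr Hl. split; [intros; apply ex_RInt_cont; exact Cf|].
  assert (HC : 0 <= C).
  { assert (H := Hr 0). rewrite Rmult_0_r, exp_0 in H. assert (P := Rabs_pos (F 0)). lra. }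
  intros eps He. destruct (exp_neg_small C d (eps / 2) Hd HC) as [A [HA0 HA]]; [lra|].
  exists A. intros a b Ha Hb. rewrite (RInt_derive_R F f) by auto.
  assert (H1 := Hr b). assert (H2 := HA b Hb). assert (H3 := Hl a). assert (H4 := HA (- a) ltac:(lra)).
  replace (- d * - a) with (d * a) in H4 by ring.
  assert (H5 : Rabs (F b) < eps / 2) by lra. assert (H6 : Rabs (F a) < eps / 2) by lra.
  apply Rabs_def2 in H5. apply Rabs_def2 in H6. apply Rabs_def1; lra.
Qed.

(** Half of the exponent absorbs the square, because t <= e^t at t = lam x^2 / 2. *)
Lemma sq_gauss_bound (lam x : R) : 0 < lam -> x ^ 2 * exp (- lam * x ^ 2) <= 2 / lam * exp
  (- (lam / 2) * x ^ 2).
Proof.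
  intros Hl.
  replace (- lam * x ^ 2) with (- (lam / 2 * x ^ 2) + - (lam / 2) * x ^ 2) by field.
  rewrite exp_plus, <- Rmult_assoc. apply Rmult_le_compat_r; [left; apply exp_pos|].
  rewrite exp_Ropp. apply Rmult_le_reg_r with (exp (lam / 2 * x ^ 2)); [apply exp_pos|].
  rewrite Rmult_assoc, Rinv_l, Rmult_1_r by (apply Rgt_not_eq, exp_pos).
  assert (H := exp_ineq1_le (lam / 2 * x ^ 2)).
  apply Rmult_le_reg_l with (lam / 2); [lra|].
  rewrite <- Rmult_assoc. replace (lam / 2 * (2 / lam)) with 1 by (field; lra). lra.
Qed.

Lemma sin_lipschitz (a b : R) : Rabs (sin b - sin a) <= Rabs (b - a).
Proof.
  destruct (MVT_gen sin a b cos) as [c [_ ->]].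
  - intros x _. auto_derive; [auto|ring].
  - intros x _. apply continuity_sin.
  - rewrite Rabs_mult. assert (H := COS_bound c).
    apply Rle_trans with (1 * Rabs (b - a)); [|lra].
    apply Rmult_le_compat_r; [apply Rabs_pos|]. apply Rabs_le. lra.
Qed.

Lemma cos_taylor (a b : R) : Rabs (cos (a + b) - cos a + b * sin a) <= b ^ 2.
Proof.
  destruct (MVT_gen cos a (a + b) (fun x => - sin x)) as [c [Hc ->]].
  - intros x _. auto_derive; [auto|ring].
  - intros x _. apply continuity_cos.
  - replace (- sin c * (a + b - a) + b * sin a) with (b * (sin a - sin c)) by ring.
    rewrite Rabs_mult. assert (H := sin_lipschitz c a).
    assert (Hca : Rabs (a - c) <= Rabs b).
    { unfold Rmin, Rmax in Hc. destruct (Rle_dec a (a + b)); unfold Rabs; repeat destruct Rcase_abs; lra.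
      }
    replace (b ^ 2) with (Rabs b * Rabs b) by (rewrite <- Rabs_mult, Rabs_pos_eq; [ring|nra]).
    apply Rmult_le_compat_l; [apply Rabs_pos|lra].
Qed.

Lemma integ_abs_le (f g : R -> R) (l m : R) :
  (forall x, Rabs (f x) <= g x) -> integ f l -> integ g m -> Rabs l <= m.
Proof.
  intros H Hf Hg. apply Rabs_le. split.
  - apply Ropp_le_cancel. rewrite Ropp_involutive.
    apply (integ_le (fun x => (-1) * f x) g).
    + intros x. assert (P := H x). unfold Rabs in P. destruct Rcase_abs; lra.
    + replace (- l) with ((-1) * l) by ring. apply integ_scal; exact Hf.
    + exact Hg.
  - apply (integ_le f g); auto. intros x. eapply Rle_trans; [apply Rle_abs|apply H].
Qed.

(** This replaces a theorem on differentiation under the integral sign: a quadratic remainder is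
    obtained by integrating a pointwise estimate. *)
Lemma is_derive_quadratic (f : R -> R) (y l C : R) :
  (forall h, Rabs (f (y + h) - f y - h * l) <= C * h ^ 2) -> is_derive f y l.
Proof.
  intros H. apply is_derive_Reals. intros eps He.
  assert (HC : 0 <= C).
  { assert (H1 := H 1). rewrite pow1, Rmult_1_r in H1. eapply Rle_trans; [apply Rabs_pos|exact H1]. }
  assert (Hd : 0 < eps / (C + 1)) by (apply Rdiv_lt_0_compat; lra).
  exists (mkposreal _ Hd). intros h Hh Hlt. simpl in Hlt.
  replace ((f (y + h) - f y) / h - l) with ((f (y + h) - f y - h * l) * / h) by (field; exact Hh).
  rewrite Rabs_mult, Rabs_inv. assert (Hhp : 0 < Rabs h) by (apply Rabs_pos_lt; exact Hh).
  apply Rmult_lt_reg_r with (Rabs h); [exact Hhp|].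
  rewrite Rmult_assoc, Rinv_l, Rmult_1_r by lra.
  eapply Rle_lt_trans; [apply H|]. rewrite <- pow2_abs.
  replace (C * Rabs h ^ 2) with ((C * Rabs h) * Rabs h) by ring.
  apply Rmult_lt_compat_r; [exact Hhp|].
  apply Rle_lt_trans with ((C + 1) * Rabs h - Rabs h); [lra|].
  assert (Hm : (C + 1) * Rabs h < eps).
  { apply Rlt_le_trans with ((C + 1) * (eps / (C + 1)));
      [apply Rmult_lt_compat_l; lra|right; field; lra]. }
  lra.
Qed.

(** The transform [J] satisfies J' = -(2y/lam) J, so J(y) e^(y^2/lam) is constant. The mass [c]
    remains unknown here; it is determined in [theta_gauss]. *)
Lemma gauss_fourier (lam : R) : 0 < lam ->
  exists c, integ (fun x => exp (- lam * x ^ 2)) c /\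
    forall y, integ (fun x => exp (- lam * x ^ 2) * cos (2 * y * x)) (c * exp (- y ^ 2 / lam)).
Proof.
  intros Hl.
  assert (Hex : forall y, exists l, integ (fun x => exp (- lam * x ^ 2) * cos (2 * y * x)) l).
  { intros y. apply integ_gauss_bound with 1 lam; [exact Hl| |].
    - intros x. apply (ex_derive_continuous (fun x => exp (- lam * x ^ 2) * cos (2 * y * x))).
      auto_derive. auto.
    - intros x. rewrite Rabs_mult, (Rabs_pos_eq (exp _)), Rmult_comm by (left; apply exp_pos).
      apply Rmult_le_compat_r; [left; apply exp_pos|]. apply Rabs_le. apply COS_bound. }
  pose (J := fun y => proj1_sig (constructive_indefinite_description _ (Hex y))).
  assert (HJ : forall y, integ (fun x => exp (- lam * x ^ 2) * cos (2 * y * x)) (J y)).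
  { intros y. unfold J. destruct (constructive_indefinite_description _ (Hex y)); auto. }
  (* The derivative of e^(-lam x^2) sin(2yx) has integral zero, which expresses this sine integral
     through [J y]. *)
  assert (HK : forall y, integ (fun x => 2 * x * exp (- lam * x ^ 2) * sin (2 * y * x))
    (2 * y / lam * J y)).
  { intros y.
    assert (Z : integ (fun x => - 2 * lam * x * exp (- lam * x ^ 2) * sin (2 * y * x)
                       + 2 * y * (exp (- lam * x ^ 2) * cos (2 * y * x))) 0).
    { apply integ_derive_zero with (fun x => exp (- lam * x ^ 2) * sin (2 * y * x))
        (exp (1 ^ 2 / (4 * lam))) 1.
      - lra.
      - intros x. auto_derive; [auto|]. change (x * (x * 1)) with (x ^ 2). toR. ring.
      - intros x. apply (ex_derive_continuous
          (fun x => - 2 * lam * x * exp (- lam * x ^ 2) * sin (2 * y * x)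
                       + 2 * y * (exp (- lam * x ^ 2) * cos (2 * y * x)))). auto_derive. auto.
      - intros x. eapply Rle_trans; [|apply gauss_bound; exact Hl].
        rewrite Rabs_mult, (Rabs_pos_eq (exp _)), Rmult_comm by (left; apply exp_pos).
        rewrite <- (Rmult_1_l (exp (- lam * x ^ 2))) at 2.
        apply Rmult_le_compat_r; [left; apply exp_pos|]. apply Rabs_le. apply SIN_bound.
      - intros x. replace (1 ^ 2) with ((-1) ^ 2) by ring. replace (1 * x) with (- -1 * x) by ring.
        eapply Rle_trans; [|apply gauss_bound; exact Hl].
        rewrite Rabs_mult, (Rabs_pos_eq (exp _)), Rmult_comm by (left; apply exp_pos).
        rewrite <- (Rmult_1_l (exp (- lam * x ^ 2))) at 2.
        apply Rmult_le_compat_r; [left; apply exp_pos|]. apply Rabs_le. apply SIN_bound. }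
    replace (2 * y / lam * J y) with (/ lam * (2 * y * J y - 0)) by (field; lra).
    eapply integ_ext; [|apply integ_scal; apply integ_minus; [apply integ_scal; apply (HJ y)|exact Z]].
    intros x. cbv beta. field. lra. }
  assert (HG : exists G, integ (fun x => exp (- (lam / 2) * x ^ 2)) G).
  { apply integ_gauss_bound with 1 (lam / 2); [lra| |].
    - intros x. apply (ex_derive_continuous (fun x => exp (- (lam / 2) * x ^ 2))). auto_derive. auto.
    - intros x. rewrite Rabs_pos_eq by (left; apply exp_pos). lra. }
  destruct HG as [G HG].
  assert (HD : forall y, is_derive J y (- (2 * y / lam * J y))).
  (* [cos_taylor] with b = 2hx leaves 4 h^2 x^2, and [sq_gauss_bound] supplies the factor 2 /
     lam. *)
  { intros y. apply is_derive_quadratic with (8 / lam * G). intros h.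
    replace (8 / lam * G * h ^ 2) with (8 / lam * h ^ 2 * G) by ring.
    apply integ_abs_le with (fun x => (exp (- lam * x ^ 2) * cos (2 * (y + h) * x)
       - exp (- lam * x ^ 2) * cos (2 * y * x)) - h *
           ((-1) * (2 * x * exp (- lam * x ^ 2) * sin (2 * y * x))))
       (fun x => 8 / lam * h ^ 2 * exp (- (lam / 2) * x ^ 2)).
    - intros x.
      replace (exp (- lam * x ^ 2) * cos (2 * (y + h) * x) - exp (- lam * x ^ 2) * cos (2 * y * x)
         - h * ((-1) * (2 * x * exp (- lam * x ^ 2) * sin (2 * y * x))))
        with (exp (- lam * x ^ 2) * (cos (2 * y * x + 2 * h * x) - cos (2 * y * x) + 2 * h * x * sin
          (2 * y * x)))
        by (replace (2 * (y + h) * x) with (2 * y * x + 2 * h * x) by ring; ring).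
      rewrite Rabs_mult, (Rabs_pos_eq (exp _)) by (left; apply exp_pos).
      assert (T := cos_taylor (2 * y * x) (2 * h * x)).
      apply Rle_trans with (exp (- lam * x ^ 2) * (2 * h * x) ^ 2).
      + apply Rmult_le_compat_l; [left; apply exp_pos|exact T].
      + replace (exp (- lam * x ^ 2) * (2 * h * x) ^ 2) with (4 * h ^ 2 * (x ^ 2 * exp (- lam * x ^ 2)))
          by ring.
        replace (8 / lam * h ^ 2 * exp (- (lam / 2) * x ^ 2)) with
          (4 * h ^ 2 * (2 / lam * exp (- (lam / 2) * x ^ 2))) by (field; lra).
        apply Rmult_le_compat_l; [assert (0 <= h ^ 2) by apply pow2_ge_0; lra|].
        apply sq_gauss_bound; exact Hl.
    - replace (J (y + h) - J y - h * - (2 * y / lam * J y)) with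
        (J (y + h) - J y - h * ((-1) * (2 * y / lam * J y))) by ring.
      apply integ_minus; [apply integ_minus; apply HJ|]. apply integ_scal, integ_scal, HK.
    - apply integ_scal; exact HG. }
  assert (HE : forall y, is_derive (fun y => J y * exp (y ^ 2 / lam)) y 0).
  { intros y. assert (HDy := HD y).
    auto_derive.
    - eexists; exact HDy.
    - replace (Derive (fun x : R => J x) y) with (- (2 * y / lam * J y))
        by (symmetry; apply is_derive_unique; exact HDy). field. lra. }
  assert (Hc : forall y, J y * exp (y ^ 2 / lam) = J 0).
  { intros y. assert (E0 : J 0 * exp (0 ^ 2 / lam) = J 0).
    { replace (0 ^ 2 / lam) with 0 by (field; lra). rewrite exp_0. ring. }
    destruct (Rtotal_order y 0) as [H|[->|H]].
    - rewrite <- E0. apply (eq_is_derive (fun y => J y * exp (y ^ 2 / lam)) y 0); [|exact H].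
      intros t _. apply HE.
    - exact E0.
    - rewrite <- E0. symmetry. apply (eq_is_derive (fun y => J y * exp (y ^ 2 / lam)) 0 y); [|exact H].
      intros t _. apply HE. }
  exists (J 0). split.
  - eapply integ_ext; [|apply (HJ 0)]. intros x. cbv beta.
    replace (2 * 0 * x) with 0 by ring. rewrite cos_0. ring.
  - intros y. rewrite <- (Hc y), Rmult_assoc, <- exp_plus.
    replace (y ^ 2 / lam + - y ^ 2 / lam) with 0 by (field; lra). rewrite exp_0, Rmult_1_r. apply HJ.
Qed.

(** * Gaussian series and Poisson summation *)

Lemma exp_mult_INR (a : R) (n : nat) : exp (a * INR n) = exp a ^ n.
Proof.
  induction n as [|n IH]; [now rewrite Rmult_0_r, exp_0|].
  rewrite S_INR, Rmult_plus_distr_l, exp_plus, IH, Rmult_1_r. simpl. ring.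
Qed.

Lemma is_series_exp_geom (a : R) : 0 < a ->
  is_series (fun n => exp (- a * INR (S n))) (exp (- a) / (1 - exp (- a))).
Proof.
  intros Ha.
  assert (H1 : exp (- a) < 1) by (rewrite <- exp_0; apply exp_increasing; lra).
  assert (H0 := exp_pos (- a)).
  apply (is_series_ext (fun n => exp (- a) * exp (- a) ^ n)).
  - intros n. now rewrite exp_mult_INR.
  - apply (is_series_scal_l (exp (- a)) (fun n => exp (- a) ^ n)).
    apply is_series_geom. rewrite Rabs_pos_eq; lra.
Qed.

Lemma gauss_le_geom (a : R) (n : nat) : 0 < a ->
  exp (- a * INR (S n) ^ 2) <= exp (- a * INR (S n)).
Proof.
  intros Ha.
  assert (H : 1 <= INR (S n)) by (rewrite S_INR; assert (P := pos_INR n); lra).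
  assert (H2 : INR (S n) <= INR (S n) ^ 2) by nra.
  assert (H3 : - a * INR (S n) ^ 2 <= - a * INR (S n)) by nra.
  destruct H3 as [L|E].
  - left; now apply exp_increasing.
  - right; now rewrite E.
Qed.

Lemma ex_series_gauss (a : R) : 0 < a -> ex_series (fun n => exp (- a * INR (S n) ^ 2)).
Proof.
  intros Ha. apply (ex_series_le (K := R_AbsRing) (V := R_CompleteNormedModule) _
    (fun n => exp (- a * INR (S n)))).
  - intros n. change (Rabs (exp (- a * INR (S n) ^ 2)) <= exp (- a * INR (S n))).
    rewrite Rabs_pos_eq by (left; apply exp_pos). now apply gauss_le_geom.
  - eexists. apply is_series_exp_geom; exact Ha.
Qed.

(** The line is cut into cells of length pi centred at the multiples of pi, and evenness pairs the
    cells on the two sides of the central one. *)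
Lemma even_cells (phi : R -> R) (L : R) :
  (forall x, phi (- x) = phi x) -> integ phi L ->
  RInt phi (- (PI / 2)) (PI / 2) + 2 * Series
    (fun m => RInt phi ((INR m + / 2) * PI) ((INR (S m) + / 2) * PI)) = L
  /\ ex_series (fun m => RInt phi ((INR m + / 2) * PI) ((INR (S m) + / 2) * PI)).
Proof.
  intros Hev HL. assert (Ephi := proj1 HL).
  assert (Hc : RInt phi (- (PI / 2)) (PI / 2) = 2 * RInt phi 0 (PI / 2)).
  { rewrite <- (RInt_Chasles_R phi _ 0) by auto.
    rewrite <- (RInt_ext (fun x => phi (- x)) phi (- (PI / 2)) 0) by (intros; apply Hev).
    rewrite RInt_reflect by auto. rewrite Ropp_0, Ropp_involutive. toR. ring. }
  assert (Hs : is_series (fun m => RInt phi ((INR m + / 2) * PI) ((INR (S m) + / 2) * PI))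
                  (L / 2 - RInt phi 0 (PI / 2))).
  { apply is_series_R.
    apply (is_lim_seq_ext (fun n => RInt phi 0 ((INR (S n) + / 2) * PI) - RInt phi 0 (PI / 2))).
    - intros n. induction n as [|n IH].
      + rewrite sum_O. replace ((INR 0 + / 2) * PI) with (PI / 2) by (simpl; field).
        rewrite <- (RInt_Chasles_R phi 0 (PI / 2)) by auto. toR. ring.
      + rewrite sum_Sn, <- IH. unfold plus; simpl AbelianMonoid.plus.
        rewrite <- (RInt_Chasles_R phi 0 ((INR (S n) + / 2) * PI) ((INR (S (S n)) + / 2) * PI)) by auto.
        toR. cbn [plus]. unfold plus; simpl. ring.
    - apply (is_lim_seq_minus' _ _ (L / 2)); [|apply is_lim_seq_const].
      apply integ_even_half; auto.
      assert (P := PI_RGT_0).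
      apply (is_lim_seq_le_p_loc INR); [|apply is_lim_seq_INR].
      exists 0%nat. intros n _. rewrite S_INR. assert (Q := pos_INR n). assert (P3 := PI2_3_2). nra. }
  split; [|eexists; exact Hs].
  rewrite (is_series_unique _ _ Hs), Hc. toR. field.
Qed.

(** The integral of the Gaussian against the normalized Fejer kernel is computed twice. Expanding
    the kernel gives Cesaro means of the partial sums on the right; cutting the line into periods
    concentrates the kernel at the multiples of pi and gives the sum on the left. *)
Lemma poisson_gauss (lam c : R) : 0 < lam ->
  integ (fun x => exp (- lam * x ^ 2)) c ->
  (forall y, integ (fun x => exp (- lam * x ^ 2) * cos (2 * y * x)) (c * exp (- y ^ 2 / lam))) ->
  PI * (1 + 2 * Series (fun n => exp (- lam * (INR (S n) * PI) ^ 2)))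
  = c * (1 + 2 * Series (fun n => exp (- / lam * INR (S n) ^ 2))).
Proof.
  intros Hl Hc HF. assert (P := PI_RGT_0). assert (P3 := PI2_3_2).
  pose (f := fun x => exp (- lam * x ^ 2)).
  assert (Cf : forall x, continuous f x).
  { intros x. apply (ex_derive_continuous f). unfold f. auto_derive. auto. }
  (* The integral of the Gaussian against [dirichlet n]. A sum by [sum_n] is never empty, so n = 0
     is separated. *)
  pose (s := fun n => c * (1 + 2 * match n with O => 0 | S m => sum_n
    (fun k => exp (- / lam * INR (S k) ^ 2)) m end)).
  assert (HD : forall n, integ (fun x => f x * dirichlet n x) (s n)).
  { induction n as [|n IH].
    - unfold s. replace (c * (1 + 2 * 0)) with c by ring.
      eapply integ_ext; [|exact Hc]. intros x. unfold f. cbn [dirichlet]. ring.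
    - replace (s (S n)) with (s n + 2 * (c * exp (- INR (S n) ^ 2 / lam))).
      + eapply integ_ext; [|apply integ_plus; [exact IH|eapply integ_scal; apply (HF (INR (S n)))]].
        intros x. cbn [dirichlet]. unfold f. ring.
      + unfold s. replace (- INR (S n) ^ 2 / lam) with (- / lam * INR (S n) ^ 2) by (field; lra).
        destruct n as [|n]; [rewrite sum_O; ring|]. rewrite sum_Sn.
        unfold plus; simpl AbelianMonoid.plus.
        unfold plus; simpl. ring. }
  assert (HG : forall n, integ (fun x => f x * fejer n x) (sum_n s n)).
  { induction n as [|n IH].
    - rewrite sum_O. exact (HD 0%nat).
    - rewrite sum_Sn. apply integ_ext with (fun x => f x * fejer n x + f x * dirichlet (S n) x).
      + intros x. cbn [fejer]. ring.
      + apply integ_plus; [exact IH|apply HD]. }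
  assert (Hil : 0 < / lam) by now apply Rinv_0_lt_compat.
  assert (Hright : is_lim_seq (fun n => sum_n s n / INR (S n))
    (c * (1 + 2 * Series (fun n => exp (- / lam * INR (S n) ^ 2))))).
  { assert (Hs : is_lim_seq s (c * (1 + 2 * Series (fun n => exp (- / lam * INR (S n) ^ 2))))).
    { apply is_lim_seq_incr_1. unfold s.
      apply (is_lim_seq_scal_l _ c (1 + 2 * Series (fun n => exp (- / lam * INR (S n) ^ 2)))).
      apply (is_lim_seq_plus' (fun _ => 1)); [apply is_lim_seq_const|].
      apply (is_lim_seq_scal_l _ 2 (Series (fun n => exp (- / lam * INR (S n) ^ 2)))).
      apply is_series_R. apply Series_correct. now apply ex_series_gauss. }
    (* Convergence of the partial sums passes to their arithmetic means. *)
    apply is_lim_seq_Reals in Hs. apply Cesaro_1 in Hs. apply is_lim_seq_Reals in Hs.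
    apply is_lim_seq_incr_1 in Hs.
    eapply is_lim_seq_ext; [|exact Hs]. intros n. cbv beta. now rewrite sum_n_Reals. }
  pose (cell := fun (m n : nat) => RInt (fun x => f (x + INR m * PI) * fejer n x) (- (PI / 2)) (PI / 2) /
    INR (S n)).
  assert (Hcell : forall m, is_lim_seq (cell m) (PI * f (INR m * PI))).
  { intros m. replace (INR m * PI) with (0 + INR m * PI) by ring.
    apply (fejer_approx (fun x => f (x + INR m * PI)) 1).
    - intros x. apply (continuous_comp (fun x => x + INR m * PI) f); [|apply Cf].
      apply (ex_derive_continuous (fun x => x + INR m * PI)). auto_derive. auto.
    - intros x. unfold f. rewrite Rabs_pos_eq by (left; apply exp_pos). rewrite <- exp_0.
      assert (H : - lam * (x + INR m * PI) ^ 2 <= 0) by (assert (Q := pow2_ge_0 (x + INR m * PI)); nra).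
      destruct H as [H|H]; [left; now apply exp_increasing|right; now rewrite H]. }
  assert (Hdec : forall n, sum_n s n / INR (S n) = cell 0%nat n + 2 * Series (fun m => cell (S m) n)).
  { intros n. assert (Hn : 0 < INR (S n)) by (apply lt_0_INR; lia).
    destruct (even_cells (fun x => f x * fejer n x) (sum_n s n)) as [E _].
    - intros x. rewrite fejer_even. unfold f. now replace ((- x) ^ 2) with (x ^ 2) by ring.
    - apply HG.
    - rewrite <- E. unfold cell at 1.
      rewrite (Series_ext (fun m => cell (S m) n)
        (fun m => / INR (S n) * RInt (fun x => f x * fejer n x) ((INR m + / 2) * PI)
          ((INR (S m) + / 2) * PI))).
      + rewrite Series_scal_l.
        rewrite (RInt_ext (fun x => f (x + INR 0 * PI) * fejer n x) (fun x => f x * fejer n x)).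
        * field. lra.
        * intros x _. now replace (x + INR 0 * PI) with x by (simpl; ring).
      + intros m. unfold cell, Rdiv. rewrite Rmult_comm. f_equal.
        replace ((INR m + / 2) * PI) with (- (PI / 2) + INR (S m) * PI) by (rewrite S_INR; field).
        replace ((INR (S m) + / 2) * PI) with (PI / 2 + INR (S m) * PI) by field.
        rewrite <- (RInt_shift (fun x => f x * fejer n x) (INR (S m) * PI) (- (PI / 2)) (PI / 2)).
        * apply RInt_ext. intros x _. now rewrite fejer_period.
        * apply ex_RInt_cont. intros x.
          apply (continuous_mult f (fejer n)); [apply Cf|apply fejer_continuous]. }
  assert (Hleft : is_lim_seq (fun n => sum_n s n / INR (S n))
    (PI * f (INR 0 * PI) + 2 * Series (fun m => PI * f (INR (S m) * PI)))).
  { apply (is_lim_seq_ext (fun n => cell 0%nat n + 2 * Series (fun m => cell (S m) n)));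
      [intros n; symmetry; apply Hdec|].
    apply (is_lim_seq_plus' (cell 0%nat)); [apply Hcell|].
    apply (is_lim_seq_scal_l _ 2 (Series (fun m => PI * f (INR (S m) * PI)))).
    (* A majorant independent of [n]: on the cell around (m+1) pi the argument is at least (m + 1/2)
       pi >= m + 1, so the Gaussian is at most e^(-lam (m+1)), and the normalized kernel has mass
       pi. *)
    apply (tannery eventually (fun m n => cell (S m) n) (fun m => PI * f (INR (S m) * PI))
      (fun m => PI * exp (- lam * INR (S m)))).
    - intros m. apply Hcell.
    - exists 0%nat. intros n _ m. unfold cell.
      assert (Hn : 0 < INR (S n)) by (apply lt_0_INR; lia).
      unfold Rdiv at 1. rewrite Rabs_mult, (Rabs_pos_eq (/ _)) by (left; now apply Rinv_0_lt_compat).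
      apply Rmult_le_reg_r with (INR (S n)); [exact Hn|].
      rewrite Rmult_assoc, Rinv_l, Rmult_1_r by lra.
      eapply Rle_trans; [apply (RInt_abs_bound _ (fun x => exp (- lam * INR (S m)) * fejer n x))|].
      + lra.
      + apply ex_RInt_cont. intros x.
        apply (continuous_mult (fun x => f (x + INR (S m) * PI)) (fejer n)); [|apply fejer_continuous].
        apply (continuous_comp (fun x => x + INR (S m) * PI) f); [|apply Cf].
        apply (ex_derive_continuous (fun x => x + INR (S m) * PI)). auto_derive. auto.
      + apply (ex_RInt_scal (fejer n)). apply ex_RInt_cont, fejer_continuous.
      + intros x Hx. assert (F0 := fejer_nonneg n x Hx).
        rewrite Rabs_mult, (Rabs_pos_eq (fejer n x)) by exact F0.
        apply Rmult_le_compat_r; [exact F0|]. unfold f. rewrite Rabs_pos_eq by (left; apply exp_pos).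
        assert (Hm : 1 <= INR (S m)) by (rewrite S_INR; assert (Q := pos_INR m); lra).
        assert (H1 : INR (S m) <= x + INR (S m) * PI) by nra.
        assert (H : - lam * (x + INR (S m) * PI) ^ 2 <= - lam * INR (S m)).
        { assert (INR (S m) <= (x + INR (S m) * PI) ^ 2) by nra. nra. }
        destruct H as [H|H]; [left; now apply exp_increasing|right; now rewrite H].
      + right. rewrite RInt_scal_R, RInt_fejer; [toR; ring|]. apply ex_RInt_cont, fejer_continuous.
    - apply (ex_series_scal_l PI (fun m => exp (- lam * INR (S m)))). eexists.
      apply is_series_exp_geom; exact Hl. }
  assert (E := is_lim_seq_unique _ _ Hleft). rewrite (is_lim_seq_unique _ _ Hright) in E.
  apply (f_equal real) in E. cbn [real] in E. rewrite E, Series_scal_l. unfold f at 1.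
  replace (- lam * (INR 0 * PI) ^ 2) with 0 by (simpl; ring). rewrite exp_0. unfold f. ring.
Qed.

Lemma exp_le_mono (x y : R) : x <= y -> exp x <= exp y.
Proof. intros [H|H]; [left; now apply exp_increasing|right; now rewrite H]. Qed.

(** * The theta function *)

Definition theta (x : R) : R := 1 + 2 * Series (fun n => exp (- (PI * x) * INR (S n) ^ 2)).

Lemma ex_series_theta (x : R) : 0 < x -> ex_series (fun n => exp (- (PI * x) * INR (S n) ^ 2)).
Proof. intros Hx. apply ex_series_gauss. apply Rmult_lt_0_compat; [apply PI_RGT_0|exact Hx]. Qed.

Lemma theta_ge_1 (x : R) : 0 < x -> 1 <= theta x.
Proof.
  intros Hx. unfold theta.
  assert (H := is_series_le_bound _ _ 0 (fun n => Rlt_le _ _ (exp_pos _))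
    (Series_correct _ (ex_series_theta x Hx))).
  rewrite sum_O in H. assert (P := exp_pos (- (PI * x) * INR 1 ^ 2)). lra.
Qed.

Lemma integ_gauss_scale (c lam : R) : 0 < lam -> integ (fun x => exp (- (1) * x ^ 2)) c ->
  integ (fun x => exp (- lam * x ^ 2)) (c / sqrt lam).
Proof.
  intros Hl Hc. assert (Hs : 0 < sqrt lam) by now apply sqrt_lt_R0.
  replace (c / sqrt lam) with (/ sqrt lam * c) by (unfold Rdiv; ring).
  apply integ_ext with (fun x => / sqrt lam * (sqrt lam * exp (- (1) * (sqrt lam * x) ^ 2))).
  { intros x. rewrite <- Rmult_assoc, Rinv_l, Rmult_1_l by lra. f_equal.
    rewrite Rpow_mult_distr, pow2_sqrt by lra. ring. }
  apply integ_scal.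
  apply (integ_comp (fun x => exp (- (1) * x ^ 2)) (fun x => sqrt lam * x) (fun _ => sqrt lam)); auto.
  - intros x. apply (ex_derive_continuous (fun x => exp (- (1) * x ^ 2))). auto_derive. auto.
  - intros x. auto_derive; [auto|]. ring.
  - intros x. apply continuous_const.
  - intros K. exists (K / sqrt lam). intros x Hx.
    apply Rmult_le_compat_l with (r := sqrt lam) in Hx; [|lra].
    replace (sqrt lam * (K / sqrt lam)) with K in Hx by (field; lra). exact Hx.
  - intros K. exists (K / sqrt lam). intros x Hx.
    apply Rmult_le_compat_l with (r := sqrt lam) in Hx; [|lra].
    replace (sqrt lam * (K / sqrt lam)) with K in Hx by (field; lra). exact Hx.
Qed.

(* The case [x = 1] of the Poisson formula determines the Gaussian integral. *)
Lemma theta_gauss : integ (fun u => exp (- PI * u ^ 2)) 1 /\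
  forall x, 0 < x -> theta (/ x) = sqrt x * theta x.
Proof.
  assert (P := PI_RGT_0).
  destruct (gauss_fourier 1 Rlt_0_1) as [c [Hc _]].
  (* With lam = x / pi the exponents of the Poisson formula become pi n^2 x and pi n^2 / x. *)
  assert (HE : forall x, 0 < x -> PI * theta x = c / sqrt (x / PI) * theta (/ x)).
  { intros x Hx. assert (Hl : 0 < x / PI) by (apply Rdiv_lt_0_compat; lra).
    assert (Hs : 0 < sqrt (x / PI)) by now apply sqrt_lt_R0.
    destruct (gauss_fourier (x / PI) Hl) as [c' [Hc' HF]].
    rewrite <- (integ_unique _ _ _ Hc' (integ_gauss_scale c (x / PI) Hl Hc)).
    assert (E := poisson_gauss (x / PI) c' Hl Hc' HF). unfold theta.
    rewrite (Series_ext (fun n => exp (- (PI * x) * INR (S n) ^ 2))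
      (fun n => exp (- (x / PI) * (INR (S n) * PI) ^ 2))).
    - rewrite E. do 3 f_equal. apply Series_ext. intros n. f_equal. f_equal. field. lra.
    - intros n. f_equal. field. lra. }
  assert (Hth := theta_ge_1 1 Rlt_0_1).
  assert (Hsp : 0 < sqrt PI) by now apply sqrt_lt_R0.
  assert (Hpp : sqrt PI * sqrt PI = PI) by (apply sqrt_sqrt; lra).
  assert (Ec : c = sqrt PI).
  { assert (E := HE 1 Rlt_0_1). rewrite Rinv_1 in E. unfold Rdiv in E.
    rewrite Rmult_1_l, sqrt_inv, Rinv_inv in E.
    apply Rmult_eq_reg_r in E; [|lra].
    apply Rmult_eq_reg_r with (sqrt PI); [|lra]. rewrite Hpp. now symmetry. }
  subst c. split.
  - assert (E := integ_gauss_scale (sqrt PI) PI P Hc).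
    replace (sqrt PI / sqrt PI) with 1 in E by (field; lra). exact E.
  - intros x Hx. assert (E := HE x Hx).
    assert (Hsx : 0 < sqrt x) by now apply sqrt_lt_R0.
    rewrite sqrt_div in E by lra.
    apply Rmult_eq_reg_l with PI; [|lra].
    replace (PI * (sqrt x * theta x)) with (sqrt x * (PI * theta x)) by ring. rewrite E.
    rewrite <- Hpp at 1. field. split; lra.
Qed.

Lemma sqrt_exp (u : R) : sqrt (exp u) = exp (u / 2).
Proof.
  replace u with (u / 2 + u / 2) at 1 by field. rewrite exp_plus.
  apply sqrt_square. left; apply exp_pos.
Qed.

Lemma theta_reflect (u : R) : theta (exp (- u)) = exp (u / 2) * theta (exp u).
Proof. rewrite exp_Ropp, (proj2 theta_gauss) by apply exp_pos. now rewrite sqrt_exp. Qed.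

(** Comparison with a geometric series of ratio e^(-pi x) <= 1/2, whose sum is at most twice its
    first term; theta doubles it again. *)
Lemma theta_decay (x : R) : 1 <= x -> theta x - 1 <= 4 * exp (- x).
Proof.
  intros Hx. unfold theta. assert (P3 := PI2_3_2).
  assert (Hpx : 0 < PI * x) by (apply Rmult_lt_0_compat; lra).
  assert (Hgeom := is_series_exp_geom (PI * x) Hpx).
  assert (H : Series (fun n => exp (- (PI * x) * INR (S n) ^ 2)) <= exp (- (PI * x)) /
    (1 - exp (- (PI * x)))).
  { rewrite <- (is_series_unique _ _ Hgeom). apply Series_le.
    - intros n. split; [left; apply exp_pos|now apply gauss_le_geom].
    - eexists; exact Hgeom. }
  assert (H1 : exp (- (PI * x)) <= / 2).
  { rewrite exp_Ropp. apply Rinv_le_contravar; [lra|]. assert (E := exp_ineq1_le (PI * x)). nra. }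
  assert (H2 : exp (- (PI * x)) <= exp (- x)) by (apply exp_le_mono; nra).
  assert (H0 := exp_pos (- (PI * x))).
  assert (H3 : exp (- (PI * x)) / (1 - exp (- (PI * x))) <= 2 * exp (- x)).
  { apply Rmult_le_reg_r with (1 - exp (- (PI * x))); [lra|].
    unfold Rdiv. rewrite Rmult_assoc, Rinv_l by lra. assert (Q := exp_pos (- x)). nra. }
  lra.
Qed.

Lemma theta_exp_continuous (u : R) : continuous (fun u => theta (exp u)) u.
Proof.
  unfold theta. apply (continuous_plus (fun _ => 1)); [apply continuous_const|].
  apply (continuous_mult (fun _ => 2)); [apply continuous_const|].
  assert (P := PI_RGT_0).
  (* Each term decreases in [u], so its value at the left end u - 1 of the neighbourhood
     dominates. *)
  apply (continuous_Series (fun n u => exp (- (PI * exp u) * INR (S n) ^ 2))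
    (fun n => exp (- (PI * exp (u - 1)) * INR (S n) ^ 2))).
  - intros n. apply (ex_derive_continuous (fun u => exp (- (PI * exp u) * INR (S n) ^ 2))). auto_derive.
    auto.
  - exists (mkposreal 1 Rlt_0_1). intros t Ht n. change (Rabs (t - u) < 1) in Ht.
    rewrite Rabs_pos_eq by (left; apply exp_pos). apply exp_le_mono.
    apply Rmult_le_compat_r; [apply pow2_ge_0|]. apply Ropp_le_contravar.
    apply Rmult_le_compat_l; [lra|]. apply exp_le_mono. apply Rabs_def2 in Ht. lra.
  - apply ex_series_theta, exp_pos.
Qed.

(** The sum of e^(-pi |v|^2 x) over the nonzero vectors v of Z^j, taken at x = e^u: Mellin integrals
    against dx/x become integrals over the line. *)
Definition theta_excess (j : nat) (u : R) : R := theta (exp u) ^ j - 1.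

Lemma theta_excess_continuous (j : nat) (u : R) : continuous (theta_excess j) u.
Proof.
  apply (continuous_minus (fun u => theta (exp u) ^ j) (fun _ => 1)); [|apply continuous_const].
  induction j as [|j IH]; [apply continuous_const|].
  apply (continuous_mult (fun u => theta (exp u)) (fun u => theta (exp u) ^ j));
    [apply theta_exp_continuous|exact IH].
Qed.

Lemma theta_excess_nonneg (j : nat) (u : R) : 0 <= theta_excess j u.
Proof. unfold theta_excess. assert (H := pow_R1_Rle (theta (exp u)) j (theta_ge_1 _ (exp_pos u))). lra.
Qed.

Lemma theta_pow_reflect (j : nat) (u : R) : theta (exp (- u)) ^ j = exp (INR j / 2 * u) * theta (exp u) ^
  j.
Proof.
  rewrite theta_reflect, Rpow_mult_distr. f_equal. rewrite <- exp_mult_INR. f_equal. field.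
Qed.

(** For N > 0 the constant is the maximum of e^(Nu - e^u), attained at u = ln N. *)
Lemma exp_exp_decay (N : R) : 0 <= N -> exists C, 0 < C /\ forall u, exp (- exp u) <= C * exp (- N * u).
Proof.
  intros [HN| <-].
  - exists (exp (N * ln N - N)). split; [apply exp_pos|]. intros u. rewrite <- exp_plus.
    apply exp_le_mono.
    assert (H := exp_ineq1_le (u - ln N)).
    assert (E : exp u = N * exp (u - ln N)).
    { rewrite <- (exp_ln N HN) at 1. rewrite <- exp_plus. f_equal. ring. }
    rewrite E. apply Rmult_le_compat_l with (r := N) in H; lra.
  - exists 1. split; [lra|]. intros u. rewrite Ropp_0, Rmult_0_l, exp_0, Rmult_1_r, <- exp_0.
    apply exp_le_mono. assert (H := exp_pos u). lra.
Qed.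

(** At plus infinity the excess decays faster than any exponential; at minus infinity reflection
    makes it grow like e^(-ju/2), whence the condition on [N]. Different values of [N] yield the
    bounds at the two ends required by [integ_exp_bound]. *)
Lemma theta_excess_bound (j : nat) (N : R) : INR j / 2 <= N -> exists C, 0 < C /\ forall u, theta_excess
  j u <= C * exp (- N * u).
Proof.
  intros HN. assert (Hj := pos_INR j).
  assert (Hbig : exists K, 0 < K /\ forall u, 0 <= u -> theta_excess j u <= K * exp (- exp u)).
  { clear. unfold theta_excess. induction j as [|j [K [HK IH]]].
    - exists 1. split; [lra|]. intros u _. simpl. assert (H := exp_pos (- exp u)). lra.
    (* For x >= 1 theta is at most 3 and theta - 1 at most 4 e^(-x); theta^(j+1) - 1 is split as
       theta (theta^j - 1) + (theta - 1). *)
    - exists (3 * K + 4). split; [lra|]. intros u Hu. specialize (IH u Hu).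
      assert (Hx : 1 <= exp u) by (rewrite <- exp_0; now apply exp_le_mono).
      assert (Hd := theta_decay (exp u) Hx). assert (H1 := theta_ge_1 (exp u) (exp_pos u)).
      assert (H3 : theta (exp u) <= 3).
      { assert (exp (- exp u) <= / 2); [|lra]. rewrite exp_Ropp. apply Rinv_le_contravar; [lra|].
        assert (E := exp_ineq1_le (exp u)). lra. }
      assert (Hp := pow_R1_Rle (theta (exp u)) j H1).
      simpl. replace (theta (exp u) * theta (exp u) ^ j - 1) with
        (theta (exp u) * (theta (exp u) ^ j - 1) + (theta (exp u) - 1)) by ring.
      assert (theta (exp u) * (theta (exp u) ^ j - 1) <= 3 * (K * exp (- exp u)))
        by (apply Rmult_le_compat; lra).
      lra. }
  destruct Hbig as [K [HK Hbig]].
  destruct (exp_exp_decay N) as [C [HC Hdec]]; [lra|].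
  exists (K * C + (K + 1)). assert (HKC : 0 < K * C) by now apply Rmult_lt_0_compat. split; [lra|].
  intros u. assert (Hpos := exp_pos (- N * u)).
  destruct (Rle_or_lt 0 u) as [Hu|Hu].
  - eapply Rle_trans; [apply (Hbig u Hu)|].
    assert (K * exp (- exp u) <= K * (C * exp (- N * u))) by (apply Rmult_le_compat_l; [lra|apply Hdec]).
    nra.
  - assert (E := theta_pow_reflect j (- u)). rewrite Ropp_involutive in E.
    assert (Hb := Hbig (- u) ltac:(lra)). unfold theta_excess in *. rewrite E.
    assert (H1 : exp (- exp (- u)) <= 1).
    { rewrite <- exp_0. apply exp_le_mono. assert (H := exp_pos (- u)). lra. }
    assert (H2 : theta (exp (- u)) ^ j <= K + 1) by nra.
    assert (H3 : exp (INR j / 2 * - u) <= exp (- N * u)) by (apply exp_le_mono; nra).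
    assert (H4 : 0 <= theta (exp (- u)) ^ j)
      by (apply pow_le; assert (Q := theta_ge_1 _ (exp_pos (- u))); lra).
    assert (H5 : exp (INR j / 2 * - u) * theta (exp (- u)) ^ j <= exp (- N * u) * (K + 1))
      by (apply Rmult_le_compat; auto; left; apply exp_pos).
    assert (0 <= K * C * exp (- N * u)) by (apply Rmult_le_pos; lra). lra.
Qed.

(** * Lattice points *)

Definition lsum {A : Type} (g : A -> R) (l : list A) : R := fold_right Rplus 0 (map g l).

Lemma lsum_app {A : Type} (g : A -> R) (l l' : list A) : lsum g (l ++ l') = lsum g l + lsum g l'.
Proof. unfold lsum. induction l as [|a l IH]; simpl; [ring|]. rewrite IH. ring. Qed.

Lemma sumsq_nonneg (v : list Z) : (0 <= sumsq v)%Z.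
Proof. induction v as [|a v IH]; simpl; [lia|]. nia. Qed.

Lemma sumsq_entry (v : list Z) (a : Z) : In a v -> (a * a <= sumsq v)%Z.
Proof.
  induction v as [|b v IH]; simpl; [tauto|]. assert (H := sumsq_nonneg v).
  intros [->|Hin]; [lia|]. specialize (IH Hin). nia.
Qed.

Lemma is_zero_vec_sumsq (v : list Z) : is_zero_vec v = true <-> sumsq v = 0%Z.
Proof.
  induction v as [|a v IH]; simpl; [tauto|]. assert (H := sumsq_nonneg v).
  unfold is_zero_vec in *. simpl. rewrite Bool.andb_true_iff, IH, Z.eqb_eq. split; nia.
Qed.

Lemma In_zrange (N : nat) (a : Z) : In a (zrange N) <-> (- Z.of_nat N <= a <= Z.of_nat N)%Z.
Proof.
  unfold zrange. rewrite in_map_iff. split.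
  - intros [i [<- Hi]]. apply in_seq in Hi. lia.
  - intros H. exists (Z.to_nat (a + Z.of_nat N)). split; [lia|]. apply in_seq. lia.
Qed.

Lemma NoDup_zrange (N : nat) : NoDup (zrange N).
Proof.
  unfold zrange. apply Injective_map_NoDup; [|apply seq_NoDup]. intros i j. lia.
Qed.

Lemma In_tuples (j : nat) (l v : list Z) :
  In v (tuples j l) <-> length v = j /\ (forall a, In a v -> In a l).
Proof.
  revert v. induction j as [|j IH]; intros v; simpl.
  - split.
    + intros [<-|[]]. simpl. tauto.
    + intros [H _]. left. now destruct v.
  - rewrite in_flat_map. split.
    + intros [a [Ha Hv]]. apply in_map_iff in Hv. destruct Hv as [w [<- Hw]].
      apply IH in Hw. destruct Hw as [Hl Hw]. split; [simpl; now rewrite Hl|].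
      intros b [<-|Hb]; auto.
    + intros [Hl Hv]. destruct v as [|a v]; [discriminate|]. exists a. split; [apply Hv; now left|].
      apply in_map. apply IH. split; [now injection Hl|]. intros b Hb. apply Hv. now right.
Qed.

Lemma NoDup_tuples (j : nat) (l : list Z) : NoDup l -> NoDup (tuples j l).
Proof.
  intros Hl. induction j as [|j IH]; simpl; [repeat constructor; simpl; tauto|].
  revert Hl. generalize l at 1 3. intros l' Hl'.
  induction Hl' as [|a l' Ha Hl' IHl]; simpl; [constructor|].
  apply NoDup_app; [|exact IHl|].
  - apply Injective_map_NoDup; [|exact IH]. intros x y H. now injection H.
  - intros v Hv Hv'. apply in_map_iff in Hv. destruct Hv as [w [<- _]].
    apply in_flat_map in Hv'. destruct Hv' as [b [Hb Hv']]. apply in_map_iff in Hv'.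
    destruct Hv' as [w' [E _]]. injection E as E _. subst b. contradiction.
Qed.

(** In [r] the box depends on [n]; here its size is free, since a sum over one box involves all [n]
    at once. *)
Definition cnt (j N n : nat) : nat :=
  length (filter (fun v => Z.eqb (sumsq v) (Z.of_nat n)) (tuples j (zrange N))).

(** Either the new box contains the old one, or it contains every vector of squared norm [n], whose
    entries are at most [n] in absolute value. *)
Lemma cnt_mono (j N N' n : nat) : (n <= N' \/ N <= N')%nat -> (cnt j N n <= cnt j N' n)%nat.
Proof.
  intros HN. unfold cnt. apply NoDup_incl_length.
  - apply NoDup_filter, NoDup_tuples, NoDup_zrange.
  - intros v Hv. apply filter_In in Hv. destruct Hv as [Hv Hs]. apply filter_In. split; [|exact Hs].
    apply In_tuples in Hv. apply In_tuples. split; [tauto|]. intros a Ha.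
    destruct Hv as [_ Hv]. specialize (Hv a Ha). apply In_zrange in Hv. apply In_zrange.
    apply Z.eqb_eq in Hs. assert (Hq := sumsq_entry v a Ha). nia.
Qed.

Lemma cnt_le_r (j N n : nat) : (cnt j N n <= r j n)%nat.
Proof. apply (cnt_mono j N n n). lia. Qed.

Lemma cnt_eq_r (j N n : nat) : (n <= N)%nat -> cnt j N n = r j n.
Proof. intros H. apply Nat.le_antisymm; [apply cnt_le_r|apply (cnt_mono j n N n); lia]. Qed.

Definition boxsum (j N : nat) (g : nat -> R) : R :=
  lsum (fun v => g (Z.to_nat (sumsq v))) (tuples j (zrange N)).

Lemma sum_n_count (g : nat -> R) (M : nat) (L : list (list Z)) :
  sum_n (fun n => INR (length (filter (fun v => Z.eqb (sumsq v) (Z.of_nat n)) L)) * g n) M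
  = lsum (fun v => if Nat.leb (Z.to_nat (sumsq v)) M then g (Z.to_nat (sumsq v)) else 0) L.
Proof.
  induction L as [|v L IH].
  - transitivity (sum_n (fun _ => 0) M).
    + apply sum_n_ext. intros n. simpl. toR. ring.
    + rewrite sum_n_const. apply Rmult_0_r.
  - unfold lsum in *. simpl map. simpl fold_right. rewrite <- IH.
    assert (Hs := sumsq_nonneg v). set (m := Z.to_nat (sumsq v)).
    transitivity (sum_n (fun n => plus ((if Nat.eqb n m then 1 else 0) * g n)
      (INR (length (filter (fun v0 => Z.eqb (sumsq v0) (Z.of_nat n)) L)) * g n)) M).
    + apply sum_n_ext. intros n. simpl filter.
      destruct (Z.eqb_spec (sumsq v) (Z.of_nat n)) as [E|E];
        destruct (Nat.eqb_spec n m) as [E'|E']; unfold plus; simpl AbelianMonoid.plus.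
      * simpl length. rewrite S_INR. simpl. ring.
      * exfalso. unfold m in E'. lia.
      * exfalso. unfold m in E'. lia.
      * simpl. ring.
    + rewrite sum_n_plus. unfold plus; simpl. f_equal. clear IH. clearbody m.
      induction M as [|M IH].
      * rewrite sum_O. destruct m; simpl; toR; ring.
      * rewrite sum_Sn, IH.
        destruct (Nat.eqb_spec (S M) m) as [E|E]; destruct (Nat.leb_spec m M);
          destruct (Nat.leb_spec m (S M));
          try lia; subst; unfold plus; simpl; toR; ring.
Qed.

Lemma boxsum_lower (j N : nat) (g : nat -> R) : (forall n, 0 <= g n) ->
  sum_n (fun n => INR (r j n) * g n) N <= boxsum j N g.
Proof.
  intros Hg. rewrite (sum_n_ext_loc _ (fun n => INR (cnt j N n) * g n)).
  - unfold cnt. rewrite sum_n_count. unfold boxsum, lsum.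
    induction (tuples j (zrange N)) as [|v L IH]; simpl; [lra|].
    assert (P := Hg (Z.to_nat (sumsq v))). destruct (Nat.leb _ N); lra.
  - intros n Hn. now rewrite cnt_eq_r.
Qed.

Lemma sumsq_le (v : list Z) (N : nat) : (forall a, In a v -> In a (zrange N)) ->
  (sumsq v <= Z.of_nat (length v * N * N))%Z.
Proof.
  induction v as [|a v IH]; intros H; simpl; [lia|].
  assert (Ha := H a (or_introl eq_refl)). apply In_zrange in Ha.
  specialize (IH (fun b Hb => H b (or_intror Hb))). nia.
Qed.

(** Vectors in the box have squared norm at most j N^2. The extra [N] keeps the upper index
    unbounded for j = 0, as the subsequence argument in [boxsum_lim_series] demands. *)
Lemma boxsum_upper (j N : nat) (g : nat -> R) : (forall n, 0 <= g n) ->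
  boxsum j N g <= sum_n (fun n => INR (r j n) * g n) (j * N * N + N).
Proof.
  intros Hg. apply Rle_trans with (sum_n (fun n => INR (cnt j N n) * g n) (j * N * N + N)).
  - unfold cnt. rewrite sum_n_count. unfold boxsum.
    assert (H : forall v, In v (tuples j (zrange N)) -> (Z.to_nat (sumsq v) <= j * N * N + N)%nat).
    { intros v Hv. apply In_tuples in Hv. destruct Hv as [<- Hv]. apply sumsq_le in Hv. lia. }
    unfold lsum. revert H. induction (tuples j (zrange N)) as [|v L IH]; intros H; simpl; [lra|].
    assert (Hv := H v (or_introl eq_refl)). apply Nat.leb_le in Hv. rewrite Hv.
    apply Rplus_le_compat_l. apply IH. intros w Hw. apply H. now right.
  - rewrite !sum_n_Reals. apply sum_Rle. intros n _. apply Rmult_le_compat_r; [apply Hg|].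
    apply le_INR, cnt_le_r.
Qed.

(** For nonnegative [g] the box sums and the partial sums by norm interlace. Left to right it serves
    the powers of theta, whose box sums factor; right to left it serves [Phi], a limit of products
    over boxes. *)
Lemma boxsum_lim_series (j : nat) (g : nat -> R) (L : R) : (forall n, 0 <= g n) ->
  is_lim_seq (fun N => boxsum j N g) L <-> is_series (fun n => INR (r j n) * g n) L.
Proof.
  intros Hg. rewrite is_series_R. set (s := sum_n (fun n => INR (r j n) * g n)).
  assert (Hmono : forall n m, (n <= m)%nat -> s n <= s m).
  { intros n m H. induction H; [lra|]. unfold s in *. rewrite sum_Sn.
    unfold plus; simpl AbelianMonoid.plus.
    assert (0 <= INR (r j (S m)) * g (S m)) by (apply Rmult_le_pos; [apply pos_INR|apply Hg]).
    unfold plus; simpl. lra. }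
  assert (Hlo : forall N, s N <= boxsum j N g) by (intros N; now apply boxsum_lower).
  assert (Hup : forall N, boxsum j N g <= s (j * N * N + N)%nat) by (intros N; now apply boxsum_upper).
  split; intros H.
  - assert (Hle : forall n, s n <= L).
    { intros n. apply (is_lim_seq_le_loc (fun _ => s n) (fun N => boxsum j N g) (s n) L); auto.
      - exists n. intros m Hm. eapply Rle_trans; [apply Hmono; exact Hm|apply Hlo].
      - apply is_lim_seq_const. }
    apply is_lim_seq_spec. intros eps. apply is_lim_seq_spec in H. destruct (H eps) as [N HN].
    specialize (HN N (le_n _)). exists (j * N * N + N)%nat. intros n Hn.
    assert (H1 := Hmono _ _ Hn). assert (H2 := Hup N). assert (H3 := Hle n).
    apply Rabs_def2 in HN. apply Rabs_def1; destruct eps; simpl in *; lra.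
  - apply (is_lim_seq_le_le s _ (fun N => s (j * N * N + N)%nat)); [intros N; split; auto|exact H|].
    apply (is_lim_seq_subseq s L (fun N => (j * N * N + N)%nat)); [|exact H].
    intros P [N HN]. exists N. intros n Hn. apply HN. lia.
Qed.

Lemma r_zero (j : nat) : r j 0 = 1%nat.
Proof.
  unfold r. change (zrange 0) with [0%Z].
  assert (H : tuples j [0%Z] = [repeat 0%Z j]).
  { induction j as [|j IH]; [reflexivity|]. simpl. now rewrite IH. }
  rewrite H. simpl filter.
  replace (sumsq (repeat 0%Z j)) with 0%Z; [reflexivity|]. clear H.
  induction j as [|j IH]; [reflexivity|exact IH].
Qed.

Lemma zrange_S (N : nat) : zrange (S N) = ((- Z.of_nat (S N))%Z :: zrange N) ++ [Z.of_nat (S N)].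
Proof.
  unfold zrange. replace (2 * S N + 1)%nat with (S (2 * N + 1) + 1)%nat by lia.
  rewrite seq_app, map_app. f_equal.
  - simpl seq. simpl map. f_equal. rewrite <- seq_shift, map_map. apply map_ext. intros i. lia.
  - cbn [seq map]. f_equal. lia.
Qed.

Lemma lsum_zrange_even (h : Z -> R) (N : nat) : (forall a, h (- a)%Z = h a) ->
  lsum h (zrange (S N)) = h 0%Z + 2 * sum_n (fun n => h (Z.of_nat (S n))) N.
Proof.
  intros Hh.
  assert (E : forall N, lsum h (zrange (S N)) = lsum h (zrange N) + 2 * h (Z.of_nat (S N))).
  { intros M. rewrite zrange_S, lsum_app.
    change (h (- Z.of_nat (S M))%Z + lsum h (zrange M) + (h (Z.of_nat (S M)) + 0)
            = lsum h (zrange M) + 2 * h (Z.of_nat (S M))).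
    rewrite Hh. ring. }
  induction N as [|N IH].
  - rewrite E, sum_O. unfold lsum at 1. simpl. ring.
  - rewrite E, IH, sum_Sn. unfold plus; simpl AbelianMonoid.plus. unfold plus; simpl. ring.
Qed.

Lemma lsum_tuples_pow (f : Z -> R) (F : list Z -> R) (j : nat) (l : list Z) :
  F [] = 1 -> (forall a v, F (a :: v) = f a * F v) ->
  lsum F (tuples j l) = lsum f l ^ j.
Proof.
  intros F0 FS. induction j as [|j IH]; [unfold lsum; simpl; rewrite F0; ring|].
  simpl. rewrite <- IH. clear IH. generalize (tuples j l). intros T.
  induction l as [|a l IHl]; [unfold lsum; simpl; ring|].
  simpl. rewrite lsum_app, IHl. clear IHl.
  replace (lsum f (a :: l)) with (f a + lsum f l) by reflexivity. rewrite Rmult_plus_distr_r. f_equal.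
  unfold lsum. rewrite map_map. induction T as [|v T IHT]; simpl; [ring|]. rewrite IHT, FS. ring.
Qed.

(** The exponential is multiplicative over the entries of a vector, so a box sum in Z^j is the j-th
    power of a one-dimensional sum. The zero vector accounts for the 1 subtracted. *)
Lemma theta_pow_series (j : nat) (x : R) : 0 < x ->
  is_series (fun n => INR (r j (S n)) * exp (- (PI * x) * INR (S n))) (theta x ^ j - 1).
Proof.
  intros Hx.
  assert (H : is_series (fun n => INR (r j n) * exp (- (PI * x) * INR n)) (theta x ^ j)).
  { apply (boxsum_lim_series j (fun n => exp (- (PI * x) * INR n))); [intros n; left; apply exp_pos|].
    apply is_lim_seq_incr_1.
    apply (is_lim_seq_ext (fun N => (1 + 2 * sum_n (fun n => exp (- (PI * x) * INR (S n) ^ 2)) N) ^ j)).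
    - intros N. unfold boxsum.
      rewrite (lsum_tuples_pow (fun a => exp (- (PI * x) * IZR (a * a)))).
      + rewrite lsum_zrange_even.
        * f_equal. replace (- (PI * x) * IZR (0 * 0)) with 0 by (simpl; ring). rewrite exp_0.
          do 2 f_equal.
          apply sum_n_ext. intros n. f_equal. rewrite mult_IZR, <- INR_IZR_INZ. ring.
        * intros a. f_equal. f_equal. f_equal. ring.
      + simpl. rewrite Rmult_0_r. apply exp_0.
      + intros a v. rewrite <- exp_plus. f_equal. simpl sumsq. assert (Hs := sumsq_nonneg v).
        rewrite !INR_IZR_INZ, !Z2Nat.id by nia. rewrite plus_IZR. ring.
    - assert (Hl : is_lim_seq (fun N => 1 + 2 * sum_n (fun n => exp (- (PI * x) * INR (S n) ^ 2)) N)
        (theta x)).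
      { apply (is_lim_seq_plus' (fun _ => 1)); [apply is_lim_seq_const|].
        apply (is_lim_seq_scal_l _ 2 (Series (fun n => exp (- (PI * x) * INR (S n) ^ 2)))).
        apply is_series_R. apply Series_correct. now apply ex_series_theta. }
      induction j as [|j IH]; [apply is_lim_seq_const|].
      apply (is_lim_seq_mult' _ _ (theta x) (theta x ^ j)); assumption. }
  apply (is_series_incr_1 (fun n => INR (r j n) * exp (- (PI * x) * INR n))).
  replace (plus _ _) with (theta x ^ j); [exact H|].
  rewrite r_zero. simpl INR. rewrite Rmult_0_r, exp_0. unfold plus; simpl. ring.
Qed.

Lemma theta_excess_series (j : nat) (u : R) :
  is_series (fun n => INR (r j (S n)) * exp (- (PI * exp u) * INR (S n))) (theta_excess j u).
Proof. apply theta_pow_series, exp_pos. Qed.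

(** The logarithm turns each finite product into a box sum of [g], and the value 0 at index 0
    replaces the filter that removes the zero vector. Summability is a hypothesis here; [integ_Phi]
    obtains it from [tonelli_series]. *)
Lemma Phi_eq (k : nat) (g : nat -> R) (L : R) :
  g 0%nat = 0 -> (forall n, g (S n) = - ln (1 - exp (- 2 * PI * sqrt (INR (S n))))) ->
  is_series (fun n => INR (r (k - 1) (S n)) * g (S n)) L -> Phi k = exp (- L).
Proof.
  intros g0 gS HL. assert (P := PI_RGT_0).
  assert (Hlt : forall n, 0 < 1 - exp (- 2 * PI * sqrt (INR (S n))) < 1).
  { intros n. assert (Hs : 0 < sqrt (INR (S n))) by (apply sqrt_lt_R0, lt_0_INR; lia).
    assert (E := exp_pos (- 2 * PI * sqrt (INR (S n)))).
    assert (exp (- 2 * PI * sqrt (INR (S n))) < 1); [|lra].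
    rewrite <- exp_0. apply exp_increasing.
    assert (0 < PI * sqrt (INR (S n))) by now apply Rmult_lt_0_compat. lra. }
  assert (Hg : forall n, 0 <= g n).
  { intros [|n]; [lra|]. rewrite gS. assert (H := Hlt n).
    assert (ln (1 - exp (- 2 * PI * sqrt (INR (S n)))) < ln 1) by (apply ln_increasing; lra).
    rewrite ln_1 in *. lra. }
  assert (HB : is_lim_seq (fun N => boxsum (k - 1) N g) L).
  { apply boxsum_lim_series; [exact Hg|]. apply is_series_decr_1.
    replace (plus L _) with L; [exact HL|]. rewrite g0, Rmult_0_r. unfold plus, opp; simpl. ring. }
  unfold Phi.
  assert (Hlim : is_lim_seq (fun N => exp (- boxsum (k - 1) N g)) (exp (- L))).
  { apply (is_lim_seq_continuous (fun x => exp (- x))); [|exact HB].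
    apply continuity_pt_filterlim. apply (ex_derive_continuous (fun x => exp (- x))). auto_derive. auto.
    }
  erewrite (Lim_seq_ext _ (fun N => exp (- boxsum (k - 1) N g))).
  - rewrite (is_lim_seq_unique _ _ Hlim). reflexivity.
  - intros N. unfold boxsum, lsum. induction (tuples (k - 1) (zrange N)) as [|v T IH]; simpl.
    + now rewrite Ropp_0, exp_0.
    + rewrite Ropp_plus_distr, exp_plus, <- IH.
      destruct (is_zero_vec v) eqn:Ev; simpl.
      * apply is_zero_vec_sumsq in Ev. rewrite Ev. simpl. rewrite g0, Ropp_0, exp_0. ring.
      * f_equal. assert (Hs := sumsq_nonneg v).
        assert (Hs0 : sumsq v <> 0%Z) by (intros E; apply is_zero_vec_sumsq in E; congruence).
        destruct (Z.to_nat (sumsq v)) as [|n] eqn:En; [lia|].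
        rewrite gS, Ropp_involutive, exp_ln by apply Hlt. do 4 f_equal.
        rewrite INR_IZR_INZ. f_equal. lia.
Qed.

(** * Mellin integrals *)

Lemma exp_exp_decay_scaled (kappa N : R) : 0 < kappa -> 0 <= N ->
  exists C, 0 < C /\ forall u, exp (- (kappa * exp u)) <= C * exp (- N * u).
Proof.
  intros Hk HN. destruct (exp_exp_decay N HN) as [C [HC H]].
  exists (C * exp (- N * ln kappa)). split; [apply Rmult_lt_0_compat; [exact HC|apply exp_pos]|].
  intros u. rewrite Rmult_assoc, <- exp_plus.
  replace (- N * ln kappa + - N * u) with (- N * (u + ln kappa)) by ring.
  eapply Rle_trans; [|apply H]. right. rewrite exp_plus, exp_ln by exact Hk. do 2 f_equal. ring.
Qed.

(** The polar part: for s > k/2 the integral of e^((s - k/2) u) over u < 0 is 1/(s - k/2), so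
    subtracting this indicator at s = k/2 leaves the constant term. *)
Definition step (u : R) : R := if Rlt_dec u 0 then 1 else 0.

Lemma is_RInt_step (b : R) : is_RInt step 0 b (Rmin b 0).
Proof.
  destruct (Rle_or_lt 0 b) as [Hb|Hb].
  - rewrite Rmin_right by exact Hb. apply is_RInt_ext with (fun _ => 0).
    + intros x Hx. rewrite Rmin_left in Hx by exact Hb. unfold step. destruct Rlt_dec; lra.
    + assert (H := is_RInt_const 0 b 0). rewrite Rminus_0_r in H.
      evar_last; [exact H|apply Rmult_0_r].
  - rewrite Rmin_left by lra. apply is_RInt_ext with (fun _ => 1).
    + intros x Hx. rewrite Rmax_left in Hx by lra. unfold step. destruct Rlt_dec; lra.
    + assert (H := is_RInt_const 0 b 1). rewrite Rminus_0_r in H.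
      evar_last; [exact H|apply Rmult_1_r].
Qed.

Lemma ex_RInt_step (a b : R) : ex_RInt step a b.
Proof.
  apply ex_RInt_Chasles with 0; [apply ex_RInt_swap|]; eexists; apply is_RInt_step.
Qed.

Lemma RInt_step (a b : R) : RInt step a b = Rmin b 0 - Rmin a 0.
Proof.
  assert (H := RInt_Chasles_R step 0 a b (ex_RInt_step _ _) (ex_RInt_step _ _)).
  rewrite !(is_RInt_unique _ _ _ _ (is_RInt_step _)) in H. lra.
Qed.

(** A Bessel integral of order 1/2. Put w = b e^(u/2) - a e^(-u/2). Then w^2 + 2ab = b^2 e^u + a^2
    e^(-u), and dw/du is half the sum of the weights b e^(u/2) and a e^(-u/2). Both weights give the
    same integral, so each gives e^(-2 pi a b) times a Gaussian integral in w. *)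
Lemma integ_bessel_half (a b : R) : 0 < a -> 0 < b ->
  integ (fun u => exp (u / 2 - PI * b ^ 2 * exp u - PI * a ^ 2 * exp (- u)))
    (exp (- (2 * PI * a * b)) / b).
Proof.
  intros Ha Hb. assert (P := PI_RGT_0).
  pose (E := fun u => exp (- (PI * b ^ 2 * exp u) - PI * a ^ 2 * exp (- u))).
  assert (Hkb : 0 < PI * b ^ 2) by (apply Rmult_lt_0_compat; [lra|now apply pow_lt]).
  assert (Hka : 0 < PI * a ^ 2) by (apply Rmult_lt_0_compat; [lra|now apply pow_lt]).
  assert (Hsq : forall u, exp (u / 2) * exp (u / 2) = exp u)
    by (intros u; rewrite <- exp_plus; f_equal; field).
  assert (CA : forall x, continuous (fun u => b * exp (u / 2) * E u) x).
  { intros x. apply (ex_derive_continuous (fun u => b * exp (u / 2) * E u)). unfold E. auto_derive. auto.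
    }
  assert (HA : exists l, integ (fun u => b * exp (u / 2) * E u) l).
  { destruct (exp_exp_decay_scaled (PI * b ^ 2) 1 Hkb) as [C [HC H]]; [lra|].
    assert (HE : forall u, 0 < E u <= exp (- (PI * b ^ 2 * exp u))).
    { intros u. split; [apply exp_pos|]. apply exp_le_mono. assert (Q := exp_pos (- u)). nra. }
    assert (HE1 : forall u, exp (- (PI * b ^ 2 * exp u)) <= 1).
    { intros u. rewrite <- exp_0. apply exp_le_mono. assert (Q := exp_pos u). nra. }
    destruct (integ_exp_bound (fun u => b * exp (u / 2) * E u) (b * (C + 1)) (/ 2)) as [l [Hl _]].
    - lra.
    - intros; now apply ex_RInt_cont.
    - intros u. assert (H1 := H u). assert (H2 := HE u). assert (Q := exp_pos (u / 2)).
      rewrite Rabs_pos_eq by (repeat apply Rmult_le_pos; lra).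
      assert (H3 : exp (u / 2) * exp (- (1) * u) = exp (- / 2 * u))
        by (rewrite <- exp_plus; f_equal; field).
      assert (Q3 := exp_pos (- / 2 * u)). rewrite !Rmult_assoc. apply Rmult_le_compat_l; [lra|].
      apply Rle_trans with (exp (u / 2) * (C * exp (- (1) * u))); [apply Rmult_le_compat_l; lra|]. nra.
    - intros u. assert (H1 := HE1 u). assert (H2 := HE u). assert (Q := exp_pos (u / 2)).
      rewrite Rabs_pos_eq by (repeat apply Rmult_le_pos; lra).
      replace (/ 2 * u) with (u / 2) by field. rewrite !Rmult_assoc. apply Rmult_le_compat_l; [lra|].
      nra.
    - exists l; exact Hl. }
  destruct HA as [l HA].
  (* Replacing u by c - u fixes [E] exactly when e^c = (a/b)^2. *)
  pose (c := 2 * ln (a / b)).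
  assert (Hab : 0 < a / b) by now apply Rdiv_lt_0_compat.
  assert (Hc2 : exp (c / 2) = a / b).
  { unfold c. replace (2 * ln (a / b) / 2) with (ln (a / b)) by field. now apply exp_ln. }
  assert (Hc1 : exp c = (a / b) ^ 2) by (rewrite <- (Hsq c), Hc2; ring).
  (* the reflection [u -> c - u] exchanges the two halves of [dw] *)
  assert (HB : integ (fun u => a * exp (- u / 2) * E u) l).
  { apply integ_ext with (fun u => b * exp ((- u + c) / 2) * E (- u + c)).
    - intros u. unfold E.
      replace ((- u + c) / 2) with (- u / 2 + c / 2) by field.
      replace (- (- u + c)) with (u + - c) by ring.
      rewrite !exp_plus, (exp_Ropp c), Hc1, Hc2.
      replace (b * (exp (- u / 2) * (a / b))) with (a * exp (- u / 2)) by (field; lra). do 2 f_equal.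
      field. lra.
    - apply (integ_reflect (fun v => b * exp ((v + c) / 2) * E (v + c))).
      apply (integ_shift (fun v => b * exp (v / 2) * E v)). exact HA. }
  pose (phi := fun u => b * exp (u / 2) - a * exp (- u / 2)).
  assert (HW : integ (fun u => (b * exp (u / 2) + a * exp (- u / 2)) / 2 * exp (- PI * phi u ^ 2)) 1).
  { apply (integ_comp (fun w => exp (- PI * w ^ 2)) phi
      (fun u => (b * exp (u / 2) + a * exp (- u / 2)) / 2)).
    - intros x. apply (ex_derive_continuous (fun w => exp (- PI * w ^ 2))). auto_derive. auto.
    - intros x. unfold phi. auto_derive; [auto|]. unfold Rdiv. toR. field.
    - intros x. apply (ex_derive_continuous (fun u => (b * exp (u / 2) + a * exp (- u / 2)) / 2)).
      auto_derive. auto.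
    - intros K. exists (2 * ((Rabs K + a) / b)). intros x Hx. unfold phi.
      assert (Q := Rabs_pos K). assert (Q1 : K <= Rabs K) by apply Rle_abs.
      assert (Hd : 0 <= (Rabs K + a) / b) by (apply Rdiv_le_0_compat; lra).
      assert (E1 := exp_ineq1_le (x / 2)).
      assert (E2 : exp (- x / 2) <= 1) by (rewrite <- exp_0; apply exp_le_mono; lra).
      assert (E3 : b * ((Rabs K + a) / b) <= b * exp (x / 2)) by (apply Rmult_le_compat_l; lra).
      replace (b * ((Rabs K + a) / b)) with (Rabs K + a) in E3 by (field; lra). nra.
    - intros K. exists (- (2 * ((Rabs K + b) / a))). intros x Hx. unfold phi.
      assert (Q := Rabs_pos K). assert (Q1 : - K <= Rabs K) by (rewrite <- Rabs_Ropp; apply Rle_abs).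
      assert (Hd : 0 <= (Rabs K + b) / a) by (apply Rdiv_le_0_compat; lra).
      assert (E1 := exp_ineq1_le (- x / 2)).
      assert (E2 : exp (x / 2) <= 1) by (rewrite <- exp_0; apply exp_le_mono; lra).
      assert (E3 : a * ((Rabs K + b) / a) <= a * exp (- x / 2)) by (apply Rmult_le_compat_l; lra).
      replace (a * ((Rabs K + b) / a)) with (Rabs K + b) in E3 by (field; lra). nra.
    - apply theta_gauss. }
  assert (HS : integ (fun u => b * exp (u / 2) * E u + a * exp (- u / 2) * E u)
    (2 * exp (- (2 * PI * a * b)) * 1)).
  { eapply integ_ext; [|eapply integ_scal; exact HW]. intros u. cbv beta.
    assert (HE : E u = exp (- (2 * PI * a * b)) * exp (- PI * phi u ^ 2)).
    { unfold E. rewrite <- exp_plus. f_equal. unfold phi.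
      assert (X1 : exp (u / 2) * exp (- u / 2) = 1) by (rewrite <- exp_plus, <- exp_0; f_equal; field).
      assert (X2 := Hsq u). assert (X3 := Hsq (- u)). 
      rewrite <- X2, <- X3.
      replace (- PI * (b * exp (u / 2) - a * exp (- u / 2)) ^ 2) with
        (- (PI * b ^ 2 * (exp (u / 2) * exp (u / 2))) - PI * a ^ 2 * (exp (- u / 2) * exp (- u / 2))
         + 2 * PI * a * b * (exp (u / 2) * exp (- u / 2))) by ring.
      rewrite X1. ring. }
    rewrite HE. field. }
  assert (El := integ_unique _ _ _ (integ_plus _ _ _ _ HA HB) HS).
  replace (exp (- (2 * PI * a * b)) / b) with (/ b * l)
    by (replace l with (exp (- (2 * PI * a * b))) by lra; field; lra).
  eapply integ_ext; [|apply integ_scal; exact HA]. intros u. cbv beta. unfold E.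
  replace (/ b * (b * exp (u / 2) * exp (- (PI * b ^ 2 * exp u) - PI * a ^ 2 * exp (- u))))
    with (exp (u / 2) * exp (- (PI * b ^ 2 * exp u) - PI * a ^ 2 * exp (- u))) by (field; lra).
  rewrite <- exp_plus. f_equal. ring.
Qed.

(** * The logarithmic series and the damped theta integral *)

(** The remainder [Rm N] has derivative t^(N+1) / (1 - t), so the mean value theorem bounds it by a
    geometric sequence. *)
Lemma log_series (z : R) : 0 < z ->
  is_series (fun n => exp (- z * INR (S n)) / INR (S n)) (- ln (1 - exp (- z))).
Proof.
  intros Hz. set (y := exp (- z)).
  assert (Hy0 : 0 < y) by apply exp_pos.
  assert (Hy1 : y < 1) by (unfold y; rewrite <- exp_0; apply exp_increasing; lra).
  pose (Rm := fun N t => - ln (1 - t) - sum_n (fun k => t ^ S k / INR (S k)) N).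
  assert (HD : forall N t, t < 1 -> is_derive (Rm N) t (t ^ S N / (1 - t))).
  { intros N t Ht.
    assert (Hs : is_derive (fun t => sum_n (fun k => t ^ S k / INR (S k)) N) t
      (sum_n (fun k => t ^ k) N)).
    { apply (is_derive_sum_n (fun k t => t ^ S k / INR (S k)) N t (fun k => t ^ k)).
      intros k _. assert (Hk : INR (S k) <> 0) by (apply not_0_INR; lia).
      assert (D := is_derive_pow (fun t => t) (S k) t 1 (is_derive_id t)).
      apply (is_derive_scal (fun t => t ^ S k) t (/ INR (S k))) in D.
      apply (is_derive_ext (fun t => / INR (S k) * t ^ S k)); [intros x; apply Rmult_comm|].
      evar_last; [exact D|]. cbn [Nat.pred]. toR. field. exact Hk. }
    assert (HR : is_derive (fun t => - ln (1 - t)) t (/ (1 - t))).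
    { auto_derive; [lra|]. toR. field. lra. }
    evar_last; [apply (is_derive_minus (fun t => - ln (1 - t)) _ _ _ _ HR Hs)|].
    unfold minus, plus, opp; simpl AbelianMonoid.plus; simpl AbelianGroup.opp.
    assert (G : forall N, sum_n (fun k => t ^ k) N = (1 - t ^ S N) / (1 - t)).
    { clear - Ht. induction N as [|N IH]; [rewrite sum_O; simpl; field; lra|].
      rewrite sum_Sn, IH. unfold plus; simpl. toR. field. lra. }
    rewrite G. unfold plus, opp; simpl. toR. field. lra. }
  assert (R0 : forall N, Rm N 0 = 0).
  { intros N. unfold Rm. rewrite Rminus_0_r, ln_1.
    replace (sum_n (fun k => 0 ^ S k / INR (S k)) N) with 0; [ring|].
    symmetry. induction N as [|N IH]; [rewrite sum_O; simpl; toR; field|].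
    rewrite sum_Sn, IH. rewrite pow_i by lia. unfold plus; simpl. toR. unfold Rdiv. ring. }
  assert (HB : forall N, 0 <= Rm N y <= / (1 - y) * y ^ N).
  { intros N. destruct (MVT_gen (Rm N) 0 y (fun t => t ^ S N / (1 - t))) as [c [Hc E]].
    - intros x Hx. rewrite Rmin_left, Rmax_right in Hx by lra. apply HD; lra.
    - intros x Hx. rewrite Rmin_left, Rmax_right in Hx by lra.
      apply continuity_pt_filterlim. apply (ex_derive_continuous (Rm N)). eexists; apply HD; lra.
    - rewrite Rmin_left, Rmax_right in Hc by lra. rewrite R0, !Rminus_0_r in E. rewrite E.
      assert (Hcp : 0 <= c ^ S N) by (apply pow_le; lra).
      assert (Hcy : c ^ S N <= y ^ S N) by (apply pow_incr; lra).
      assert (Hi : 0 < / (1 - c)) by (apply Rinv_0_lt_compat; lra).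
      assert (Hi2 : / (1 - c) <= / (1 - y)) by (apply Rinv_le_contravar; lra).
      assert (HyN : 0 < y ^ N) by now apply pow_lt.
      assert (Hyy : y ^ S N <= y ^ N) by (simpl; nra).
      split; [apply Rmult_le_pos; [apply Rmult_le_pos|]; lra|].
      unfold Rdiv. apply Rle_trans with (c ^ S N * / (1 - c) * 1).
      + apply Rmult_le_compat_l; [apply Rmult_le_pos|]; lra.
      + rewrite Rmult_1_r, Rmult_comm. apply Rmult_le_compat; lra. }
  apply (is_series_ext (fun n => y ^ S n / INR (S n))).
  { intros n. unfold y. now rewrite <- exp_mult_INR. }
  apply is_series_R.
  apply (is_lim_seq_ext (fun N => - ln (1 - y) - Rm N y)); [intros N; unfold Rm; ring|].
  replace (Finite (- ln (1 - y))) with (Finite (- ln (1 - y) - 0)) by (f_equal; ring).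
  apply is_lim_seq_minus'; [apply is_lim_seq_const|].
  apply (is_lim_seq_le_le (fun _ => 0) _ (fun N => / (1 - y) * y ^ N));
    [exact HB|apply is_lim_seq_const|].
  replace (Finite 0) with (Rbar_mult (/ (1 - y)) 0) by (simpl; f_equal; ring).
  apply is_lim_seq_scal_l. apply is_lim_seq_geom. rewrite Rabs_pos_eq; lra.
Qed.

Lemma theta_excess1_series (u : R) : is_series (fun n => 2 * exp (- (PI * exp u) * INR (S n) ^ 2))
  (theta_excess 1 u).
Proof.
  unfold theta_excess, theta. rewrite pow_1.
  replace (1 + 2 * Series (fun n => exp (- (PI * exp u) * INR (S n) ^ 2)) - 1)
    with (2 * Series (fun n => exp (- (PI * exp u) * INR (S n) ^ 2))) by ring.
  apply (is_series_scal_l 2 (fun n => exp (- (PI * exp u) * INR (S n) ^ 2))).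
  apply Series_correct, ex_series_theta, exp_pos.
Qed.

(** Termwise this is [integ_bessel_half] with a = y / (2 pi) and b = n, and the values 2 e^(-yn) / n
    add up to a logarithm. The damping secures convergence at minus infinity, where e^(u/2) (theta -
    1) tends to 1. It is used with y = 2 pi |m| for [Phi] and with y -> 0 for Euler's constant. *)
Lemma integ_damped_theta_excess1 (y : R) : 0 < y ->
  integ (fun u => exp (u / 2) * theta_excess 1 u * exp (- (y ^ 2 / (4 * PI) * exp (- u))))
    (- 2 * ln (1 - exp (- y))).
Proof.
  intros Hy. assert (P := PI_RGT_0). set (z := y ^ 2 / (4 * PI)).
  assert (Hz : 0 < z) by (apply Rdiv_lt_0_compat; [now apply pow_lt|lra]).
  assert (CF : forall x, continuous (fun u => exp (u / 2) * theta_excess 1 u * exp (- (z * exp (- u))))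
    x).
  { intros x. apply (continuous_mult (fun u => exp (u / 2) * theta_excess 1 u)
      (fun u => exp (- (z * exp (- u))))).
    - apply (continuous_mult (fun u => exp (u / 2)) (theta_excess 1)); [|apply theta_excess_continuous].
      apply (ex_derive_continuous (fun u => exp (u / 2))). auto_derive. auto.
    - apply (ex_derive_continuous (fun u => exp (- (z * exp (- u))))). auto_derive. auto. }
  assert (HF : exists L, integ (fun u => exp (u / 2) * theta_excess 1 u * exp (- (z * exp (- u)))) L).
  { destruct (theta_excess_bound 1 (/ 2)) as [C1 [HC1 H1]]; [simpl; lra|].
    destruct (theta_excess_bound 1 1) as [C2 [HC2 H2]]; [simpl; lra|].
    destruct (exp_exp_decay_scaled z (/ 2) Hz) as [C [HC H]]; [lra|].
    destruct (integ_exp_bound (fun u => exp (u / 2) * theta_excess 1 u * exp (- (z * exp (- u))))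
      (C1 * C + C2) (/ 2)) as [L [HL _]].
    - lra.
    - intros; now apply ex_RInt_cont.
    - intros u. assert (Hq := theta_excess_nonneg 1 u). assert (Q := exp_pos (u / 2)).
      assert (Q' := exp_pos (- (z * exp (- u)))).
      rewrite Rabs_pos_eq by (repeat apply Rmult_le_pos; lra).
      assert (E1 : exp (- (z * exp (- u))) <= 1).
      { rewrite <- exp_0. apply exp_le_mono. assert (R := exp_pos (- u)). nra. }
      assert (E2 : exp (u / 2) * theta_excess 1 u <= C2 * exp (- / 2 * u)).
      { replace (C2 * exp (- / 2 * u)) with (exp (u / 2) * (C2 * exp (- (1) * u))).
        - apply Rmult_le_compat_l; [lra|apply H2].
        - replace (- / 2 * u) with (u / 2 + - (1) * u) by field. rewrite exp_plus. ring. }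
      assert (0 <= exp (u / 2) * theta_excess 1 u) by (apply Rmult_le_pos; lra).
      assert (0 <= C1 * C * exp (- / 2 * u))
        by (repeat apply Rmult_le_pos; try lra; left; apply exp_pos).
      nra.
    - intros u. assert (Hq := theta_excess_nonneg 1 u). assert (Q := exp_pos (u / 2)).
      assert (Q' := exp_pos (- (z * exp (- u)))).
      rewrite Rabs_pos_eq by (repeat apply Rmult_le_pos; lra).
      assert (E1 := H (- u)). replace (- / 2 * - u) with (/ 2 * u) in E1 by ring.
      assert (E2 : exp (u / 2) * theta_excess 1 u <= C1).
      { replace C1 with (exp (u / 2) * (C1 * exp (- / 2 * u))).
        - apply Rmult_le_compat_l; [lra|apply H1].
        - replace (- / 2 * u) with (- (u / 2)) by field. rewrite exp_Ropp. field. lra. }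
      assert (0 <= exp (u / 2) * theta_excess 1 u) by (apply Rmult_le_pos; lra).
      assert (0 <= C2 * exp (/ 2 * u)) by (apply Rmult_le_pos; try lra; left; apply exp_pos).
      apply Rle_trans with (C1 * (C * exp (/ 2 * u))); [apply Rmult_le_compat; lra|lra].
    - exists L; exact HL. }
  destruct HF as [L HF].
  assert (HS : is_series (fun n => 2 * (exp (- y * INR (S n)) / INR (S n))) L).
  { apply (tonelli_series (fun n u => exp (u / 2) * (2 * exp (- (PI * exp u) * INR (S n) ^ 2)) * exp
      (- (z * exp (- u))))
      (fun u => exp (u / 2) * theta_excess 1 u * exp (- (z * exp (- u))))).
    - intros n u. repeat apply Rmult_le_pos; try lra; left; apply exp_pos.
    - intros n x. apply (ex_derive_continuous
        (fun u => exp (u / 2) * (2 * exp (- (PI * exp u) * INR (S n) ^ 2)) * exp (- (z * exp (- u))))).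
      auto_derive. auto.
    - exact CF.
    - intros u. assert (S1 := is_series_scal_l (exp (u / 2) * exp (- (z * exp (- u)))) _ _
        (theta_excess1_series u)).
      replace (exp (u / 2) * theta_excess 1 u * exp (- (z * exp (- u)))) with
        (exp (u / 2) * exp (- (z * exp (- u))) * theta_excess 1 u) by ring.
      eapply is_series_ext; [|exact S1]. intros n. cbv beta. unfold scal; simpl; unfold mult; simpl.
      ring.
    - intros n. assert (Hn : 0 < INR (S n)) by (apply lt_0_INR; lia).
      assert (Hyp : 0 < y / (2 * PI)) by (apply Rdiv_lt_0_compat; lra).
      assert (B := integ_bessel_half (y / (2 * PI)) (INR (S n)) Hyp Hn).
      replace (2 * PI * (y / (2 * PI)) * INR (S n)) with (y * INR (S n)) in B by (field; lra).
      rewrite <- Ropp_mult_distr_l.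
      eapply integ_ext; [|apply integ_scal; exact B]. intros u. cbv beta.
      replace (PI * (y / (2 * PI)) ^ 2) with z by (unfold z; field; lra).
      replace (u / 2 - PI * INR (S n) ^ 2 * exp u - z * exp (- u))
        with (u / 2 + - (PI * exp u) * INR (S n) ^ 2 + - (z * exp (- u))) by ring.
      rewrite !exp_plus. ring.
    - exact HF. }
  assert (HS2 := is_series_scal_l 2 _ _ (log_series y Hy)).
  assert (E : L = 2 * - ln (1 - exp (- y))).
  { rewrite <- (is_series_unique _ _ HS). apply is_series_unique. exact HS2. }
  replace (- 2 * ln (1 - exp (- y))) with L by lra. exact HF.
Qed.

(** * Euler's constant *)

Lemma ln_ratio_bounds (m : R) : 0 < m -> / (m + 1) <= ln (m + 1) - ln m <= / m.
Proof.
  intros Hm. destruct (MVT_gen ln m (m + 1) Rinv) as [c [Hc E]].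
  - intros x Hx. rewrite Rmin_left, Rmax_right in Hx by lra. auto_derive; [lra|]. field. lra.
  - intros x Hx. rewrite Rmin_left, Rmax_right in Hx by lra.
    apply continuity_pt_filterlim. apply (ex_derive_continuous ln). auto_derive. lra.
  - rewrite Rmin_left, Rmax_right in Hc by lra. rewrite E.
    replace (/ c * (m + 1 - m)) with (/ c) by ring. split; apply Rinv_le_contravar; lra.
Qed.

Definition euler_term (n : nat) : R := / INR (S n) - (ln (INR (S (S n))) - ln (INR (S n))).

Lemma ex_series_telescope : ex_series (fun n => 2 / (INR (S n) * INR (S (S n)))).
Proof.
  apply (ex_series_scal_l 2 (fun n => / (INR (S n) * INR (S (S n))))).
  exists 1. apply is_series_R.
  apply (is_lim_seq_ext (fun n => 1 - 1 / INR (S (S n)))).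
  - intros n. induction n as [|n IH]; [rewrite sum_O; simpl; toR; field|].
    rewrite sum_Sn, <- IH. unfold plus; simpl AbelianMonoid.plus. unfold plus. cbn [AbelianMonoid.plus].
    assert (0 < INR (S (S n))) by (apply lt_0_INR; lia). assert (H3 := S_INR (S (S n))).
    change (1 - 1 / INR (S (S (S n))) = 1 - 1 / INR (S (S n)) + / (INR (S (S n)) * INR (S (S (S n))))).
    rewrite H3. field. lra.
  - replace (Finite 1) with (Finite (1 - 0)) by (f_equal; ring).
    apply is_lim_seq_minus'; [apply is_lim_seq_const|].
    apply (is_lim_seq_incr_1 (fun n => 1 / INR (S n))). apply is_lim_seq_div_S.
Qed.

Lemma euler_term_bounds (n : nat) : 0 <= euler_term n <= 2 / (INR (S n) * INR (S (S n))).
Proof.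
  assert (Hn : 0 < INR (S n)) by (apply lt_0_INR; lia).
  assert (H := ln_ratio_bounds (INR (S n)) Hn). unfold euler_term. rewrite (S_INR (S n)).
  split; [lra|]. assert (E : 2 / (INR (S n) * (INR (S n) + 1)) = 2 * (/ INR (S n) - / (INR (S n) + 1)))
    by (field; lra).
  assert (/ (INR (S n) + 1) <= / INR (S n)) by (apply Rinv_le_contravar; lra). lra.
Qed.

Lemma ex_series_euler_term : ex_series euler_term.
Proof.
  apply (ex_series_le (K := R_AbsRing) (V := R_CompleteNormedModule) _
    (fun n => 2 / (INR (S n) * INR (S (S n))))).
  - intros n. change (Rabs (euler_term n) <= 2 / (INR (S n) * INR (S (S n)))).
    assert (H := euler_term_bounds n). rewrite Rabs_pos_eq; lra.
  - apply ex_series_telescope.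
Qed.

(** Up to index [n] the terms sum to the harmonic number H_(n+1) minus ln(n+2), whereas
    [euler_gamma] is defined with ln(n+1); the two logarithms differ by a null sequence. *)
Lemma euler_gamma_series : euler_gamma = Series euler_term.
Proof.
  assert (H := Series_correct _ ex_series_euler_term). apply is_series_R in H.
  assert (Hd : is_lim_seq (fun n => ln (INR (S (S n))) - ln (INR (S n))) 0).
  { apply (is_lim_seq_le_le (fun _ => 0) _ (fun n => 1 / INR (S n)));
      [|apply is_lim_seq_const|apply is_lim_seq_div_S].
    intros n. assert (Hn : 0 < INR (S n)) by (apply lt_0_INR; lia).
    assert (B := ln_ratio_bounds (INR (S n)) Hn). rewrite <- S_INR in B.
    assert (0 < / INR (S (S n))) by (apply Rinv_0_lt_compat, lt_0_INR; lia). unfold Rdiv. lra. }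
  assert (E := is_lim_seq_plus' _ _ _ _ H Hd). rewrite Rplus_0_r in E.
  unfold euler_gamma.
  transitivity (real (Lim_seq (fun n => sum_n euler_term n + (ln (INR (S (S n))) - ln (INR (S n)))))).
  2:{ exact (f_equal real (is_lim_seq_unique _ _ E)). }
  f_equal. apply Lim_seq_ext.
  intros n. induction n as [|n IH].
  - rewrite !sum_O. unfold euler_term. toR. simpl (INR 1). rewrite ln_1. ring.
  - rewrite !sum_Sn.
      assert (IH' : sum_n (fun i => / INR (S i)) n = sum_n euler_term n + ln (INR (S (S n)))) by lra.
      rewrite IH'. unfold euler_term at 3.
      change (sum_n euler_term n + ln (INR (S (S n))) + / INR (S (S n)) - ln (INR (S (S n)))
        = sum_n euler_term n + (/ INR (S (S n)) - (ln (INR (S (S (S n)))) - ln (INR (S (S n)))))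
          + (ln (INR (S (S (S n)))) - ln (INR (S (S n))))). ring.
Qed.

(** With t = e^(-u) this is the integral of e^(-zt) dt/t from n+1 to n+2, a slice of the exponential
    integral E_1(z). *)
Definition expint_term (z : R) (n : nat) : R :=
  RInt (fun u => exp (- (z * exp (- u)))) (- ln (INR (S (S n)))) (- ln (INR (S n))).

Lemma damp_continuous (z x : R) : continuous (fun u => exp (- (z * exp (- u)))) x.
Proof. apply (ex_derive_continuous (fun u => exp (- (z * exp (- u))))). auto_derive. auto. Qed.

Lemma damp_le_1 (z u : R) : 0 < z -> exp (- (z * exp (- u))) <= 1.
Proof. intros Hz. rewrite <- exp_0. apply exp_le_mono. assert (R := exp_pos (- u)). nra. Qed.

Lemma ex_RInt_step_damp (z a b : R) : ex_RInt (fun u => step u * exp (- (z * exp (- u)))) a b.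
Proof.
  assert (H : forall b, ex_RInt (fun u => step u * exp (- (z * exp (- u)))) 0 b).
  { clear. intros b. destruct (Rle_or_lt 0 b) as [Hb|Hb].
    - apply ex_RInt_ext with (fun _ => 0); [|apply ex_RInt_const].
      intros x Hx. rewrite Rmin_left in Hx by exact Hb. unfold step. destruct Rlt_dec; toR; [lra|ring].
    - apply ex_RInt_ext with (fun u => exp (- (z * exp (- u)))); [|apply ex_RInt_cont, damp_continuous].
      intros x Hx. rewrite Rmax_left in Hx by lra. unfold step. destruct Rlt_dec; toR; [ring|lra]. }
  apply ex_RInt_Chasles with 0; [apply ex_RInt_swap|]; apply H.
Qed.

(** The value is E_1(z); its slices between consecutive integers are to be matched with the terms of
    the logarithmic series. *)
Lemma integ_expint (z : R) : 0 < z ->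
  exists e, integ (fun u => step u * exp (- (z * exp (- u)))) e /\ is_series (expint_term z) e.
Proof.
  intros Hz.
  destruct (exp_exp_decay_scaled z 1 Hz) as [C [HC H]]; [lra|].
  destruct (integ_exp_bound (fun u => step u * exp (- (z * exp (- u)))) (C + 1) 1) as [e [He _]].
  - lra.
  - apply ex_RInt_step_damp.
  - intros u. assert (Q := exp_pos (- (1) * u)). unfold step. destruct (Rlt_dec u 0) as [Hu|Hu].
    + rewrite Rmult_1_l, Rabs_pos_eq by (left; apply exp_pos).
      assert (D := damp_le_1 z u Hz). assert (G : exp 0 <= exp (- (1) * u)) by (apply exp_le_mono; lra).
      rewrite exp_0 in G. nra.
    + rewrite Rmult_0_l, Rabs_R0. nra.
  - intros u. assert (Q := exp_pos (1 * u)). unfold step. destruct (Rlt_dec u 0) as [Hu|Hu].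
    + rewrite Rmult_1_l, Rabs_pos_eq by (left; apply exp_pos).
      assert (D := H (- u)). replace (- (1) * - u) with (1 * u) in D by ring. nra.
    + rewrite Rmult_0_l, Rabs_R0. nra.
  - exists e. split; [exact He|]. apply is_series_R.
    assert (Hln : is_lim_seq (fun n => ln (INR (S (S n)))) p_infty).
    { apply (is_lim_comp_seq ln (fun n => INR (S (S n))) p_infty p_infty); [apply is_lim_ln_p| |].
      - exists 0%nat. intros n _. discriminate.
      - apply (is_lim_seq_incr_1 (fun n => INR (S n))). apply (is_lim_seq_incr_1 INR).
        apply is_lim_seq_INR. }
    apply (is_lim_seq_ext (fun n => RInt (fun u => step u * exp (- (z * exp (- u))))
      (- ln (INR (S (S n)))) (ln (INR (S (S n)))))).
    + intros n. assert (Hl : 0 < ln (INR (S (S n)))).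
      { rewrite <- ln_1. apply ln_increasing; [lra|]. rewrite !S_INR. assert (Q := pos_INR n). lra. }
      rewrite <- (RInt_Chasles_R _ _ 0) by apply ex_RInt_step_damp.
      rewrite (RInt_ext _ (fun _ => 0) 0).
      2:{ intros x Hx. rewrite Rmin_left in Hx by lra. unfold step. destruct Rlt_dec; toR; [lra|ring]. }
      rewrite (RInt_ext _ (fun u => exp (- (z * exp (- u)))) _ 0).
      2:{ intros x Hx. rewrite Rmax_right in Hx by lra. unfold step. destruct Rlt_dec; toR; [ring|lra]. }
      rewrite RInt_const_R, Rmult_0_r, Rplus_0_r. clear Hl.
      induction n as [|n IH].
      * rewrite sum_O. unfold expint_term. simpl (INR 1). now rewrite ln_1, Ropp_0.
      * rewrite sum_Sn, <- IH. unfold expint_term.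
        rewrite <- (RInt_Chasles_R _ _ (- ln (INR (S (S n)))) 0)
          by (apply ex_RInt_cont, damp_continuous).
        apply Rplus_comm.
    + apply is_lim_seq_RInt_integ; [exact He| |exact Hln].
      apply (is_lim_seq_opp _ p_infty). exact Hln.
Qed.

Lemma expint_term_bounds (z : R) (n : nat) : 0 < z ->
  exp (- z * INR (S (S n))) * (ln (INR (S (S n))) - ln (INR (S n))) <= expint_term z n
  <= exp (- z * INR (S n)) * (ln (INR (S (S n))) - ln (INR (S n))).
Proof.
  intros Hz. assert (Hn : 0 < INR (S n)) by (apply lt_0_INR; lia).
  assert (Hn2 : 0 < INR (S (S n))) by (apply lt_0_INR; lia).
  assert (Hl := ln_ratio_bounds (INR (S n)) Hn). rewrite <- S_INR in Hl.
  assert (0 < / INR (S (S n))) by now apply Rinv_0_lt_compat.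
  assert (K : forall c, c * (ln (INR (S (S n))) - ln (INR (S n))) = RInt (fun _ => c)
    (- ln (INR (S (S n)))) (- ln (INR (S n)))).
  { intros c. rewrite RInt_const_R. toR. ring. }
  unfold expint_term. rewrite !K. split; apply RInt_le; try lra; try apply ex_RInt_const;
    try (apply ex_RInt_cont, damp_continuous); intros u Hu; apply exp_le_mono.
  - assert (exp (- u) <= INR (S (S n))); [|nra].
    rewrite <- (exp_ln _ Hn2). apply exp_le_mono. lra.
  - assert (INR (S n) <= exp (- u)); [|nra].
    rewrite <- (exp_ln _ Hn) at 1. apply exp_le_mono. lra.
Qed.

(** Subtracting the slices of E_1(z) from the terms e^(-zm)/m gives a series dominated uniformly in
    z, although both series diverge at z = 0. Its terms tend to 1/m - ln((m+1)/m), whose sum is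
    Euler's constant. *)
Lemma expint_asymptotic (z : nat -> R) (e : nat -> R) :
  (forall k, 0 < z k) -> is_lim_seq z 0 ->
  (forall k, is_series (expint_term (z k)) (e k)) ->
  is_lim_seq (fun k => - ln (1 - exp (- z k)) - e k) euler_gamma.
Proof.
  intros Hz Hlim He.
  pose (t := fun (n k : nat) => exp (- z k * INR (S n)) / INR (S n) - expint_term (z k) n).
  apply (is_lim_seq_ext (fun k => Series (fun n => t n k))).
  { intros k. apply is_series_unique.
    apply (is_series_minus (fun n => exp (- z k * INR (S n)) / INR (S n)) (expint_term (z k)));
      [now apply log_series|apply He]. }
  rewrite euler_gamma_series.
  apply (tannery eventually t euler_term (fun n => 2 / (INR (S n) * INR (S (S n))))).
  - intros n. change (is_lim_seq (t n) (euler_term n)).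
    assert (Ha : forall a, is_lim_seq (fun k => exp (- z k * a)) 1).
    { intros a. replace 1 with (exp (- 0 * a)) by (rewrite Ropp_0, Rmult_0_l; apply exp_0).
      apply (is_lim_seq_continuous (fun x => exp (- x * a)) z 0); [|exact Hlim].
      apply continuity_pt_filterlim. apply (ex_derive_continuous (fun x => exp (- x * a))). auto_derive.
      auto. }
    apply is_lim_seq_minus'.
    + replace (/ INR (S n)) with (1 * / INR (S n)) by ring.
      apply (is_lim_seq_mult' _ (fun _ => / INR (S n))); [apply Ha|apply is_lim_seq_const].
    + set (l := ln (INR (S (S n))) - ln (INR (S n))).
      assert (Hb : forall a, is_lim_seq (fun k => exp (- z k * a) * l) l).
      { intros a. assert (G := is_lim_seq_mult' _ (fun _ => l) 1 l (Ha a) (is_lim_seq_const l)).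
        rewrite Rmult_1_l in G. exact G. }
      apply (is_lim_seq_le_le (fun k => exp (- z k * INR (S (S n))) * l) _
        (fun k => exp (- z k * INR (S n)) * l)); auto.
      intros k. now apply expint_term_bounds.
  - exists 0%nat. intros k _ n. assert (B := expint_term_bounds (z k) n (Hz k)). unfold t.
    assert (Hn : 0 < INR (S n)) by (apply lt_0_INR; lia).
    assert (Hl := ln_ratio_bounds (INR (S n)) Hn). specialize (Hz k).
    rewrite (S_INR (S n)) in *. set (m := INR (S n)) in *. set (l := ln (m + 1) - ln m) in *.
    set (zz := z k) in *. set (x := exp (- zz * m)) in *.
    assert (Hx : 0 < x) by apply exp_pos.
    (* With the inequality 1 - z <= e^(-z) below, the difference is at most x (1 + zm) / (m (m+1));
       this inequality makes the bound independent of z. *)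
    assert (Hx1 : x * (1 + zz * m) <= 1).
    { unfold x. replace (- zz * m) with (- (zz * m)) by ring. rewrite exp_Ropp.
      assert (E := exp_ineq1_le (zz * m)). assert (E2 := exp_pos (zz * m)).
      apply Rmult_le_reg_l with (exp (zz * m)); [exact E2|]. rewrite <- Rmult_assoc, Rinv_r by lra. lra.
      }
    assert (Hx2 : x * (1 - zz) <= exp (- zz * (m + 1))).
    { replace (- zz * (m + 1)) with (- zz * m + - zz) by ring. rewrite exp_plus. fold x.
      apply Rmult_le_compat_l; [lra|]. assert (E := exp_ineq1_le (- zz)). lra. }
    assert (Hx3 := exp_pos (- zz * (m + 1))).
    assert (Hi : 0 < / (m + 1)) by (apply Rinv_0_lt_compat; lra).
    rewrite Rabs_pos_eq.
    + assert (L1 : exp (- zz * (m + 1)) * / (m + 1) <= expint_term zz n).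
      { eapply Rle_trans; [|apply B]. apply Rmult_le_compat_l; lra. }
      assert (L2 : x * (1 - zz) * / (m + 1) <= exp (- zz * (m + 1)) * / (m + 1))
        by (apply Rmult_le_compat_r; lra).
      apply Rle_trans with (x / m - x * (1 - zz) * / (m + 1)); [lra|].
      replace (x / m - x * (1 - zz) * / (m + 1)) with (x * (1 + zz * m) / (m * (m + 1))) by (field; lra).
      apply Rmult_le_compat_r; [|lra]. left. apply Rinv_0_lt_compat. apply Rmult_lt_0_compat; lra.
    + assert (x * l <= x * / m) by (apply Rmult_le_compat_l; lra). unfold Rdiv. lra.
  - apply ex_series_telescope.
Qed.

(** * The regularized integral of theta *)

Lemma ln_one_minus_exp (y : R) : 0 < y -> - y <= ln (1 - exp (- y)) - ln y <= 0.
Proof.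
  intros Hy. assert (E1 := exp_ineq1_le (- y)). assert (E2 := exp_ineq1_le y).
  assert (E3 : exp (- y) <= / (1 + y)) by (rewrite exp_Ropp; apply Rinv_le_contravar; lra).
  assert (E4 : y / (1 + y) <= 1 - exp (- y)).
  { replace (y / (1 + y)) with (1 - / (1 + y)) by (field; lra). lra. }
  assert (H0 : 0 < y / (1 + y)) by (apply Rdiv_lt_0_compat; lra).
  assert (L1 : ln (1 - exp (- y)) <= ln y) by (apply ln_le; lra).
  assert (L2 : ln (y / (1 + y)) <= ln (1 - exp (- y))) by (apply ln_le; lra).
  rewrite ln_div in L2 by lra.
  assert (L3 : ln (1 + y) <= y) by (rewrite <- (ln_exp y) at 2; apply ln_le; lra).
  lra.
Qed.

(** Applied with w = ln z - u. The exponent 1/4 stays below the decay rate 1/2 of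
    [theta_excess1_reg], so the product is still integrable and carries a factor z^(1/4), which
    vanishes with the damping. *)
Lemma one_minus_exp_quarter (w : R) : 0 <= 1 - exp (- exp w) <= exp (w / 4).
Proof.
  assert (P := exp_pos w). assert (P2 := exp_pos (- exp w)).
  assert (G : exp (- exp w) <= exp 0) by (apply exp_le_mono; lra). rewrite exp_0 in G.
  split; [lra|]. destruct (Rle_or_lt 0 w) as [Hw|Hw].
  - assert (G2 : exp 0 <= exp (w / 4)) by (apply exp_le_mono; lra). rewrite exp_0 in G2. lra.
  - assert (E := exp_ineq1_le (- exp w)).
    assert (exp w <= exp (w / 4)) by (apply exp_le_mono; lra). lra.
Qed.

(** The integrand of [integ_kronecker] for k = 1; it reappears unchanged as a summand for every
    k. *)
Definition theta_excess1_reg (u : R) : R := exp (u / 2) * theta_excess 1 u - step u.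

Lemma ex_RInt_theta_excess1_reg (a b : R) : ex_RInt theta_excess1_reg a b.
Proof.
  apply (ex_RInt_minus (fun u => exp (u / 2) * theta_excess 1 u) step); [|apply ex_RInt_step].
  apply ex_RInt_cont. intros x. apply (continuous_mult (fun u => exp (u / 2)) (theta_excess 1));
    [|apply theta_excess_continuous].
  apply (ex_derive_continuous (fun u => exp (u / 2))). auto_derive. auto.
Qed.

Lemma theta_excess1_reg_bound : exists C, 0 < C /\ forall u, Rabs (theta_excess1_reg u) <= C * exp
  (- Rabs u / 2).
Proof.
  destruct (theta_excess_bound 1 1) as [C [HC H]]; [simpl; lra|].
  exists (C + 1). split; [lra|]. intros u. unfold theta_excess1_reg, step.
  destruct (Rlt_dec u 0) as [Hu|Hu].
  - rewrite (Rabs_left u) by exact Hu.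
    (* For u < 0 reflection exhibits two terms, both decaying at minus infinity. *)
    assert (E : exp (u / 2) * theta_excess 1 u - 1 = theta_excess 1 (- u) - exp (u / 2)).
    { unfold theta_excess. rewrite !pow_1, theta_reflect. ring. }
    rewrite E. assert (Hq := theta_excess_nonneg 1 (- u)). assert (H1 := H (- u)).
    replace (- (1) * - u) with u in H1 by ring. replace (- - u / 2) with (u / 2) by field.
    assert (G : exp u <= exp (u / 2)) by (apply exp_le_mono; lra).
    assert (P := exp_pos (u / 2)). apply Rabs_le. nra.
  - rewrite (Rabs_pos_eq u) by lra. rewrite Rminus_0_r.
    assert (Hq := theta_excess_nonneg 1 u). assert (H1 := H u). assert (P := exp_pos (u / 2)).
    rewrite Rabs_pos_eq by (apply Rmult_le_pos; lra).
    assert (E : exp (u / 2) * (C * exp (- (1) * u)) = C * exp (- u / 2)).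
    { replace (- u / 2) with (u / 2 + - (1) * u) by field. rewrite exp_plus. ring. }
    assert (exp (u / 2) * theta_excess 1 u <= exp (u / 2) * (C * exp (- (1) * u)))
      by (apply Rmult_le_compat_l; lra).
    assert (P2 := exp_pos (- u / 2)). lra.
Qed.

(* Damping by [exp (- z / x)] splits off [E_1 (z)] from a sum of Bessel
   integrals of order 1/2; the logarithmic singularities at [z = 0] cancel. *)
Lemma integ_theta_excess1_reg : integ theta_excess1_reg (euler_gamma - ln (4 * PI)).
Proof.
  assert (P := PI_RGT_0).
  destruct theta_excess1_reg_bound as [C [HC Hb]].
  assert (Habs : forall u, - Rabs u / 2 <= / 2 * u /\ - Rabs u / 2 <= - / 2 * u).
  { intros u. unfold Rabs. destruct Rcase_abs; lra. }
  destruct (integ_exp_bound theta_excess1_reg C (/ 2)) as [V [HV _]].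
  { lra. }
  { apply ex_RInt_theta_excess1_reg. }
  { intros u. eapply Rle_trans; [apply Hb|]. apply Rmult_le_compat_l; [lra|]. apply exp_le_mono, Habs. }
  { intros u. eapply Rle_trans; [apply Hb|]. apply Rmult_le_compat_l; [lra|]. apply exp_le_mono, Habs. }
  pose (y := fun n => exp (- INR n)). pose (z := fun n => y n ^ 2 / (4 * PI)).
  assert (Hy : forall n, 0 < y n) by (intros; apply exp_pos).
  assert (Hz : forall n, 0 < z n) by (intros; apply Rdiv_lt_0_compat; [now apply pow_lt|lra]).
  assert (Hylim : is_lim_seq y 0).
  { unfold y. apply (is_lim_comp_seq exp (fun n => - INR n) m_infty 0); [apply is_lim_exp_m| |].
    - exists 0%nat. intros n _. discriminate.
    - apply (is_lim_seq_opp INR p_infty). apply is_lim_seq_INR. }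
  assert (Hzlim : is_lim_seq z 0).
  { unfold z. replace 0 with (0 * (0 * 1) / (4 * PI)) by (unfold Rdiv; ring).
    apply (is_lim_seq_mult' _ (fun _ => / (4 * PI))); [|apply is_lim_seq_const].
    apply (is_lim_seq_mult' y (fun n => y n * 1)); [exact Hylim|].
    apply (is_lim_seq_mult' y (fun _ => 1)); [exact Hylim|apply is_lim_seq_const]. }
  pose (e := fun n => proj1_sig (constructive_indefinite_description _ (integ_expint (z n) (Hz n)))).
  assert (He : forall n, integ (fun u => step u * exp (- (z n * exp (- u)))) (e n) /\ is_series
    (expint_term (z n)) (e n)).
  { intros n. unfold e. destruct constructive_indefinite_description as [x Hx]. exact Hx. }
  assert (HD : forall n, integ (fun u => theta_excess1_reg u * exp (- (z n * exp (- u))))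
    (- 2 * ln (1 - exp (- y n)) - e n)).
  { intros n. eapply integ_ext; [|apply integ_minus;
      [apply (integ_damped_theta_excess1 (y n) (Hy n))|apply He]].
    intros u. cbv beta. unfold theta_excess1_reg, z. ring. }
  pose (K := fun n => C * exp (ln (z n) / 4)).
  (* The rate 1/4 on both sides turns the bound 2 C / d into 8 K. *)
  assert (Hdiff : forall n, Rabs (V - (- 2 * ln (1 - exp (- y n)) - e n)) <= 8 * K n).
  { intros n. assert (HI := integ_minus _ _ _ _ HV (HD n)).
    destruct (integ_exp_bound (fun u => theta_excess1_reg u - theta_excess1_reg u * exp
      (- (z n * exp (- u)))) (K n) (/ 4)) as [l [Hl Hle]].
    - lra.
    - apply HI.
    - intros u. assert (E := one_minus_exp_quarter (ln (z n) + - u)).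
      rewrite exp_plus, exp_ln in E by apply Hz.
      replace (theta_excess1_reg u - theta_excess1_reg u * exp (- (z n * exp (- u)))) with
        (theta_excess1_reg u * (1 - exp (- (z n * exp (- u))))) by ring.
      rewrite Rabs_mult, (Rabs_pos_eq (1 - _)) by lra.
      apply Rle_trans with (C * exp (- Rabs u / 2) * exp ((ln (z n) + - u) / 4)).
      + apply Rmult_le_compat; [apply Rabs_pos|lra|apply Hb|lra].
      + unfold K. rewrite !Rmult_assoc, <- !exp_plus. apply Rmult_le_compat_l; [lra|]. apply exp_le_mono.
        unfold Rabs. destruct Rcase_abs; lra.
    - intros u. assert (E := one_minus_exp_quarter (ln (z n) + - u)).
      rewrite exp_plus, exp_ln in E by apply Hz.
      replace (theta_excess1_reg u - theta_excess1_reg u * exp (- (z n * exp (- u)))) with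
        (theta_excess1_reg u * (1 - exp (- (z n * exp (- u))))) by ring.
      rewrite Rabs_mult, (Rabs_pos_eq (1 - _)) by lra.
      apply Rle_trans with (C * exp (- Rabs u / 2) * exp ((ln (z n) + - u) / 4)).
      + apply Rmult_le_compat; [apply Rabs_pos|lra|apply Hb|lra].
      + unfold K. rewrite !Rmult_assoc, <- !exp_plus. apply Rmult_le_compat_l; [lra|]. apply exp_le_mono.
        unfold Rabs. destruct Rcase_abs; lra.
    - rewrite (integ_unique _ _ _ HI Hl). lra. }
  assert (HKlim : is_lim_seq (fun n => 8 * K n) 0).
  { replace (Finite 0) with (Rbar_mult 8 (Finite (C * 0))) by (simpl; f_equal; ring).
    apply is_lim_seq_scal_l. apply (is_lim_seq_mult' (fun _ => C)); [apply is_lim_seq_const|].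
    apply (is_lim_comp_seq exp (fun n => ln (z n) / 4) m_infty 0); [apply is_lim_exp_m| |].
    - exists 0%nat. intros n _. discriminate.
    - apply (is_lim_seq_ext (fun n => (- / 2) * INR n + - ln (4 * PI) / 4)).
      + intros n. unfold z, y. rewrite ln_div, ln_pow, ln_exp
          by (try apply pow_lt; try apply exp_pos; lra). simpl. field.
      + apply (is_lim_seq_plus _ _ m_infty (- ln (4 * PI) / 4)).
        * evar_last; [apply is_lim_seq_scal_l; apply is_lim_seq_INR|].
          unfold Rbar_mult, Rbar_mult'. destruct (Rle_dec 0 (- / 2)) as [H|H];
            [exfalso; lra|reflexivity].
        * apply is_lim_seq_const.
        * reflexivity. }
  assert (HVlim : is_lim_seq (fun n => - 2 * ln (1 - exp (- y n)) - e n) V).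
  { apply (is_lim_seq_le_le (fun n => V - 8 * K n) _ (fun n => V + 8 * K n)).
    - intros n. assert (B := Hdiff n). apply Rabs_le_between in B. lra.
    - replace (Finite V) with (Finite (V - 0)) by (f_equal; ring).
      apply is_lim_seq_minus'; [apply is_lim_seq_const|exact HKlim].
    - replace (Finite V) with (Finite (V + 0)) by (f_equal; ring).
      apply is_lim_seq_plus'; [apply is_lim_seq_const|exact HKlim]. }
  assert (Hr : forall w : nat -> R, (forall n, 0 < w n) -> is_lim_seq w 0 -> is_lim_seq
    (fun n => ln (1 - exp (- w n)) - ln (w n)) 0).
  { intros w Hw Hwlim. apply (is_lim_seq_le_le (fun n => - w n) _ (fun _ => 0)).
    - intros n. now apply ln_one_minus_exp.
    - replace (Finite 0) with (Rbar_opp 0) by (simpl; f_equal; ring). now apply (is_lim_seq_opp w 0).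
    - apply is_lim_seq_const. }
  (* For small y the expression is - 2 ln y + ln z + gamma up to a vanishing error; z = y^2 / (4 pi)
     leaves - ln(4 pi). *)
  assert (HGlim : is_lim_seq (fun n => - 2 * ln (1 - exp (- y n)) - e n) (euler_gamma - ln (4 * PI))).
  { assert (L1 := expint_asymptotic z e Hz Hzlim (fun n => proj2 (He n))).
    assert (L2 := Hr z Hz Hzlim). assert (L3 := Hr y Hy Hylim).
    assert (L4 := is_lim_seq_scal_l _ 2 _ L3).
    assert (L5 := is_lim_seq_minus' _ _ _ _ (is_lim_seq_plus' _ _ _ _ L1 L2) L4).
    assert (L6 := is_lim_seq_minus' _ _ _ _ L5 (is_lim_seq_const (ln (4 * PI)))).
    replace (euler_gamma + 0 - 2 * 0 - ln (4 * PI)) with (euler_gamma - ln (4 * PI)) in L6 by ring.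
    eapply is_lim_seq_ext; [|exact L6]. intros n. cbv beta.
    assert (E : ln (z n) = 2 * ln (y n) - ln (4 * PI)).
    { unfold z. rewrite ln_div, ln_pow by (try apply pow_lt; try apply Hy; lra). simpl. ring. }
    rewrite E. ring. }
  assert (E := is_lim_seq_unique _ _ HGlim). rewrite (is_lim_seq_unique _ _ HVlim) in E.
  apply (f_equal real) in E. cbn [real] in E. rewrite <- E. exact HV.
Qed.

(** * The Epstein zeta value *)

(** The substitution t = e^u carries the windows [1/(N+1), N+1] of the definition to symmetric
    ones. *)
Lemma integ_Gamma (s : R) : 0 < s -> integ (fun u => exp (s * u - exp u)) (Gamma s).
Proof.
  intros Hs.
  assert (C0 : forall x, continuous (fun u => exp (s * u - exp u)) x).
  { intros x. apply (ex_derive_continuous (fun u => exp (s * u - exp u))). auto_derive. auto. }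
  destruct (exp_exp_decay (2 * s)) as [C [HC H]]; [lra|].
  destruct (integ_exp_bound (fun u => exp (s * u - exp u)) (C + 1) s) as [l [Hl _]].
  - exact Hs.
  - intros; now apply ex_RInt_cont.
  - intros u. rewrite Rabs_pos_eq by (left; apply exp_pos). unfold Rminus. rewrite exp_plus.
    assert (P := exp_pos (s * u)). assert (P2 := exp_pos (- s * u)). assert (H1 := H u).
    assert (E : exp (s * u) * (C * exp (- (2 * s) * u)) = C * exp (- s * u)).
    { replace (- s * u) with (s * u + - (2 * s) * u) by ring. rewrite exp_plus. ring. }
    assert (exp (s * u) * exp (- exp u) <= exp (s * u) * (C * exp (- (2 * s) * u)))
      by (apply Rmult_le_compat_l; lra).
    lra.
  - intros u. rewrite Rabs_pos_eq by (left; apply exp_pos).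
    apply Rle_trans with (exp (s * u)); [apply exp_le_mono; assert (Q := exp_pos u); lra|].
    assert (Q := exp_pos (s * u)). nra.
  - replace (Gamma s) with l; [exact Hl|].
    assert (Hln : is_lim_seq (fun n => ln (INR (S n))) p_infty).
    { apply (is_lim_comp_seq ln (fun n => INR (S n)) p_infty p_infty); [apply is_lim_ln_p| |].
      - exists 0%nat. intros n _. discriminate.
      - apply (is_lim_seq_incr_1 INR). apply is_lim_seq_INR. }
    assert (L := is_lim_seq_RInt_integ _ _ (fun n => - ln (INR (S n))) _ Hl
      (proj1 (is_lim_seq_opp _ p_infty) Hln) Hln).
    unfold Gamma. symmetry.
    transitivity (real (Lim_seq (fun n => RInt (fun u => exp (s * u - exp u)) (- ln (INR (S n)))
      (ln (INR (S n)))))).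
    2:{ exact (f_equal real (is_lim_seq_unique _ _ L)). }
    f_equal. apply Lim_seq_ext. intros n.
    assert (Hn : 0 < INR (S n)) by (apply lt_0_INR; lia).
    rewrite <- (exp_ln _ Hn) at 1 2. rewrite <- exp_Ropp.
    symmetry. rewrite <- (RInt_comp (fun t => Rpower t (s - 1) * exp (- t)) exp exp).
    + apply RInt_ext. intros u _. change
        (exp (s * u - exp u) = exp u * (Rpower (exp u) (s - 1) * exp (- exp u))).
      unfold Rpower. rewrite ln_exp, <- !exp_plus. f_equal. ring.
    + intros x _. apply (ex_derive_continuous (fun t => Rpower t (s - 1) * exp (- t))). unfold Rpower.
      auto_derive. apply exp_pos.
    + intros x _. split; [apply is_derive_exp|]. apply (ex_derive_continuous exp). eexists.
      apply is_derive_exp.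
Qed.

Lemma integ_Gamma_scaled (s c : R) : 0 < s -> 0 < c ->
  integ (fun u => exp (s * u - c * exp u)) (Rpower c (- s) * Gamma s).
Proof.
  intros Hs Hc. eapply integ_ext; [|apply integ_scal; apply (integ_shift _ _ (ln c) (integ_Gamma s Hs))].
  intros u. cbv beta. unfold Rpower. rewrite <- exp_plus. f_equal. rewrite exp_plus, exp_ln by exact Hc.
  ring.
Qed.

(** The Mellin transform of theta^j - 1, taken term by term. It needs no regularization above j/2,
    and [eta (k - 1)] is evaluated at k/2, safely above (k-1)/2. *)
Lemma integ_eta (j : nat) (s : R) : INR j / 2 < s ->
  integ (fun u => exp (s * u) * theta_excess j u) (eta j s).
Proof.
  intros Hs. assert (Hj := pos_INR j). assert (P := PI_RGT_0).
  (* The distance to the abscissa is the decay rate at minus infinity; the exponent s + d below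
     yields the same rate at plus infinity. *)
  pose (d := s - INR j / 2). assert (Hd : 0 < d) by (unfold d; lra).
  assert (CF : forall x, continuous (fun u => exp (s * u) * theta_excess j u) x).
  { intros x. apply (continuous_mult (fun u => exp (s * u)) (theta_excess j));
      [|apply theta_excess_continuous].
    apply (ex_derive_continuous (fun u => exp (s * u))). auto_derive. auto. }
  destruct (theta_excess_bound j (INR j / 2)) as [C1 [HC1 H1]]; [lra|].
  destruct (theta_excess_bound j (s + d)) as [C2 [HC2 H2]]; [lra|].
  destruct (integ_exp_bound (fun u => exp (s * u) * theta_excess j u) (C1 + C2) d) as [L [HL _]].
  - exact Hd.
  - intros; now apply ex_RInt_cont.
  - intros u. assert (Hq := theta_excess_nonneg j u). assert (Q := exp_pos (s * u)).
    rewrite Rabs_pos_eq by (apply Rmult_le_pos; lra).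
    apply Rle_trans with (exp (s * u) * (C2 * exp (- (s + d) * u)));
      [apply Rmult_le_compat_l; [lra|apply H2]|].
    replace (exp (s * u) * (C2 * exp (- (s + d) * u))) with (C2 * exp (- d * u)).
    + assert (R := exp_pos (- d * u)). nra.
    + replace (- d * u) with (s * u + - (s + d) * u) by ring. rewrite exp_plus. ring.
  - intros u. assert (Hq := theta_excess_nonneg j u). assert (Q := exp_pos (s * u)).
    rewrite Rabs_pos_eq by (apply Rmult_le_pos; lra).
    apply Rle_trans with (exp (s * u) * (C1 * exp (- (INR j / 2) * u)));
      [apply Rmult_le_compat_l; [lra|apply H1]|].
    replace (exp (s * u) * (C1 * exp (- (INR j / 2) * u))) with (C1 * exp (d * u)).
    + assert (R := exp_pos (d * u)). nra.
    + replace (d * u) with (s * u + - (INR j / 2) * u) by (unfold d; ring). rewrite exp_plus. ring.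
  - assert (HS : is_series (fun n => Rpower PI (- s) * Gamma s *
      (INR (r j (S n)) * Rpower (INR (S n)) (- s))) L).
    { apply (tonelli_series (fun n u => exp (s * u) *
        (INR (r j (S n)) * exp (- (PI * exp u) * INR (S n))))
        (fun u => exp (s * u) * theta_excess j u)).
      - intros n u. repeat apply Rmult_le_pos; try apply pos_INR; left; apply exp_pos.
      - intros n x. apply (ex_derive_continuous
          (fun u => exp (s * u) * (INR (r j (S n)) * exp (- (PI * exp u) * INR (S n))))).
        auto_derive. auto.
      - exact CF.
      - intros u. apply (is_series_scal_l (exp (s * u)) _ _ (theta_excess_series j u)).
      - intros n. assert (Hn : 0 < INR (S n)) by (apply lt_0_INR; lia).
        assert (Hpn : 0 < PI * INR (S n)) by now apply Rmult_lt_0_compat.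
        rewrite <- Rmult_assoc, (Rmult_comm _ (INR (r j (S n)))).
        replace (INR (r j (S n)) * (Rpower PI (- s) * Gamma s) * Rpower (INR (S n)) (- s))
          with (INR (r j (S n)) * (Rpower (PI * INR (S n)) (- s) * Gamma s))
            by (rewrite <- Rpower_mult_distr by lra; ring).
        eapply integ_ext; [|apply integ_scal; apply integ_Gamma_scaled; [lra|exact Hpn]].
        intros u. cbv beta. unfold Rminus. rewrite exp_plus.
        replace (- (PI * exp u) * INR (S n)) with (- (PI * INR (S n) * exp u)) by ring. ring.
      - exact HL. }
    apply is_series_unique in HS. rewrite Series_scal_l in HS. unfold eta, zeta. rewrite HS. exact HL.
Qed.

(** A vector of squared norm n in Z^(k-1) enters through the reflected factor as a damping e^(-pi n
    / x) of theta - 1. With y = 2 pi sqrt(n) the damped integral is - 2 times the logarithm of one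
    factor of [Phi]. *)
Lemma integ_Phi (k : nat) : (1 <= k)%nat ->
  integ (fun u => exp (u / 2) * theta_excess (k - 1) (- u) * theta_excess 1 u) (- 2 * ln (Phi k)).
Proof.
  intros Hk. set (j := (k - 1)%nat). assert (Hj := pos_INR j). assert (P := PI_RGT_0).
  assert (Cq : forall x, continuous (fun u => theta_excess j (- u)) x).
  { intros x. apply (continuous_comp Ropp (theta_excess j)); [|apply theta_excess_continuous].
    apply (ex_derive_continuous Ropp). auto_derive. auto. }
  assert (CF : forall x, continuous (fun u => exp (u / 2) * theta_excess j (- u) * theta_excess 1 u) x).
  { intros x. apply (continuous_mult (fun u => exp (u / 2) * theta_excess j (- u)) (theta_excess 1));
      [|apply theta_excess_continuous].
    apply (continuous_mult (fun u => exp (u / 2)) (fun u => theta_excess j (- u))); [|apply Cq].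
    apply (ex_derive_continuous (fun u => exp (u / 2))). auto_derive. auto. }
  assert (Hbd : forall C C' N N' u, (forall u, theta_excess j u <= C * exp (- N * u)) ->
    (forall u, theta_excess 1 u <= C' * exp (- N' * u)) ->
     0 < C -> 0 < C' ->
     Rabs (exp (u / 2) * theta_excess j (- u) * theta_excess 1 u) <= C * C' * exp ((/ 2 + N - N') * u)).
  { intros C C' N N' u H H' HC HC'. assert (Q := exp_pos (u / 2)).
    assert (Hq := theta_excess_nonneg j (- u)). assert (Hq' := theta_excess_nonneg 1 u).
    rewrite Rabs_pos_eq by (repeat apply Rmult_le_pos; lra).
    replace ((/ 2 + N - N') * u) with (u / 2 + (- N * - u + - N' * u)) by field. rewrite !exp_plus.
    replace (C * C' * (exp (u / 2) * (exp (- N * - u) * exp (- N' * u))))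
      with (exp (u / 2) * (C * exp (- N * - u)) * (C' * exp (- N' * u))) by ring.
    apply Rmult_le_compat; [apply Rmult_le_pos; lra|exact Hq'| |apply H'].
    apply Rmult_le_compat_l; [lra|apply H]. }
  (* Exponents N and N' bound the product by e^((1/2 + N - N') u); the two pairs chosen here give
     the rates - 1/2 and 1/2. *)
  destruct (theta_excess_bound j (INR j / 2)) as [C1 [HC1 H1]]; [lra|].
  destruct (theta_excess_bound 1 (INR j / 2 + 1)) as [C1' [HC1' H1']]; [simpl; lra|].
  destruct (theta_excess_bound j (INR j / 2 + / 2)) as [C2 [HC2 H2]]; [lra|].
  destruct (theta_excess_bound 1 (INR j / 2 + / 2)) as [C2' [HC2' H2']]; [simpl; lra|].
  assert (Hp1 : 0 < C1 * C1') by now apply Rmult_lt_0_compat.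
  assert (Hp2 : 0 < C2 * C2') by now apply Rmult_lt_0_compat.
  destruct (integ_exp_bound (fun u => exp (u / 2) * theta_excess j (- u) * theta_excess 1 u)
    (C1 * C1' + C2 * C2') (/ 2)) as [L [HL _]].
  - lra.
  - intros; now apply ex_RInt_cont.
  - intros u. eapply Rle_trans; [apply (Hbd C1 C1' _ _ u H1 H1' HC1 HC1')|].
    replace (/ 2 + INR j / 2 - (INR j / 2 + 1)) with (- / 2) by field.
    assert (Q := exp_pos (- / 2 * u)). nra.
  - intros u. eapply Rle_trans; [apply (Hbd C2 C2' _ _ u H2 H2' HC2 HC2')|].
    replace (/ 2 + (INR j / 2 + / 2) - (INR j / 2 + / 2)) with (/ 2) by field.
    assert (Q := exp_pos (/ 2 * u)). nra.
  - pose (g := fun n => match n with O => 0 | S _ => - ln (1 - exp (- 2 * PI * sqrt (INR n))) end).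
    assert (HS : is_series (fun n => 2 * (INR (r j (S n)) * g (S n))) L).
    { apply (tonelli_series (fun n u => exp (u / 2) *
        (INR (r j (S n)) * exp (- (PI * exp (- u)) * INR (S n))) * theta_excess 1 u)
        (fun u => exp (u / 2) * theta_excess j (- u) * theta_excess 1 u)).
      - intros n u. assert (Hq' := theta_excess_nonneg 1 u).
        repeat apply Rmult_le_pos; try apply pos_INR; try exact Hq'; left; apply exp_pos.
      - intros n x. apply (continuous_mult
          (fun u => exp (u / 2) * (INR (r j (S n)) * exp (- (PI * exp (- u)) * INR (S n))))
            (theta_excess 1)); [|apply theta_excess_continuous].
        apply (ex_derive_continuous (fun u => exp (u / 2) *
          (INR (r j (S n)) * exp (- (PI * exp (- u)) * INR (S n))))).
        auto_derive. auto.
      - exact CF.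
      - intros u. assert (S1 := is_series_scal_l (exp (u / 2) * theta_excess 1 u) _ _
          (theta_excess_series j (- u))).
        replace (exp (u / 2) * theta_excess j (- u) * theta_excess 1 u) with
          (exp (u / 2) * theta_excess 1 u * theta_excess j (- u)) by ring.
        eapply is_series_ext; [|exact S1]. intros n. cbv beta. unfold scal; simpl; unfold mult; simpl.
        ring.
      - intros n. assert (Hn : 0 < INR (S n)) by (apply lt_0_INR; lia).
        assert (Hsn : 0 < sqrt (INR (S n))) by now apply sqrt_lt_R0.
        assert (Hy : 0 < 2 * PI * sqrt (INR (S n))) by (apply Rmult_lt_0_compat; [lra|exact Hsn]).
        assert (B := integ_damped_theta_excess1 _ Hy).
        replace ((2 * PI * sqrt (INR (S n))) ^ 2 / (4 * PI)) with (PI * INR (S n)) in B.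
        2:{ rewrite !Rpow_mult_distr, pow2_sqrt by lra. field. lra. }
        unfold g. replace (- 2 * PI * sqrt (INR (S n))) with (- (2 * PI * sqrt (INR (S n)))) by ring.
        replace (2 * (INR (r j (S n)) * - ln (1 - exp (- (2 * PI * sqrt (INR (S n)))))))
          with (INR (r j (S n)) * (- 2 * ln (1 - exp (- (2 * PI * sqrt (INR (S n))))))) by ring.
        eapply integ_ext; [|apply integ_scal; exact B]. intros u. cbv beta.
        replace (- (PI * exp (- u)) * INR (S n)) with (- (PI * INR (S n) * exp (- u))) by ring. ring.
      - exact HL. }
    assert (HS2 : is_series (fun n => INR (r (k - 1) (S n)) * g (S n)) (L / 2)).
    { assert (S2 := is_series_scal_l (/ 2) _ _ HS). replace (L / 2) with (scal (/ 2) L).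
      - eapply is_series_ext; [|exact S2]. intros n. unfold scal; simpl; unfold mult; simpl. fold j. toR.
        field.
      - unfold scal; simpl; unfold mult; simpl. toR. field. }
    rewrite (Phi_eq k g (L / 2)); [|reflexivity|reflexivity|exact HS2].
    rewrite ln_exp. replace (- 2 * - (L / 2)) with L by field. exact HL.
Qed.

(* The first Kronecker limit formula, as the constant term of
   [pi^(-s) Gamma(s) zeta_k(s)] at the pole [s = k/2]. *)
Lemma integ_kronecker (k : nat) : (1 <= k)%nat ->
  integ (fun u => exp (INR k / 2 * u) * theta_excess k u - step u)
    (eta (k - 1) (INR k / 2) + euler_gamma - 2 * ln (Phi k) - ln (4 * PI)).
Proof.
  intros Hk. destruct k as [|j]; [lia|].
  assert (H1 := integ_Phi (S j) Hk). assert (H2 := integ_theta_excess1_reg).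
  replace (S j - 1)%nat with j in * by lia.
  assert (Hs : INR j / 2 < INR (S j) / 2) by (rewrite S_INR; lra).
  assert (H3 := integ_eta j _ Hs).
  replace (eta j (INR (S j) / 2) + euler_gamma - 2 * ln (Phi (S j)) - ln (4 * PI))
    with (- 2 * ln (Phi (S j)) + eta j (INR (S j) / 2) + (euler_gamma - ln (4 * PI))) by ring.
  (* Put T = theta(e^u), T' = theta(e^(-u)), k = j + 1. Since T'^j = e^(ju/2) T^j, the terms e^(u/2)
     (T'^j - 1) (T - 1), e^(ku/2) (T^j - 1) and e^(u/2) (T - 1) add up to e^(ku/2) (T^k - 1). *)
  eapply integ_ext; [|apply integ_plus; [apply integ_plus; [exact H1|exact H3]|exact H2]].
  intros u. cbv beta. unfold theta_excess1_reg, theta_excess. rewrite pow_1, theta_pow_reflect.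
  replace (INR (S j) / 2 * u) with (u / 2 + INR j / 2 * u) by (rewrite S_INR; field).
  rewrite exp_plus. simpl pow. ring.
Qed.

(** * The Bessel series *)

Lemma cosh_ge (t : R) : t / 2 <= cosh t /\ - t / 2 <= cosh t.
Proof.
  unfold cosh. assert (H1 := exp_ineq1_le t). assert (H2 := exp_ineq1_le (- t)).
  assert (P1 := exp_pos t). assert (P2 := exp_pos (- t)). split; lra.
Qed.

Lemma integ_K0 (x : R) : 0 < x -> integ (fun t => exp (- x * cosh t)) (2 * K0 x).
Proof.
  intros Hx.
  assert (C0 : forall t, continuous (fun t => exp (- x * cosh t)) t).
  { intros t. apply (ex_derive_continuous (fun t => exp (- x * cosh t))). unfold cosh. auto_derive. auto.
    }
  destruct (integ_exp_bound (fun t => exp (- x * cosh t)) 1 (x / 2)) as [l [Hl _]].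
  - lra.
  - intros; now apply ex_RInt_cont.
  - intros t. rewrite Rabs_pos_eq, Rmult_1_l by (left; apply exp_pos). apply exp_le_mono.
    assert (H := cosh_ge t). nra.
  - intros t. rewrite Rabs_pos_eq, Rmult_1_l by (left; apply exp_pos). apply exp_le_mono.
    assert (H := cosh_ge t). nra.
  - replace (2 * K0 x) with l; [exact Hl|].
    assert (L : is_lim_seq (fun n => RInt (fun t => exp (- x * cosh t)) 0 (INR n)) (l / 2)).
    { apply integ_even_half; [|exact Hl|apply is_lim_seq_INR].
      intros t. do 2 f_equal. unfold cosh. rewrite Ropp_involutive. f_equal. ring. }
    unfold K0. rewrite (is_lim_seq_unique _ _ L). cbn [real]. field.
Qed.

(** Since m e^s + n e^(-s) = 2 sqrt(mn) cosh(s + ln sqrt(m/n)), a shift absorbs the asymmetry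
    between [m] and [n]. *)
Lemma integ_K0_pair (c m n : R) : 0 < m -> 0 < n ->
  integ (fun s => exp (- (PI * exp (s + c)) * m) * exp (- (PI * exp (- s + c)) * n))
    (2 * K0 (2 * sqrt (m * n) * (PI * exp c))).
Proof.
  intros Hm Hn. assert (P := PI_RGT_0).
  assert (Hsm : 0 < sqrt m) by now apply sqrt_lt_R0. assert (Hsn : 0 < sqrt n) by now apply sqrt_lt_R0.
  assert (Hc := exp_pos c).
  assert (Hx : 0 < 2 * sqrt (m * n) * (PI * exp c)).
  { rewrite sqrt_mult by lra. assert (0 < sqrt m * sqrt n) by now apply Rmult_lt_0_compat.
    assert (0 < PI * exp c) by now apply Rmult_lt_0_compat. apply Rmult_lt_0_compat; lra. }
  assert (Hd : 0 < sqrt m / sqrt n) by now apply Rdiv_lt_0_compat.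
  eapply integ_ext; [|apply (integ_shift _ _ (ln (sqrt m / sqrt n)) (integ_K0 _ Hx))].
  intros s. cbv beta. rewrite <- exp_plus. f_equal. unfold cosh.
  rewrite Ropp_plus_distr, !exp_plus, (exp_Ropp (ln _)), exp_ln, sqrt_mult by lra.
  assert (Em : m = sqrt m * sqrt m) by (symmetry; apply sqrt_sqrt; lra).
  assert (En : n = sqrt n * sqrt n) by (symmetry; apply sqrt_sqrt; lra).
  clear Hx. set (x := sqrt m) in *. set (y := sqrt n) in *. clearbody x y.
  rewrite Em, En. field. lra.
Qed.

(** Two uses of [tonelli_series], over [n] for fixed [m] and then over [m], following the nesting in
    [bessel_sum]; every intermediate integrand is dominated by the full product. *)
Lemma integ_bessel_sum (k : nat) (c : R) :
  integ (fun s => theta_excess k (s + c) * theta_excess k (- s + c)) (2 * bessel_sum k (PI * exp c)).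
Proof.
  assert (Hk := pos_INR k). assert (P := PI_RGT_0).
  pose (N := INR k / 2).
  destruct (theta_excess_bound k N) as [C1 [HC1 H1]]; [unfold N; lra|].
  destruct (theta_excess_bound k (N + 1)) as [C2 [HC2 H2]]; [unfold N; lra|].
  assert (HC : 0 < C1 * C2) by now apply Rmult_lt_0_compat.
  pose (K := C1 * C2 * exp (- (2 * N + 1) * c)).
  (* Exponents N + 1 and N for the two factors leave the decay e^(-s); exchanging s and -s gives the
     other end. *)
  assert (Hr : forall s, theta_excess k (s + c) * theta_excess k (- s + c) <= K * exp (- (1) * s)).
  { intros s. unfold K. apply Rle_trans with
      (C2 * exp (- (N + 1) * (s + c)) * (C1 * exp (- N * (- s + c)))).
    - apply Rmult_le_compat; auto using theta_excess_nonneg.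
    - right. rewrite !Rmult_assoc, <- exp_plus.
      replace (- (2 * N + 1) * c + - (1) * s) with (- (N + 1) * (s + c) + - N * (- s + c)) by ring.
      rewrite exp_plus. ring. }
  assert (Hl : forall s, theta_excess k (s + c) * theta_excess k (- s + c) <= K * exp (1 * s)).
  { intros s. assert (G := Hr (- s)). rewrite Ropp_involutive in G.
    replace (- (1) * - s) with (1 * s) in G by ring. rewrite Rmult_comm. exact G. }
  assert (Cr : forall x, continuous (fun s => theta_excess k (s + c)) x).
  { intros x. apply (continuous_comp (fun s => s + c) (theta_excess k));
      [|apply theta_excess_continuous].
    apply (ex_derive_continuous (fun s => s + c)). auto_derive. auto. }
  assert (Cl : forall x, continuous (fun s => theta_excess k (- s + c)) x).
  { intros x. apply (continuous_comp (fun s => - s + c) (theta_excess k));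
      [|apply theta_excess_continuous].
    apply (ex_derive_continuous (fun s => - s + c)). auto_derive. auto. }
  assert (CF : forall x, continuous (fun s => theta_excess k (s + c) * theta_excess k (- s + c)) x).
  { intros x. apply (continuous_mult (fun s => theta_excess k (s + c))
      (fun s => theta_excess k (- s + c))); auto. }
  assert (Hex : forall f, (forall x, continuous f x) ->
    (forall s, 0 <= f s <= theta_excess k (s + c) * theta_excess k (- s + c)) ->
     exists L, integ f L).
  { intros f Cf Hf. destruct (integ_exp_bound f K 1) as [L [HL _]].
    - lra.
    - intros; now apply ex_RInt_cont.
    - intros u. specialize (Hf u). rewrite Rabs_pos_eq by lra. specialize (Hr u). lra.
    - intros u. specialize (Hf u). rewrite Rabs_pos_eq by lra. specialize (Hl u). lra.
    - exists L; exact HL. }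
  destruct (Hex _ CF) as [L HL].
  { intros s. split; [apply Rmult_le_pos; apply theta_excess_nonneg|lra]. }
  pose (a := fun (m : nat) s => INR (r k (S m)) * exp (- (PI * exp (s + c)) * INR (S m))).
  pose (b := fun (n : nat) s => INR (r k (S n)) * exp (- (PI * exp (- s + c)) * INR (S n))).
  assert (Ha : forall m s, 0 <= a m s)
    by (intros; apply Rmult_le_pos; [apply pos_INR|left; apply exp_pos]).
  assert (Hb : forall m s, 0 <= b m s)
    by (intros; apply Rmult_le_pos; [apply pos_INR|left; apply exp_pos]).
  assert (Ca : forall m x, continuous (a m) x).
  { intros m x. apply (ex_derive_continuous (a m)). unfold a. auto_derive. auto. }
  assert (Cb : forall m x, continuous (b m) x).
  { intros m x. apply (ex_derive_continuous (b m)). unfold b. auto_derive. auto. }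
  assert (Hale : forall m s, a m s <= theta_excess k (s + c)).
  { intros m s. eapply Rle_trans;
      [|apply (is_series_le_bound _ _ m (fun n => Ha n s) (theta_excess_series k (s + c)))].
    destruct m as [|m]; [rewrite sum_O; apply Rle_refl|]. rewrite sum_Sn.
    assert (0 <= sum_n (fun n => a n s) m).
    { rewrite sum_n_Reals. apply cond_pos_sum. intros; apply Ha. }
    unfold plus; simpl AbelianMonoid.plus. change (a (S m) s <= sum_n (fun n => a n s) m + a (S m) s).
    lra. }
  assert (Cab : forall m x, continuous (fun s => a m s * theta_excess k (- s + c)) x).
  { intros m x. apply (continuous_mult (a m) (fun s => theta_excess k (- s + c))); auto. }
  pose (t := fun m n => INR (r k (S m)) * INR (r k (S n)) * K0
    (2 * sqrt (INR (S m) * INR (S n)) * (PI * exp c))).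
  assert (Hin : forall m, integ (fun s => a m s * theta_excess k (- s + c)) (2 * Series (t m))).
  { intros m. destruct (Hex _ (Cab m)) as [l Hlm].
    { intros s. split; [apply Rmult_le_pos; [apply Ha|apply theta_excess_nonneg]|].
      apply Rmult_le_compat_r; [apply theta_excess_nonneg|apply Hale]. }
    assert (HS : is_series (fun n => 2 * t m n) l).
    { apply (tonelli_series (fun n s => a m s * b n s) (fun s => a m s * theta_excess k (- s + c))).
      - intros n s. apply Rmult_le_pos; auto.
      - intros n x. apply (continuous_mult (a m) (b n)); auto.
      - apply Cab.
      - intros s. apply (is_series_scal_l (a m s) _ _ (theta_excess_series k (- s + c))).
      - intros n. assert (Hm1 : 0 < INR (S m)) by (apply lt_0_INR; lia).
        assert (Hn1 : 0 < INR (S n)) by (apply lt_0_INR; lia).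
        unfold t. replace (2 * (INR (r k (S m)) * INR (r k (S n)) * K0
          (2 * sqrt (INR (S m) * INR (S n)) * (PI * exp c))))
          with (INR (r k (S m)) * INR (r k (S n)) *
            (2 * K0 (2 * sqrt (INR (S m) * INR (S n)) * (PI * exp c)))) by ring.
        eapply integ_ext; [|apply integ_scal; apply (integ_K0_pair c _ _ Hm1 Hn1)].
        intros s. cbv beta. unfold a, b. ring.
      - exact Hlm. }
    apply is_series_unique in HS. rewrite Series_scal_l in HS. rewrite HS. exact Hlm. }
  assert (HS : is_series (fun m => 2 * Series (t m)) L).
  { apply (tonelli_series (fun m s => a m s * theta_excess k (- s + c))
      (fun s => theta_excess k (s + c) * theta_excess k (- s + c))).
    - intros n s. apply Rmult_le_pos; [apply Ha|apply theta_excess_nonneg].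
    - exact Cab.
    - exact CF.
    - intros s. assert (S1 := is_series_scal_l (theta_excess k (- s + c)) _ _
        (theta_excess_series k (s + c))).
      rewrite Rmult_comm. eapply is_series_ext; [|exact S1]. intros n. apply Rmult_comm.
    - exact Hin.
    - exact HL. }
  apply is_series_unique in HS. rewrite Series_scal_l in HS. unfold bessel_sum. fold t. 
  change (integ (fun s => theta_excess k (s + c) * theta_excess k (- s + c))
    (2 * Series (fun m => Series (t m)))). rewrite HS. exact HL.
Qed.

(** * Modularity *)

(** By reflection theta(e^(-u))^k is the regularized integrand plus [step] plus e^(ku/2). Only the
    first has a limiting integral; [step] contributes the length n + c of the negative part of the
    window, the source of the linear term in c. *)
Lemma integ_reg_window (k : nat) (V c : R) : (1 <= k)%nat ->
  integ (fun u => exp (INR k / 2 * u) * theta_excess k u - step u) V ->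
  exists J : nat -> R, is_lim_seq J V /\ exists N, forall n, (N <= n)%nat ->
    RInt (fun u => theta (exp (- u)) ^ k) (- INR n - c) (INR n - c)
    = J n + (INR n + c) + 2 / INR k *
      (exp (INR k / 2 * (INR n - c)) - exp (- (INR k / 2) * (INR n + c))).
Proof.
  intros Hk HV. assert (Hk0 : 0 < INR k) by (apply lt_0_INR; lia).
  exists (fun n => RInt (fun u => exp (INR k / 2 * u) * theta_excess k u - step u) (- INR n - c)
    (INR n - c)). split.
  - assert (Hp : forall d, is_lim_seq (fun n => INR n + d) p_infty).
    { intros d. apply (is_lim_seq_plus _ _ p_infty d);
        [apply is_lim_seq_INR|apply is_lim_seq_const|reflexivity]. }
    apply is_lim_seq_RInt_integ; [exact HV| |].
    + apply (is_lim_seq_ext (fun n => - (INR n + c))); [intros; ring|].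
      apply (is_lim_seq_opp _ p_infty), Hp.
    + apply Hp.
  (* For n > |c| the point 0 lies inside the window. *)
  - destruct (nfloor_ex (Rabs c) (Rabs_pos c)) as [N [_ HN]]. exists (S N). intros n Hn.
    apply le_INR in Hn. rewrite S_INR in Hn.
    assert (Hc1 : c <= Rabs c) by apply Rle_abs.
    assert (Hc2 : - c <= Rabs c) by (rewrite <- Rabs_Ropp; apply Rle_abs).
    assert (Cexp : forall x, continuous (fun u => exp (INR k / 2 * u)) x).
    { intros x. apply (ex_derive_continuous (fun u => exp (INR k / 2 * u))). auto_derive. auto. }
    assert (E1 : RInt (fun u => exp (INR k / 2 * u)) (- INR n - c) (INR n - c)
      = 2 / INR k * (exp (INR k / 2 * (INR n - c)) - exp (- (INR k / 2) * (INR n + c)))).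
    { rewrite (RInt_derive_R (fun u => 2 / INR k * exp (INR k / 2 * u))).
      - replace (INR k / 2 * (- INR n - c)) with (- (INR k / 2) * (INR n + c)) by ring. toR. ring.
      - intros x. auto_derive; [auto|]. toR. field. lra.
      - exact Cexp. }
    assert (E2 : RInt step (- INR n - c) (INR n - c) = INR n + c).
    { rewrite RInt_step, Rmin_right, Rmin_left by lra. toR. ring. }
    rewrite <- E1, <- E2 at 1.
    rewrite <- RInt_plus_R by (apply HV || apply ex_RInt_step).
    rewrite <- RInt_plus_R.
    + apply RInt_ext. intros u _. rewrite theta_pow_reflect. unfold theta_excess. toR. ring.
    + apply (ex_RInt_plus (fun u => exp (INR k / 2 * u) * theta_excess k u - step u) step);
        [apply HV|apply ex_RInt_step].
    + apply ex_RInt_cont, Cexp.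
Qed.

(** The weights e^(kc/2) and e^(-kc/2) make the products of theta powers cancel pointwise. What
    remains is 1 minus two single powers, integrable on bounded windows only, and [integ_reg_window]
    evaluates these. *)
Lemma bessel_sum_modular (k : nat) (V c : R) : (1 <= k)%nat ->
  integ (fun u => exp (INR k / 2 * u) * theta_excess k u - step u) V ->
  exp (INR k / 2 * c) * (V + c + bessel_sum k (PI * exp c))
  = exp (- (INR k / 2 * c)) * (V - c + bessel_sum k (PI * exp (- c))).
Proof.
  intros Hk HV. assert (Hk0 : 0 < INR k) by (apply lt_0_INR; lia).
  set (A := exp (INR k / 2 * c)). set (B := exp (- (INR k / 2 * c))).
  assert (HAB : A * B = 1) by (unfold A, B; rewrite <- exp_plus, <- exp_0; f_equal; ring).
  assert (I := integ_minus _ _ _ _ (integ_scal _ _ A (integ_bessel_sum k c))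
    (integ_scal _ _ B (integ_bessel_sum k (- c)))).
  pose (W := fun u => theta (exp (- u)) ^ k).
  assert (CW : forall x, continuous W x).
  { intros x. unfold W. apply continuous_ext with (fun u => theta_excess k (- u) + 1).
    - intros u. unfold theta_excess. toR. ring.
    - apply (continuous_plus (fun u => theta_excess k (- u)) (fun _ => 1)); [|apply continuous_const].
      apply (continuous_comp Ropp (theta_excess k)); [|apply theta_excess_continuous].
      apply (ex_derive_continuous Ropp). auto_derive. auto. }
  assert (CWs : forall d x, continuous (fun s => W (s + d)) x).
  { intros d x. apply (continuous_comp (fun s => s + d) W); [|apply CW].
    apply (ex_derive_continuous (fun s => s + d)). auto_derive. auto. }
  assert (CWr : forall d x, continuous (fun s => W (- s + d)) x).
  { intros d x. apply (continuous_comp (fun s => - s + d) W); [|apply CW].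
    apply (ex_derive_continuous (fun s => - s + d)). auto_derive. auto. }
  assert (Hwin : forall d n, RInt (fun s => 1 - W (s - d) - W (- s - d)) (- INR n) (INR n)
     = 2 * INR n - 2 * RInt W (- INR n - d) (INR n - d)).
  { intros d n. rewrite RInt_minus_R, RInt_minus_R, RInt_const_R.
    - unfold Rminus. rewrite (RInt_reflect (fun s => W (s + - d))) by (apply ex_RInt_cont, CWs).
      rewrite Ropp_involutive, (RInt_shift W) by (apply ex_RInt_cont, CW). toR. ring.
    - apply ex_RInt_const.
    - apply ex_RInt_cont. apply (CWs (- d)).
    - apply (ex_RInt_minus (fun _ => 1) (fun s => W (s - d)));
        [apply ex_RInt_const|apply ex_RInt_cont, (CWs (- d))].
    - apply ex_RInt_cont. apply (CWr (- d)). }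
  assert (Hpt : forall s, A * (theta_excess k (s + c) * theta_excess k (- s + c)) - B *
    (theta_excess k (s + - c) * theta_excess k (- s + - c))
     = A * (1 - W (s - c) - W (- s - c)) - B * (1 - W (s - - c) - W (- s - - c))).
  { intros s. unfold theta_excess, W.
    replace (- (s - c)) with (- s + c) by ring. replace (- (- s - c)) with (s + c) by ring.
    replace (- (s - - c)) with (- s + - c) by ring. replace (- (- s - - c)) with (s + - c) by ring.
    assert (X1 := theta_pow_reflect k (s + c)). assert (X2 := theta_pow_reflect k (- s + c)).
    replace (- (s + c)) with (- s + - c) in X1 by ring.
    replace (- (- s + c)) with (s + - c) in X2 by ring.
    (* Poisson summation in both factors: the arguments s + c and - s + c add up to 2c, so the
       automorphy factors multiply to A^2, free of s. *)
    assert (X3 : B * (theta (exp (s + - c)) ^ k * theta (exp (- s + - c)) ^ k) = A *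
      (theta (exp (s + c)) ^ k * theta (exp (- s + c)) ^ k)).
    { rewrite X1, X2.
      assert (X4 : exp (INR k / 2 * (s + c)) * exp (INR k / 2 * (- s + c)) = A * A).
      { unfold A. rewrite <- !exp_plus. f_equal. field. }
      transitivity ((A * B) * A * (theta (exp (s + c)) ^ k * theta (exp (- s + c)) ^ k)).
      - transitivity (B * (exp (INR k / 2 * (s + c)) * exp (INR k / 2 * (- s + c))) *
          (theta (exp (s + c)) ^ k * theta (exp (- s + c)) ^ k)); [ring|].
        rewrite X4. ring.
      - rewrite HAB. ring. }
    lra. }
  destruct (integ_reg_window k V c Hk HV) as [J [HJ [N1 E1]]].
  destruct (integ_reg_window k V (- c) Hk HV) as [J' [HJ' [N2 E2]]].
  assert (L1 := is_lim_seq_RInt_integ _ _ (fun n => - INR n) INR I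
    (proj1 (is_lim_seq_opp INR p_infty) is_lim_seq_INR) is_lim_seq_INR).
  assert (Hexp : forall d, is_lim_seq (fun n => 2 / INR k * exp (- (INR k / 2) * (INR n + d))) 0).
  { intros d. apply is_lim_seq_spec. intros eps.
    destruct (exp_neg_small (2 / INR k) (INR k / 2) eps) as [T [_ HT]];
      [lra|left; apply Rdiv_lt_0_compat; lra|apply cond_pos|].
    destruct (nfloor_ex (Rabs (T - d)) (Rabs_pos _)) as [N [_ HN]]. exists (S N). intros n Hn.
    apply le_INR in Hn. rewrite S_INR in Hn. assert (Q := Rle_abs (T - d)).
    rewrite Rminus_0_r, Rabs_pos_eq.
    - apply HT. lra.
    - apply Rmult_le_pos; [left; apply Rdiv_lt_0_compat; lra|left; apply exp_pos]. }
  assert (L2 : is_lim_seq (fun n => - 2 * A * (J n + c - 2 / INR k * exp (- (INR k / 2) * (INR n + c)))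
      + 2 * B * (J' n + - c - 2 / INR k * exp (- (INR k / 2) * (INR n + - c))))
          (- 2 * A * (V + c - 0) + 2 * B * (V + - c - 0))).
  { apply is_lim_seq_plus'; (apply is_lim_seq_mult'; [apply is_lim_seq_const|]);
      (apply is_lim_seq_minus'; [|apply Hexp]);
        (apply is_lim_seq_plus'; [assumption|apply is_lim_seq_const]). }
  assert (L3 : is_lim_seq (fun n => - 2 * A * (J n + c - 2 / INR k * exp (- (INR k / 2) * (INR n + c)))
      + 2 * B * (J' n + - c - 2 / INR k * exp (- (INR k / 2) * (INR n + - c))))
      (A * (2 * bessel_sum k (PI * exp c)) - B * (2 * bessel_sum k (PI * exp (- c))))).
  { eapply is_lim_seq_ext_loc; [|exact L1]. exists (N1 + N2)%nat. intros n Hn. cbv beta.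
    assert (En1 := E1 n ltac:(lia)). assert (En2 := E2 n ltac:(lia)). fold W in En1, En2.
    assert (Ei : forall d x, continuous (fun s => 1 - W (s - d) - W (- s - d)) x).
    { intros d x. apply (continuous_minus (fun s => 1 - W (s - d)) (fun s => W (- s - d)));
        [|apply (CWr (- d))].
      apply (continuous_minus (fun _ => 1) (fun s => W (s - d)));
        [apply continuous_const|apply (CWs (- d))]. }
    rewrite (RInt_ext _ (fun s => A * (1 - W (s - c) - W (- s - c)) - B *
      (1 - W (s - - c) - W (- s - - c)))) by (intros s _; apply Hpt).
    rewrite RInt_minus_R, !RInt_scal_R, !Hwin, En1, En2.
    (* The exponentially large boundary terms agree: both equal e^(kn/2). *)
    - assert (X : A * exp (INR k / 2 * (INR n - c)) = B * exp (INR k / 2 * (INR n - - c))).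
      { unfold A, B. rewrite <- !exp_plus. f_equal. field. }
      transitivity (- 2 * A * (J n + c - 2 / INR k * exp (- (INR k / 2) * (INR n + c)))
         + 2 * B * (J' n + - c - 2 / INR k * exp (- (INR k / 2) * (INR n + - c)))
         + 4 / INR k * (B * exp (INR k / 2 * (INR n - - c)) - A * exp (INR k / 2 * (INR n - c)))).
      + toR. field. lra.
      + rewrite X. ring.
    - apply ex_RInt_cont, Ei.
    - apply ex_RInt_cont, Ei.
    - apply (ex_RInt_scal (fun s => 1 - W (s - c) - W (- s - c))), ex_RInt_cont, Ei.
    - apply (ex_RInt_scal (fun s => 1 - W (s - - c) - W (- s - - c))), ex_RInt_cont, Ei. }
  assert (E := is_lim_seq_unique _ _ L3). rewrite (is_lim_seq_unique _ _ L2) in E.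
  apply (f_equal real) in E. cbn [real] in E. lra.
Qed.

Theorem theorem2 (k : nat) (alpha beta : R) :
  (1 <= k)%nat -> 0 < alpha -> 0 < beta -> alpha * beta = PI ^ 2 ->
  Rpower alpha (INR k / 2) * bracket k alpha beta
  = Rpower beta (INR k / 2) * bracket k beta alpha.
Proof.
  intros Hk Ha Hb Hab. assert (P := PI_RGT_0).
  set (c := ln (alpha / PI)).
  assert (Hap : 0 < alpha / PI) by (apply Rdiv_lt_0_compat; lra).
  assert (Ec : exp c = alpha / PI) by (unfold c; now apply exp_ln).
  assert (Ea : alpha = PI * exp c) by (rewrite Ec; field; lra).
  assert (Eb : beta = PI * exp (- c)).
  { rewrite exp_Ropp, Ec. apply Rmult_eq_reg_l with alpha; [|lra]. rewrite Hab. field. lra. }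
  assert (Pc := exp_pos c). assert (Pc' := exp_pos (- c)).
  assert (M := bessel_sum_modular k _ c Hk (integ_kronecker k Hk)).
  assert (Pa : 0 < PI * exp c) by (rewrite <- Ea; exact Ha).
  assert (Pb : 0 < PI * exp (- c)) by (rewrite <- Eb; exact Hb).
  (* As ln(4 beta) = ln(4 pi) - c, the left bracket is twice the sum of the constant of
     [integ_kronecker], c and the Bessel sum; the right one has - c. The factor pi^(k/2) is common
     to both sides. *)
  unfold bracket, Rpower. rewrite Ea, Eb, !ln_mult, !ln_exp by lra.
  rewrite ln_mult in M by lra.
  replace (INR k / 2 * (ln PI + c)) with (INR k / 2 * ln PI + INR k / 2 * c) by ring.
  replace (INR k / 2 * (ln PI + - c)) with (INR k / 2 * ln PI + - (INR k / 2 * c)) by ring.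
  rewrite !exp_plus, !Rmult_assoc. f_equal.
  set (A := exp (INR k / 2 * c)) in *. set (B := exp (- (INR k / 2 * c))) in *. lra.
Qed.
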